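(* Let $\frac12<\alpha<1$, $s,d\in\mathbb N$, $D=sd$. For $n=1,\dots,d$ and $l\in\mathbb N$ let $U^{(n)}_l$ be a randomized QMC quadrature based on a scrambled $(0,l-1,s)$-net in base $b$. Let $A(L,d)$, $L\ge d$, denote the corresponding Smolyak method approximating the integral $I_D:H^\alpha_{\rm mix}([0,1]^D)\to\mathbb R$, where the building blocks $(U^{(n)}_l)_{l,n}$ are all randomized independently, and denote by $N$ the number of function evaluations performed by $A(L,d)$. Since the Sobolev space of dominated mixed smoothness $H^\alpha_{\rm mix}([0,1]^D)$ is continuously embedded in the Haar-wavelet space $\mathcal H^D_\alpha$, the upper error bound known for integrands from $\mathcal H^D_\alpha$ holds also for multivariate integration over $H^\alpha_{\rm mix}([0,1]^D)$, with the randomized error measured in the Sobolev norm instead of the Haar wavelet norm. That is, there exists a constant $C$ independent of $N$ such that $$\sup_{\|f\|_{H^\alpha_{\rm mix}([0,1]^D)}\le1}\left(\mathbf E\left[|A(L,d)f-I_Df|^2\right]\right)^{\frac12}\le C\,\frac{(\log N)^{(d-1)(1+\alpha)}}{N^{\alpha+\frac12}}.$$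
   Context: Notation: $\mathbb N=\{1,2,\dots\}$, $\mathbb N_0=\mathbb N\cup\{0\}$; $|\mathbf v|=\sum_r|v_r|$ for vectors. The base $b\in\mathbb N$, $b\ge2$, is fixed. $I_Df=\int_{[0,1)^D}f(\mathbf x)\,d\mathbf x$. Sobolev space. $H^\alpha[0,1]\subseteq L^2([0,1))$ is the (fractional, $L^2$-based) Sobolev space of smoothness $\alpha$ on $[0,1]$ (with any of its usual equivalent Hilbert space norms), and the Sobolev space of dominated mixed smoothness $H^\alpha_{\rm mix}([0,1]^D)$ is the $D$-fold tensor product Hilbert space of $H^\alpha[0,1]$. Haar-wavelet space. For $i=0,\dots,b-1$ let $\psi_i(x)=b^{1/2}\mathbb 1_{\lfloor bx\rfloor=i}-b^{-1/2}\mathbb 1_{\lfloor x\rfloor=0}$. For integers $j>0$ and $k\in\vartheta_{j-1}$ let $\psi^j_{i,k}(x)=b^{(j-1)/2}\psi_i(b^{j-1}x-k)$, and let $\psi^0_{0,0}=\mathbb 1_{[0,1)}$. Here $\theta_0=\{0\}$ and $\theta_j=\{0,\dots,b-1\}$ for $j\ge1$; $\vartheta_{-1}=\vartheta_0=\{0\}$ and $\vartheta_j=\{0,\dots,b^j-1\}$ for $j\ge1$. For $\mathbf j\in\mathbb N_0^D$ and $\mathbf i,\mathbf k$ with $i_t\in\theta_{j_t}$, $k_t\in\vartheta_{j_t-1}$ put $\Psi^{D,\mathbf j}_{\mathbf i,\mathbf k}(\mathbf x)=\prod_{t=1}^D\psi^{j_t}_{i_t,k_t}(x_t)$ and $\hat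 f^{\mathbf j}_{\mathbf i,\mathbf k}=\int_{[0,1)^D}f(\mathbf x)\Psi^{D,\mathbf j}_{\mathbf i,\mathbf k}(\mathbf x)\,d\mathbf x$. Then $\mathcal H^D_\alpha=\{f\in L^2([0,1)^D):\sum_{\mathbf j,\mathbf k,\mathbf i}b^{2\alpha|\mathbf j|}(\hat f^{\mathbf j}_{\mathbf i,\mathbf k})^2<\infty\}$, with inner product $\langle f,g\rangle=\sum_{\mathbf j,\mathbf k,\mathbf i}b^{2\alpha|\mathbf j|}\hat f^{\mathbf j}_{\mathbf i,\mathbf k}\hat g^{\mathbf j}_{\mathbf i,\mathbf k}$. Nets. For $j\in\mathbb N_0$, $0\le k<b^j$ let $E^j_k=[kb^{-j},(k+1)b^{-j})$. An $s$-dimensional elementary interval (in base $b$) is a product $E^{j_1}_{k_1}\times\cdots\times E^{j_s}_{k_s}$. For $m\in\mathbb N_0$, a finite set $\mathcal P\subset[0,1)^s$ is a $(0,m,s)$-net in base $b$ if each $s$-dimensional elementary interval of volume $b^{-m}$ contains exactly one point of $\mathcal P$ (so $|\mathcal P|=b^m$). Scrambling. A random $b$-ary scrambling $\sigma:[0,1)\to[0,1)$ of depth $m$ maps $x$ with $b$-ary digits $x_1,x_2,\dots$ (finite expansion chosen if possible) to the point with $b$-ary digits $y_1=\pi(x_1)$, $y_2=\pi_{x_1}(x_2)$, $y_3=\pi_{x_1,x_2}(x_3),\dots$ up to $y_m$, all further digits being $0$; here $\pi,\pi_{x_1},\pi_{x_1,x_2},\dots$ (one permutation for each possible digit prefix)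 are independent uniformly distributed permutations of $\{0,\dots,b-1\}$. Building blocks. $U^{(n)}_lf=b^{-(l-1)}\sum_{i=1}^{b^{l-1}}f(Y_i)$, where, for some $(0,l-1,s)$-net $\mathcal P^{(n)}_l=\{p_1,\dots,p_{b^{l-1}}\}$ in base $b$, $(Y_i)$ is the associated scrambled net consisting of the points $Y_i=(\sigma_1(p_{i,1})+b^{-(l-1)}\xi^1_i,\dots,\sigma_s(p_{i,s})+b^{-(l-1)}\xi^s_i)$, with independent random $b$-ary scramblings $\sigma_1,\dots,\sigma_s$ of depth $l-1$ and $\xi^t_i$ i.i.d. uniform on $[0,1)$, independent of all permutations (the $\sigma_t$ and $\xi^t_i$ depending also on $n$ and $l$). That the building blocks are randomized independently means that all permutations and all variables $\xi$ used for all $n\in\{1,\dots,d\}$, $l\in\mathbb N$ are independent. Put $U^{(n)}_0=0$. Smolyak method. With $\Delta^{(n)}_l=U^{(n)}_l-U^{(n)}_{l-1}$ ($l\in\mathbb N$) and $Q(L,d)=\{\mathbf l\in\mathbb N^d:|\mathbf l|\le L\}$, $L\in\mathbb N$, $L\ge d$, put $A(L,d)=\sum_{\mathbf l\in Q(L,d)}\bigotimes_{n=1}^d\Delta^{(n)}_{l_n}$. Equivalently $A(L,d)=\sum_{L-d+1\le|\mathbf l|\le L}(-1)^{L-|\mathbf l|}\binom{d-1}{L-|\mathbf l|}\bigotimes_{n=1}^dU^{(n)}_{l_n}$ (sum over $\mathbf l\in\mathbb N^d$). The number $N$ of function evaluations is the number of nodes used in the latter representation, $N=\sum_{\mathbf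 l\in\mathbb N^d,\ L-d+1\le|\mathbf l|\le L}b^{|\mathbf l|-d}$.
   Formalization: For d ≥ 2 the case L = d is excluded: there N = 1 and log N = 0, so the stated bound is 0 while the error of a single random evaluation is positive. The bound is proved for all other L ≥ d, and for every L when d = 1. *)

(* Defs.v *)
From HB Require Import structures.
From mathcomp Require Import all_boot all_order perm all_algebra.
From mathcomp Require Import all_classical all_reals all_analysis.

Set Implicit Arguments.
Unset Strict Implicit.
Unset Printing Implicit Defensive.

Import Order.TTheory GRing.Theory Num.Theory.
Import numFieldNormedType.Exports.

Local Open Scope classical_set_scope.
Local Open Scope ring_scope.

Section UnitCube.
Context {R : realType}.

Definition unit_cube (n : nat) : set (n.-tuple R) :=
  [set x | forall i, 0 <= tnth x i < 1].

(* measurableTypeR R is R, as the carrier of lebesgue_measure. *)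
Definition cons_point (n : nat) (z : measurableTypeR R * n.-tuple R) : n.+1.-tuple R :=
  [the n.+1.-tuple R of z.1 :: z.2].

Lemma measurable_cons_point (n : nat) :
  measurable_fun [set: measurableTypeR R * n.-tuple R] (@cons_point n).
Proof.
by apply: measurable_cons; [exact: measurable_fst | exact: measurable_snd].
Qed.

HB.instance Definition _ (n : nat) :=
  @isMeasurableFun.Build _ _ _ _ (@cons_point n) (@measurable_cons_point n).

(* The n-fold product of Lebesgue measure on [0, 1].  (uniform_prob lives on
   the closed interval; integrals are taken over [0, 1)^n, which has full
   measure.) *)
Fixpoint cube_measure (n : nat) : probability (n.-tuple R) R :=
  match n return probability (n.-tuple R) R with
  | 0%N => \d_([tuple] : 0.-tuple R)
  | n'.+1 => distribution
      ((uniform_prob (@ltr01 R) \x cube_measure n')%E : probability _ R)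
      (@cons_point n')
  end.

Definition cube_integral (n : nat) (f : n.-tuple R -> R) : R :=
  \int[cube_measure n]_(x in @unit_cube n) f x.

Definition cube_L2sq (n : nat) (f : n.-tuple R -> R) : \bar R :=
  (\int[cube_measure n]_(x in @unit_cube n) ((f x) ^+ 2)%:E)%E.

Definition cube_L2 (n : nat) (f : n.-tuple R -> R) : Prop :=
  measurable_fun (@unit_cube n) f /\ (cube_L2sq f < +oo)%E.

End UnitCube.

Section Sobolev.
Context {R : realType}.
Implicit Types (alpha : R) (f g h : R -> R).

Local Notation mu := (@lebesgue_measure R).

Definition unit_itv : set R := `[0, 1[.

Definition L2sq f : \bar R := (\int[mu]_(x in unit_itv) ((f x) ^+ 2)%:E)%E.

(* The integrand vanishes on the diagonal, since 0 `^ (1 + 2 alpha) = 0 and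
   0^-1 = 0. *)
Definition slobodeckij_sq alpha f : \bar R :=
  (\int[mu \x mu]_(z in unit_itv `*` unit_itv)
     ((f z.1 - f z.2) ^+ 2 / `|z.1 - z.2| `^ (1 + 2 * alpha))%:E)%E.

Definition sobolev_normsq alpha f : \bar R :=
  (L2sq f + slobodeckij_sq alpha f)%E.

(* H^alpha[0,1] for 0 < alpha < 1.  Elements are measurable functions, their
   values outside [0, 1) being irrelevant. *)
Definition sobolev alpha f : Prop :=
  measurable_fun unit_itv f /\ (sobolev_normsq alpha f < +oo)%E.

(* Any of the equivalent Hilbert space norms on H^alpha[0,1]: an inner product
   whose norm is equivalent to the Sobolev-Slobodeckij norm.  The two bounds
   make ip invariant under a.e. equality, definite modulo a.e. equality, and
   complete. *)
Record sobolev_inner_product alpha (ip : (R -> R) -> (R -> R) -> R) : Prop := {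
  sobolev_ip_sym : forall f g, sobolev alpha f -> sobolev alpha g ->
    ip f g = ip g f;
  sobolev_ip_linear : forall (a : R) f g h,
    sobolev alpha f -> sobolev alpha g -> sobolev alpha h ->
    ip (fun x => a * f x + g x) h = a * ip f h + ip g h;
  sobolev_ip_equiv : exists c1 c2 : R, [/\ 0 < c1, 0 < c2 &
    forall f, sobolev alpha f ->
      (c1%:E * sobolev_normsq alpha f <= (ip f f)%:E)%E /\
      ((ip f f)%:E <= c2%:E * sobolev_normsq alpha f)%E] }.

(* A finite sum of elementary tensors; scalar coefficients are absorbed in the
   factors. *)
Record ftensor (D : nat) := FTensor {
  ft_size : nat;
  ft_fac : 'I_ft_size -> 'I_D -> R -> R }.

Definition ft_eval (D : nat) (u : ftensor D) (x : D.-tuple R) : R :=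
  \sum_(i < ft_size u) \prod_(t < D) ft_fac i t (tnth x t).

Section MixedSpace.
Variables (alpha : R) (ip : (R -> R) -> (R -> R) -> R) (D : nat).
Implicit Types (u v : ftensor D) (F : D.-tuple R -> R).

Definition ft_ip u v : R :=
  \sum_(i < ft_size u) \sum_(j < ft_size v)
    \prod_(t < D) ip (ft_fac i t) (ft_fac j t).

Definition ft_distsq u v : R := ft_ip u u - 2 * ft_ip u v + ft_ip v v.

(* The Hilbert space tensor product is the completion of the algebraic one,
   identified with a space of functions through its injection into
   L^2([0,1)^D): F is represented by a sequence of finite tensors that is
   Cauchy for the tensor norm and tends to F in L^2. *)
Definition mix_represents F (u : nat -> ftensor D) : Prop :=
  [/\ forall k i t, sobolev alpha (@ft_fac _ (u k) i t),
      forall e : R, 0 < e -> exists K : nat, forall k l : nat,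
        (K <= k)%N -> (K <= l)%N -> ft_distsq (u k) (u l) < e
    & cube_L2sq (fun x => F x - ft_eval (u k) x) @[k --> \oo] --> 0%E].

Definition sobolev_mix F : Prop :=
  measurable_fun (@unit_cube R D) F /\ exists u : nat -> ftensor D, mix_represents F u.

(* The limit does not depend on the representing sequence. *)
Definition sobolev_mix_norm F : R :=
  Num.sqrt (xget 0 [set v : R | exists u : nat -> ftensor D, mix_represents F u /\
    ft_ip (u k) (u k) @[k --> \oo] --> v]).

End MixedSpace.

End Sobolev.

Section HaarSpace.
Context {R : realType}.
Variable b : nat.

Definition haar_mother (i : nat) (x : R) : R :=
  Num.sqrt b%:R * (Num.floor (b%:R * x) == i%:Z)%:R
  - (Num.sqrt b%:R)^-1 * (Num.floor x == 0)%:R.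

Definition haar (j i k : nat) (x : R) : R :=
  if j is j'.+1
  then Num.sqrt (b%:R ^+ j') * haar_mother i (b%:R ^+ j' * x - k%:R)
  else (x \in `[0%R, 1%R[)%:R.

Variable D : nat.

Definition haar_ix := {ffun 'I_D -> nat * nat * nat}.
Definition ix_j (q : haar_ix) (t : 'I_D) : nat := (q t).1.1.
Definition ix_i (q : haar_ix) (t : 'I_D) : nat := (q t).1.2.
Definition ix_k (q : haar_ix) (t : 'I_D) : nat := (q t).2.

(* For j = 0 the predecessor j.-1 is 0, so that k ranges over {0}. *)
Definition haar_range : set haar_ix :=
  [set q | forall t, (ix_i q t < if ix_j q t == 0 then 1 else b)%N
                  /\ (ix_k q t < b ^ (ix_j q t).-1)%N].

Definition haar_tensor (q : haar_ix) (x : D.-tuple R) : R :=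
  \prod_(t < D) haar (ix_j q t) (ix_i q t) (ix_k q t) (tnth x t).

Definition haar_coef (f : D.-tuple R -> R) (q : haar_ix) : R :=
  cube_integral (fun x => f x * haar_tensor q x).

Definition haar_normsq (alpha : R) (f : D.-tuple R -> R) : \bar R :=
  (\esum_(q in haar_range)
    (b%:R `^ (2 * alpha * (\sum_(t < D) ix_j q t)%:R) * haar_coef f q ^+ 2)%:E)%E.

Definition haar_space (alpha : R) (f : D.-tuple R -> R) : Prop :=
  cube_L2 f /\ (haar_normsq alpha f < +oo)%E.

Definition haar_norm (alpha : R) (f : D.-tuple R -> R) : R :=
  Num.sqrt (fine (haar_normsq alpha f)).

End HaarSpace.

Section Nets.
Context {R : realType}.
Variable b : nat.

Definition elementary_interval (s : nat) (j k : 'I_s -> nat) : set (s.-tuple R) :=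
  [set x | forall t, (k t)%:R / b%:R ^+ j t <= tnth x t < (k t).+1%:R / b%:R ^+ j t].

Definition is_net (m s : nat) (A : set (s.-tuple R)) : Prop :=
  [/\ finite_set A, A `<=` @unit_cube R s &
      forall j k : 'I_s -> nat,
        (forall t, (k t < b ^ j t)%N) ->
        \prod_(t < s) (b%:R ^- j t) = b%:R ^- m :> R ->
        exists! x, A x /\ elementary_interval j k x].

Hypothesis hb : (1 < b)%N.

(* The (k+1)-st b-ary digit of x in [0, 1); taking integer parts selects the
   finite expansion whenever there is one. *)
Definition bdigit (x : R) (k : nat) : 'I_b :=
  Ordinal (ltn_pmod (Num.truncn (b%:R ^+ k.+1 * x)) (ltnW hb)).

(* pi assigns a permutation to each prefix of digits; only prefixes of length
   less than m are used. *)
Definition scramble (m : nat) (pi : seq 'I_b -> {perm 'I_b}) (x : R) : R :=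
  \sum_(k < m) (nat_of_ord (pi (mkseq (bdigit x) k) (bdigit x k)))%:R / b%:R ^+ k.+1.

Definition scrambled_point (m s : nat) (pi : 'I_s -> seq 'I_b -> {perm 'I_b})
    (xi : 'I_s -> R) (p : s.-tuple R) : s.-tuple R :=
  [tuple scramble m (pi t) (tnth p t) + b%:R ^- m * xi t | t < s].

End Nets.

Section Quadrature.
Context {R : realType}.

Record qrule (T : Type) := QRule {
  q_ix : finType;
  q_weight : q_ix -> R;
  q_node : q_ix -> T }.

Definition q_eval T (q : qrule T) (f : T -> R) : R :=
  \sum_(c : q_ix q) q_weight c * f (q_node c).

Definition q_zero T : qrule T :=
  @QRule T void (fun=> 0) (fun c => match c with end).

Definition q_sub T (q r : qrule T) : qrule T :=
  @QRule T (q_ix q + q_ix r)%type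
    (fun c => match c with inl i => q_weight i | inr i => - q_weight i end)
    (fun c => match c with inl i => q_node i | inr i => q_node i end).

Lemma block_proof (s d : nat) (t : 'I_(s * d)) : (t %/ s < d)%N.
Proof.
by case: s t => [|s] [t /=]; rewrite ?mul0n // mulnC ltn_divLR.
Qed.

Lemma coord_proof (s d : nat) (t : 'I_(s * d)) : (t %% s < s)%N.
Proof. by case: s t => [|s] [t /=]; rewrite ?mul0n // ltn_pmod. Qed.

(* Coordinates are grouped in d consecutive blocks of length s. *)
Definition join_blocks (s d : nat) (y : 'I_d -> s.-tuple R) : (s * d).-tuple R :=
  [tuple tnth (y (Ordinal (block_proof t))) (Ordinal (coord_proof t)) | t < s * d].

Definition q_tensor (s d : nat) (q : 'I_d -> qrule (s.-tuple R)) :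
    qrule ((s * d).-tuple R) :=
  @QRule _ {dffun forall n : 'I_d, q_ix (q n)}
    (fun c => \prod_(n < d) q_weight (c n))
    (fun c => join_blocks (fun n => q_node (c n))).

(* Multi-indices in {1, 2, ...}^d with |l| <= L; their entries are at most L. *)
Definition smolyak_ix (d L : nat) (l : {ffun 'I_d -> 'I_L.+1}) : bool :=
  [forall n, (0 < l n)%N] && (\sum_(n < d) l n <= L)%N.

(* A(L,d) f for building blocks U n l, where U n 0 is the zero rule. *)
Definition smolyak (s d : nat) (U : 'I_d -> nat -> qrule (s.-tuple R)) (L : nat)
    (f : (s * d).-tuple R -> R) : R :=
  \sum_(l : {ffun 'I_d -> 'I_L.+1} | smolyak_ix l)
    q_eval (q_tensor (fun n => q_sub (U n (l n)) (U n (l n).-1))) f.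

(* The number of nodes in the combination formula for A(L,d) with
   building blocks using b ^ (l - 1) nodes at level l. *)
Definition smolyak_cost (b d L : nat) : nat :=
  (\sum_(l : {ffun 'I_d -> 'I_L.+1} |
      smolyak_ix l && (L - d + 1 <= \sum_(n < d) l n))
    b ^ (\sum_(n < d) l n - d))%N.

(* The quadrature of level l is based on a scrambled (0, l - 1, s)-net; the
   net, the permutations and the jitter are indexed by the depth m = l - 1. *)
Definition scrambled_rule (b : nat) (hb : (1 < b)%N) (s : nat)
    (p : forall m : nat, 'I_(b ^ m) -> s.-tuple R)
    (pi : nat -> 'I_s -> seq 'I_b -> {perm 'I_b})
    (xi : forall m : nat, 'I_s -> 'I_(b ^ m) -> R) (l : nat) :
    qrule (s.-tuple R) :=
  if l is m.+1 then
    @QRule _ 'I_(b ^ m) (fun=> b%:R ^- m)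
      (fun i => scrambled_point hb m (pi m) (fun t => xi m t i) (p m i))
  else q_zero _.

End Quadrature.

Section Randomization.
Local Open Scope ereal_scope.
Context {R : realType} {d0 : measure_display} {Omega : measurableType d0}.
Variable P : probability Omega R.

(* Mutual independence of the systems of events (E k)_{k in K}. *)
Definition mutually_independent (I : Type) (K : set I)
    (E : I -> set (set Omega)) : Prop :=
  forall (r : nat) (k : 'I_r -> I) (A : 'I_r -> set Omega),
    injective k -> (forall i, K (k i)) -> (forall i, E (k i) (A i)) ->
    P (\bigcap_(i in [set: 'I_r]) A i) = \prod_(i < r) P (A i).

Variables b s d : nat.

(* Indices of the random variables: block n, depth m, coordinate t, and a
   digit prefix, respectively the number i of a point of the net. *)
Inductive rv_ix : Type :=
  | PermIx (n : 'I_d) (m : nat) (t : 'I_s) (prefix : seq 'I_b)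
  | UnifIx (n : 'I_d) (m : nat) (t : 'I_s) (i : 'I_(b ^ m)).

Definition rv_used : set rv_ix :=
  [set q | match q with
           | PermIx _ m _ prefix => (size prefix < m)%N
           | UnifIx _ _ _ _ => True
           end].

Variable pi : 'I_d -> nat -> 'I_s -> seq 'I_b -> Omega -> {perm 'I_b}.
Variable xi : 'I_d -> forall m : nat, 'I_s -> 'I_(b ^ m) -> Omega -> R.

Definition rv_events (q : rv_ix) : set (set Omega) :=
  match q with
  | PermIx n m t prefix =>
      [set pi n m t prefix @^-1` B | B in [set: set {perm 'I_b}]]
  | UnifIx n m t i => [set @xi n m t i @^-1` B | B in measurable]
  end.

Record independently_randomized : Prop := {
  rand_measurable : forall q, rv_used q -> rv_events q `<=` measurable;
  rand_perm_uniform : forall n m t prefix, (size prefix < m)%N ->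
    forall sigma : {perm 'I_b},
      P (pi n m t prefix @^-1` [set sigma]) = (b`!%:R^-1)%:E;
  rand_xi_range : forall n m t i w, (0 <= @xi n m t i w < 1)%R;
  rand_xi_uniform : forall n m t i (B : set R), measurable B ->
    P (@xi n m t i @^-1` B) = lebesgue_measure (B `&` unit_itv);
  rand_independent : mutually_independent rv_used rv_events }.

End Randomization.

Section Error.
Context {R : realType} {d0 : measure_display} {Omega : measurableType d0}.

Definition rmse (P : probability Omega R) (D : nat)
    (A : Omega -> (D.-tuple R -> R) -> R) (f : D.-tuple R -> R) : \bar R :=
  ('E_P[(fun w => (A w f - cube_integral f) ^+ 2)%R] `^ 2^-1%R)%E.

End Error.

(* Main.v *)
Require Import Defs.
From HB Require Import structures.
From mathcomp Require Import all_boot all_order perm fingroup finmap all_algebra.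
From mathcomp Require Import all_classical all_reals all_analysis.
From mathcomp Require Import measurable_realfun zify ring lra.

(** Let [av j f g] be the scalar product of the averages of [f] and [g] over
    the [b]-adic intervals of length [b ^ -j], and [lev] its increments in [j],
    with one last increment that leads to the integral of [f g]. The levels
    serve both halves of the theorem. The products of the Haar coefficients of
    level [j] add up to the level [j] ([haar_level]). And on an interval the
    variance is a double integral of [(f x - f y)^2], so that a weighted sum of
    the variances is dominated, by a geometric sum, by the integral with the
    singular kernel in the Slobodeckij norm: the sum of the
    [b ^ (2 alpha j) lev j f f] is at most a constant times [ip f f].

    Both sides of this bound are quadratic forms in [f]. Hence it is an
    inequality between Gram matrices in the order of positive semidefinite
    matrices ([henergy_gram]), and by Schur's product theorem it can be
    multiplied over the coordinates ([psd_le_prod]). This is how all bounds pass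
    from one variable to finite sums of elementary tensors. An element of the
    mixed space is an [L^2] limit of such sums with converging norms, and a
    bound passes to the limit as soon as its left-hand side is continuous on
    [L^2], with whatever constant ([mix_limit]). For the Haar norm this is
    applied to finitely many levels at a time ([haar_embedding]).

    For a scrambled net, the joint law of the scrambled digits of two points
    depends only on the number of digits that the original points share
    ([pair_prob]), and the second moment of the values of [f] and [g] at these
    points is a combination of the levels whose coefficients are correlations
    ([pair_moment]). Multiplied over the coordinates and summed over the net,
    the coefficient of a product of levels [J] vanishes for [0 < |J| <= m],
    because elementary intervals of volume at least [b ^ -m] contain the right
    numbers of points ([net_gain_low]), and otherwise it is bounded by a
    constant per point ([net_gain_high]). So the covariance matrix of the rule
    with [b ^ m] points is at most a constant times [q ^ (m + 1)] times the Gram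
    matrix, where [q = b ^ -(2 alpha + 1)] ([block_cov_le]).

    Write [X_0] for the integral and [X_k] for the error of the building block of
    level [k]. Then [A(L,d) - I] is a combination of tensor products of the
    [X_(k n)], with bounded coefficients that vanish for [|k| <= L - d]. As the
    building blocks are independent and unbiased, distinct products are
    orthogonal ([smolyak_second_moment]), and the mean square error is at most a
    constant times the sum of the [q ^ |k|] over [|k| > L - d], which is of order
    [L ^ (d - 1) q ^ (L - d)]. Each node is uniformly distributed, so the method
    is continuous on [L^2] in the mean square ([smolyak_L2]), and the bound
    passes to the mixed space. Finally [N] is at most of order
    [L ^ (d - 1) b ^ (L - d)], and [L] at most of order [ln N], which turns this
    into the stated rate ([smolyak_rate]). *)

Import Order.TTheory GRing.Theory Num.Theory.
Import numFieldNormedType.Exports.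

Local Open Scope classical_set_scope.
Local Open Scope ring_scope.
Set Implicit Arguments.
Unset Strict Implicit.
Unset Printing Implicit Defensive.

(** * Integrable and square-integrable random variables *)

Section Expectation.
Context {d : measure_display} {T : measurableType d} {R : realType}.
Variable P : probability T R.
Implicit Types X Y : T -> R.

Definition L1 X := P.-integrable setT (EFin \o X).
Definition Ex X : R := \int[P]_w X w.

Lemma L1_measurable X : L1 X -> measurable_fun setT X.
Proof. by move=> /measurable_int/measurable_EFinP. Qed.

Lemma Ex_EFin X : L1 X -> (Ex X)%:E = (\int[P]_w (X w)%:E)%E.
Proof. by move=> h; rewrite /Ex /Rintegral fineK//; exact: integrable_fin_num. Qed.

Lemma L1_cst c : L1 (fun=> c).
Proof. exact: finite_measure_integrable_cst. Qed.

Lemma Ex_cst c : Ex (fun=> c) = c.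
Proof. by rewrite /Ex Rintegral_cst//= probability_setT mulr1. Qed.

Lemma L1_le X Y : measurable_fun setT X -> (forall w, `|X w| <= Y w) -> L1 Y -> L1 X.
Proof.
move=> mX h; apply: le_integrable => //; first exact/measurable_EFinP.
by move=> x _ /=; rewrite lee_fin (le_trans (h x))// ler_norm.
Qed.

Lemma L1D X Y : L1 X -> L1 Y -> L1 (fun w => X w + Y w).
Proof. by move=> hX hY; exact: (integrableD measurableT hX hY). Qed.

Lemma ExD X Y : L1 X -> L1 Y -> Ex (fun w => X w + Y w) = Ex X + Ex Y.
Proof. exact: RintegralD. Qed.

Lemma L1Z c X : L1 X -> L1 (fun w => c * X w).
Proof. by move=> hX; exact: (integrableZl measurableT c hX). Qed.

Lemma ExZ c X : L1 X -> Ex (fun w => c * X w) = c * Ex X.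
Proof. exact: RintegralZl. Qed.

Lemma L1_sum (I : Type) (r : seq I) (p : pred I) (X : I -> T -> R) :
  (forall i, p i -> L1 (X i)) -> L1 (fun w => \sum_(i <- r | p i) X i w).
Proof.
move=> h; elim: r => [|i r IH].
  by under eq_fun do rewrite big_nil; exact: L1_cst.
under eq_fun do rewrite big_cons; case: (boolP (p i)) => pi //.
by apply: L1D => //; exact: h.
Qed.

Lemma Ex_sum (I : Type) (r : seq I) (p : pred I) (X : I -> T -> R) :
  (forall i, p i -> L1 (X i)) ->
  Ex (fun w => \sum_(i <- r | p i) X i w) = \sum_(i <- r | p i) Ex (X i).
Proof.
move=> h; elim: r => [|i r IH].
  by under [in LHS]eq_fun do rewrite big_nil; rewrite Ex_cst big_nil.
under [in LHS]eq_fun do rewrite big_cons; rewrite big_cons; case: (boolP (p i)) => pi //.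
by rewrite ExD ?IH//; [exact: h | exact: L1_sum].
Qed.

Lemma Ex_ge0 X : (forall w, 0 <= X w) -> 0 <= Ex X.
Proof. by move=> h; apply: Rintegral_ge0. Qed.

Lemma Ex_le X Y : L1 X -> L1 Y -> (forall w, X w <= Y w) -> Ex X <= Ex Y.
Proof. by move=> hX hY h; apply: le_Rintegral. Qed.

Lemma L1_indic A : measurable A -> L1 (\1_A).
Proof. exact: integrable_indic. Qed.

Lemma Ex_indic A : measurable A -> Ex (\1_A) = fine (P A).
Proof. by move=> mA; rewrite /Ex /Rintegral integral_indic// setIT. Qed.

Lemma fineP A : measurable A -> (fine (P A))%:E = P A.
Proof. by move=> mA; rewrite fineK// fin_num_measure. Qed.

Definition L2 X := measurable_fun setT X /\ L1 (fun w => X w ^+ 2).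

Lemma L2_mul X Y : L2 X -> L2 Y -> L1 (fun w => X w * Y w).
Proof.
move=> [mX hX] [mY hY].
apply: (L1_le _ _ (L1D hX hY)); first exact: measurable_funM.
move=> w; rewrite normrM.
have := sqr_ge0 (`|X w| - `|Y w|); rewrite sqrrB -!normrX.
rewrite (ger0_norm (sqr_ge0 (X w))) (ger0_norm (sqr_ge0 (Y w))).
have := normr_ge0 (X w); have := normr_ge0 (Y w).
have := mulr_ge0 (normr_ge0 (X w)) (normr_ge0 (Y w)).
move: (`|X w| * `|Y w|) => z; lra.
Qed.

Lemma L2_cst c : L2 (fun=> c).
Proof. by split => //; exact: L1_cst. Qed.

Lemma L2_L1 X : L2 X -> L1 X.
Proof.
move=> hX; have := L2_mul hX (L2_cst 1).
by under eq_fun do rewrite mulr1.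
Qed.

Lemma L2D X Y : L2 X -> L2 Y -> L2 (fun w => X w + Y w).
Proof.
move=> hX hY; split; first by apply: measurable_funD; [exact: hX.1|exact: hY.1].
under eq_fun do rewrite sqrrD -mulr_natl.
apply: L1D; last exact: hY.2; apply: L1D; first exact: hX.2.
by apply: L1Z; exact: L2_mul.
Qed.

Lemma L2Z c X : L2 X -> L2 (fun w => c * X w).
Proof.
move=> hX; split; first by apply: measurable_funM => //; exact: hX.1.
by under eq_fun do rewrite exprMn; apply: L1Z; exact: hX.2.
Qed.

Lemma L2_sum (I : Type) (r : seq I) (p : pred I) (X : I -> T -> R) :
  (forall i, p i -> L2 (X i)) -> L2 (fun w => \sum_(i <- r | p i) X i w).
Proof.
move=> h; elim: r => [|i r IH].
  by under eq_fun do rewrite big_nil; exact: L2_cst.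
under eq_fun do rewrite big_cons; case: (boolP (p i)) => pi //.
by apply: L2D => //; exact: h.
Qed.

Lemma L2_indic A : measurable A -> L2 (\1_A).
Proof.
move=> mA; split; first exact: measurable_indic.
rewrite (_ : (fun w => _) = \1_A); first exact: L1_indic.
by apply/funext => w; rewrite indicE; case: (_ \in _); rewrite ?expr1n ?expr0n.
Qed.

Lemma L2_indicM A X : measurable A -> L2 X -> L2 (fun w => \1_A w * X w).
Proof.
move=> mA hX; split.
  by apply: measurable_funM; [exact: measurable_indic | exact: hX.1].
apply: L1_le hX.2.
  apply: measurable_funX; apply: measurable_funM; [exact: measurable_indic | exact: hX.1].
move=> w; rewrite exprMn normrM !ger0_norm ?sqr_ge0// indicE.
by case: (_ \in _); rewrite ?expr1n ?mul1r// expr0n mul0r sqr_ge0.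
Qed.

(** The expectation of [(X - c Y)^2] is a nonnegative quadratic polynomial in
    [c]. *)
Lemma cauchy_schwarz X Y : L2 X -> L2 Y ->
  Ex (fun w => X w * Y w) ^+ 2 <= Ex (fun w => X w ^+ 2) * Ex (fun w => Y w ^+ 2).
Proof.
move=> hX hY; set e := Ex _; set q := Ex _; set p := Ex _.
have key c : 0 <= q - 2 * c * e + c ^+ 2 * p.
  have -> : q - 2 * c * e + c ^+ 2 * p = Ex (fun w => (X w - c * Y w) ^+ 2).
    rewrite /q /p -mulNr -!ExZ; [|exact: L2_mul|exact: hY.2].
    rewrite -ExD; [|exact: hX.2|apply: L1Z; exact: L2_mul].
    rewrite -ExD; [|by apply: L1D; [exact: hX.2|apply: L1Z; exact: L2_mul]|apply: L1Z; exact: hY.2].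
    by congr Ex; apply/funext => w /=; ring.
  by apply: Ex_ge0 => w; rewrite sqr_ge0.
have p0 : 0 <= p by apply: Ex_ge0 => w; rewrite sqr_ge0.
have [p00|pn0] := eqVneq p 0.
  (* then e vanishes, for otherwise a large c would violate key *)
  rewrite p00 mulr0; have [->|e0] := eqVneq e 0; first by rewrite expr0n.
  have := key ((q + 1) / (2 * e)); rewrite p00 mulr0 addr0.
  rewrite (_ : 2 * _ * e = q + 1); first lra.
  by field.
have := key (e / p).
have {}p0 : 0 < p by rewrite lt_def pn0.
rewrite (_ : _ + _ = q - e ^+ 2 / p); last by field.
by rewrite subr_ge0 ler_pdivrMr.
Qed.

Lemma cauchy_indic A X : measurable A -> L2 X ->
  Ex (fun w => \1_A w * X w) ^+ 2 <= fine (P A) * Ex (fun w => \1_A w * X w ^+ 2).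
Proof.
move=> mA hX; have := cauchy_schwarz (L2_indic mA) (L2_indicM mA hX).
have i2 w : \1_A w ^+ 2 = \1_A w :> R by rewrite indicE; case: (_ \in _); rewrite ?expr1n ?expr0n.
rewrite (_ : (fun w => \1_A w * (\1_A w * X w)) = fun w => \1_A w * X w); last first.
  by apply/funext => w; rewrite mulrA -expr2 i2.
rewrite (_ : (fun w => \1_A w ^+ 2) = \1_A); last by apply/funext => w; rewrite i2.
rewrite (_ : (fun w => (_ * X w) ^+ 2) = fun w => \1_A w * X w ^+ 2); last first.
  by apply/funext => w; rewrite exprMn i2.
by rewrite Ex_indic.
Qed.

Lemma jensen_sq X : L2 X -> Ex X ^+ 2 <= Ex (fun w => X w ^+ 2).
Proof.
move=> hX; have := cauchy_schwarz hX (L2_cst 1).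
by under eq_fun do rewrite mulr1; rewrite expr1n Ex_cst mulr1.
Qed.

End Expectation.

Section Law.
Context {d d' : measure_display} {T : measurableType d} {T' : measurableType d'} {R : realType}.
Variables (P : probability T R) (Q : probability T' R) (Y : T -> T').
Hypothesis mY : measurable_fun setT Y.
Hypothesis lawY : forall A, measurable A -> P (Y @^-1` A) = Q A.

Lemma ge0_integral_law (f : T' -> \bar R) : measurable_fun setT f ->
  (forall x, 0 <= f x)%E -> (\int[Q]_x f x = \int[P]_w f (Y w))%E.
Proof.
move=> mf f0.
transitivity (\int[pushforward P Y]_x f x)%E.
  by apply: eq_measure_integral => A mA _; exact/esym/lawY.
by rewrite ge0_integral_pushforward.
Qed.

Lemma L1_law (f : T' -> R) : L1 Q f <-> measurable_fun setT f /\ L1 P (f \o Y).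
Proof.
split=> [h|[mf h]].
  have mf := L1_measurable h; split => //.
  apply/integrableP; split; first by apply/measurable_EFinP; exact: measurableT_comp.
  move/integrableP: h => [_]; rewrite ge0_integral_law//.
  by apply: measurableT_comp => //; exact/measurable_EFinP.
apply/integrableP; split; first exact/measurable_EFinP.
move/integrableP: h => [_]; rewrite ge0_integral_law//.
by apply: measurableT_comp => //; exact/measurable_EFinP.
Qed.

Lemma Ex_law (f : T' -> R) : L1 Q f -> Ex Q f = Ex P (f \o Y).
Proof.
move=> h; have [mf h'] := (L1_law f).1 h.
rewrite /Ex /Rintegral; congr fine.
transitivity (\int[pushforward P Y]_x (f x)%:E)%E.
  by apply: eq_measure_integral => A mA _; exact/esym/lawY.
by rewrite integral_pushforward//; exact/measurable_EFinP.
Qed.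

Lemma L2_law (f : T' -> R) : L2 Q f -> L2 P (f \o Y).
Proof.
move=> [mf hf]; split; first exact: measurableT_comp.
by have [_] := (L1_law _).1 hf.
Qed.

End Law.

Section Independent.
Context {d : measure_display} {T : measurableType d} {R : realType}.
Variable P : probability T R.

(** The law of the pair [(X, Y)] is the product of the two laws, and Fubini's
    theorem applies to the product of the two coordinates. *)
Lemma indep_Ex (X Y : T -> R) : L1 P X -> L1 P Y ->
  (forall A B, measurable A -> measurable B ->
     P (X @^-1` A `&` Y @^-1` B) = (P (X @^-1` A) * P (Y @^-1` B))%E) ->
  L1 P (fun w => X w * Y w) /\ Ex P (fun w => X w * Y w) = Ex P X * Ex P Y.
Proof.
move=> hX hY hXY.
have mX := L1_measurable hX; have mY := L1_measurable hY.
pose X' : {mfun T >-> R} := HB.pack X (isMeasurableFun.Build _ _ _ _ X mX).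
pose Y' : {mfun T >-> R} := HB.pack Y (isMeasurableFun.Build _ _ _ _ Y mY).
pose Z w := (X' w, Y' w).
have mZ : measurable_fun setT Z by apply/measurable_fun_pairP; split.
pose Z' : {mfun T >-> (R * R)%type} :=
  HB.pack Z (isMeasurableFun.Build _ _ _ _ Z mZ).
pose m1 := distribution P X'; pose m2 := distribution P Y'.
have law A : measurable A -> P (Z @^-1` A) = (m1 \x m2)%E A.
  move=> mA; have := @product_measure_unique _ _ _ _ _ m1 m2 (distribution P Z').
  by move=> ->// A0 B0 mA0 mB0; rewrite -hXY.
pose f (z : R * R) : R := z.1 * z.2.
have mf : measurable_fun setT f by apply: measurable_funM; [exact: measurable_fst|exact: measurable_snd].
have l1 : L1 m1 (fun x => x).
  by apply/(L1_law (P := P) (Y := X)) => //.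
have l2 : L1 m2 (fun x => x).
  by apply/(L1_law (P := P) (Y := Y)) => //.
have hf : L1 (m1 \x m2 : probability _ _)%E f.
  have mn : measurable_fun setT (fun x : R => (`|x|)%:E).
    by apply/measurable_EFinP; exact: normr_measurable.
  apply/integrable12ltyP; first exact/measurable_EFinP.
  under eq_integral => x _.
    under eq_integral => y _ do rewrite /f/= normrM EFinM.
    rewrite ge0_integralZl//.
    over.
  rewrite /= ge0_integralZr//; last exact: integral_ge0.
  apply: lte_mul_pinfty.
  - exact: integral_ge0.
  - apply/fin_numPlt; rewrite (lt_le_trans (ltNyr 0))/=; last exact: integral_ge0.
    by move/integrableP: l1 => [].
  - by move/integrableP: l2 => [].
have [_ hZ] := (L1_law mZ law f).1 hf.
split => //.
transitivity (Ex (m1 \x m2 : probability _ _)%E f); first by rewrite (Ex_law mZ law hf).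
apply: EFin_inj.
rewrite Ex_EFin// -integral12_prod_meas1// /fubini_F.
under eq_integral => x _.
  under eq_integral => y _ do rewrite /f/= EFinM.
  rewrite integralZl//.
  rewrite -(Ex_EFin l2); over.
rewrite integralZr// -(Ex_EFin l1) -EFinM.
by rewrite (Ex_law (P := P) (Y := X)) ?(Ex_law (P := P) (Y := Y))//.
Qed.

End Independent.

(** * Independence of groups of random variables, and the law of a random point of the cube *)

Section SigmaIndependence.
Context {d : measure_display} {T : measurableType d} {R : realType}.
Variables (P : probability T R) (I : eqType) (K : set I) (E : I -> set (set T)).
Implicit Types S : set I.

Definition gens S : set (set T) := [set A | exists2 q, S q /\ K q & E q A].
Definition sigS S : set (set T) := <<s gens S >>.

Hypothesis Em : forall q, K q -> E q `<=` measurable.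
Hypothesis EI : forall q, setI_closed (E q).
Hypothesis ET : forall q, E q setT.
Hypothesis Eind : mutually_independent P K E.

(** Finite intersections of events with distinct indices in [S]: a pi-system
    that generates [sigS S] and on which independence is the product rule. *)
Definition box S : set (set T) := [set A | exists (F : seq I) (B : I -> set T),
  [/\ uniq F, (forall q, q \in F -> S q /\ K q), (forall q, E q (B q)) &
      A = \bigcap_(q in [set q | q \in F]) B q]].

Lemma measurable_gens S : gens S `<=` measurable.
Proof. by move=> A [q [_ Kq] /(Em Kq)]. Qed.

Lemma measurable_sigS S : sigS S `<=` measurable.
Proof. exact: smallest_sub (@sigma_algebra_measurable _ T) (@measurable_gens S). Qed.

Lemma measurable_box S : box S `<=` measurable.
Proof.
move=> _ [F [B [_ FS EB ->]]].
apply: fin_bigcap_measurable => // q /= qF.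
by apply: (Em (FS _ qF).2); exact: EB.
Qed.

Lemma box_setI S : setI_closed (box S).
Proof.
move=> _ _ [F [B [uF FS EB ->]]] [F' [B' [uF' FS' EB' ->]]].
exists (undup (F ++ F')), (fun q => (if q \in F then B q else setT) `&` (if q \in F' then B' q else setT)).
split.
- exact: undup_uniq.
- by move=> q; rewrite mem_undup mem_cat => /orP[/FS|/FS'].
- by move=> q; apply: EI; case: ifP.
- apply/seteqP; split => x /=.
    by move=> [h h'] q _; split; case: ifP => // hq; [exact: h|exact: h'].
  move=> h; split => q /= hq; have := h q; rewrite /= mem_undup mem_cat hq ?orbT => /(_ isT) [] //.
Qed.

Lemma box_setT S : box S setT.
Proof.
by exists [::], (fun=> setT); split => //; apply/seteqP; split.
Qed.

Lemma gens_box S : gens S `<=` box S.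
Proof.
move=> A [q [Sq Kq] EA]; exists [:: q], (fun q' => if q' == q then A else setT).
split => //.
- by move=> q'; rewrite inE => /eqP ->.
- by move=> q'; case: eqP => [->|].
- apply/seteqP; split => x /=; first by move=> Ax q' /=; rewrite mem_seq1 => ->.
  by move=> /(_ q); rewrite /= mem_seq1 eqxx => /(_ isT).
Qed.

Lemma sigS_box S : sigS S `<=` <<s box S >>.
Proof. by apply: sub_smallest2r; [exact: smallest_sigma_algebra|exact: gens_box]. Qed.

Lemma prob_bigcap (F : seq I) (B : I -> set T) : uniq F ->
  (forall q, q \in F -> K q) -> (forall q, E q (B q)) ->
  P (\bigcap_(q in [set q | q \in F]) B q) = (\prod_(q <- F) P (B q))%E.
Proof.
move=> uF FK EB; rewrite big_tnth.
rewrite -(Eind (k := tnth (in_tuple F)) (A := fun i => B (tnth (in_tuple F) i))).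
- congr (P _); apply/seteqP; split => x /= h.
    by move=> i _; apply: h => /=; exact: mem_tnth.
  move=> q /= qF; have /tnthP[i ->] : q \in in_tuple F by [].
  exact: h.
- exact/tuple_uniqP.
- by move=> i; apply: FK; exact: mem_tnth.
- by move=> i; exact: EB.
Qed.

Lemma box_indep S S' A B : (forall q, S q -> S' q -> False) ->
  box S A -> box S' B -> P (A `&` B) = (P A * P B)%E.
Proof.
move=> dis [F [C [uF FS EC ->]]] [F' [C' [uF' FS' EC' ->]]].
pose D q := if q \in F then C q else C' q.
have uFF : uniq (F ++ F').
  rewrite cat_uniq uF uF' andbT/=; apply/hasPn => q qF'; apply/negP => qF.
  by apply: (dis q); [case: (FS q qF)|case: (FS' q qF')].
have nF q : q \in F' -> (q \in F) = false.
  by move=> qF'; apply/negP => qF; apply: (dis q); [case: (FS q qF)|case: (FS' q qF')].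
have e1 : \bigcap_(q in [set q | q \in F]) C q = \bigcap_(q in [set q | q \in F]) D q.
  by apply: eq_bigcapr => q /= qF; rewrite /D qF.
have e2 : \bigcap_(q in [set q | q \in F']) C' q = \bigcap_(q in [set q | q \in F']) D q.
  by apply: eq_bigcapr => q /= qF; rewrite /D nF.
have ED q : E q (D q) by rewrite /D; case: ifP.
rewrite e1 e2 -bigcap_setU (_ : _ `|` _ = [set q | q \in F ++ F']); last first.
  by apply/seteqP; split => q /=; rewrite mem_cat => /orP.
rewrite !prob_bigcap ?big_cat//.
- by move=> q /FS' [].
- by move=> q /FS [].
- by move=> q; rewrite mem_cat => /orP[/FS[]|/FS'[]].
Qed.

(** A pi-system argument: two finite measures that agree on [box S] agree on
    [sigS S]. *)
Lemma box_sigS S B : measurable B ->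
  (forall A, box S A -> P (A `&` B) = (P A * P B)%E) ->
  forall A, sigS S A -> P (A `&` B) = (P A * P B)%E.
Proof.
move=> mB h A sA.
pose m1 := mrestr P mB.
have p0 : 0 <= fine (P B) by rewrite fine_ge0.
pose m2 := mscale (NngNum p0) P.
have := @g_sigma_algebra_measure_unique _ R T (box S) (@measurable_box S)
  (fun=> setT) (fun=> box_setT S) _ m1 m2 (@box_setI S) _ _ A (sigS_box sA).
have m2E C : m2 C = (P C * P B)%E by rewrite -(fineP P mB) muleC.
have -> : (P (A `&` B) = m1 A) by [].
rewrite -m2E; apply.
- by rewrite bigcup_const//; exists 0%N.
- by move=> C bC; rewrite [RHS]m2E; exact: h.
- by move=> _; rewrite [ltLHS](_ : _ = P (setT `&` B))// setTI -fineP// ltry.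
Qed.

Lemma sigS_indep S S' A B : (forall q, S q -> S' q -> False) ->
  sigS S A -> sigS S' B -> P (A `&` B) = (P A * P B)%E.
Proof.
move=> dis sA sB.
apply: (@box_sigS S B _ _ A sA); first exact: measurable_sigS sB.
move=> C bC; rewrite setIC muleC.
apply: (@box_sigS S' C _ _ B sB); first exact: measurable_box bC.
by move=> D bD; rewrite setIC muleC; exact: (box_indep dis bC bD).
Qed.

Lemma sigS_sub S S' : S `<=` S' -> sigS S `<=` sigS S'.
Proof.
move=> SS; apply: sub_smallest2r; first exact: smallest_sigma_algebra.
by move=> A [q [Sq Kq] EA]; exists q => //; split => //; exact: SS.
Qed.

(** Random variables that depend only on the randomness with index in [S]. *)
Definition smf {d'} {T' : measurableType d'} S (X : T -> T') :=
  @measurable_fun _ _ (g_sigma_algebraType (gens S)) T' setT X.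

Lemma smfP {d'} {T' : measurableType d'} S (X : T -> T') :
  smf S X <-> forall B, measurable B -> sigS S (X @^-1` B).
Proof.
split=> h; first by move=> B mB; have := h measurableT B mB; rewrite setTI.
by move=> _ B mB; rewrite setTI; exact: h.
Qed.

Lemma smf_sub {d'} {T' : measurableType d'} S S' (X : T -> T') :
  S `<=` S' -> smf S X -> smf S' X.
Proof. by move=> /sigS_sub SS /smfP h; apply/smfP => B mB; apply: SS; exact: h. Qed.

Lemma smf_measurable {d'} {T' : measurableType d'} S (X : T -> T') :
  smf S X -> measurable_fun setT X.
Proof. by move=> /smfP h _ B mB; rewrite setTI; apply: measurable_sigS (h B mB). Qed.

Lemma smf_indep_Ex S S' (X Y : T -> R) : (forall q, S q -> S' q -> False) ->
  smf S X -> smf S' Y -> L1 P X -> L1 P Y ->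
  L1 P (fun w => X w * Y w) /\ Ex P (fun w => X w * Y w) = Ex P X * Ex P Y.
Proof.
move=> dis /smfP mX /smfP mY hX hY; apply: indep_Ex => // A B mA mB.
by apply: (sigS_indep dis); [exact: mX|exact: mY].
Qed.

Lemma smf_prod_indep (J : eqType) (r : seq J) (S : J -> set I) (X : J -> T -> R) :
  uniq r -> (forall i j q, S i q -> S j q -> i = j) ->
  (forall j, smf (S j) (X j)) -> (forall j, L1 P (X j)) ->
  [/\ smf (fun q => exists2 j, j \in r & S j q) (fun w => \prod_(j <- r) X j w),
      L1 P (fun w => \prod_(j <- r) X j w) &
      Ex P (fun w => \prod_(j <- r) X j w) = \prod_(j <- r) Ex P (X j)].
Proof.
move=> + dis mX hX; elim: r => [_|j r IH /= /andP[jr ur]].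
  rewrite (_ : (fun w => _) = fun=> 1); last by apply/funext => w; rewrite big_nil.
  by rewrite big_nil Ex_cst; split; [exact: measurable_cst|exact: L1_cst|].
have [m1 l1 e1] := IH ur.
have [] := @smf_indep_Ex (S j) (fun q => exists2 j, j \in r & S j q) (X j)
  (fun w => \prod_(j <- r) X j w) _ (mX j) m1 (hX j) l1.
  by move=> q jq [i ir iq]; move: jr; rewrite (dis _ _ _ jq iq) ir.
move=> l2 e2; rewrite (_ : (fun w => _) = fun w => X j w * \prod_(i <- r) X i w); last first.
  by apply/funext => w; rewrite big_cons.
rewrite big_cons -e1 -e2; split => //.
apply: measurable_funM.
  by apply: (@smf_sub _ _ (S j)) (mX j) => q Sq; exists j => //; rewrite mem_head.
by apply: smf_sub m1 => q [i ir iq]; exists i => //; rewrite in_cons ir orbT.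
Qed.

End SigmaIndependence.

Section Cube.
Context {R : realType}.

Definition unif : probability (measurableTypeR R) R := uniform_prob (@ltr01 R).

Lemma cube_measureS n (A : set (n.+1.-tuple R)) :
  cube_measure n.+1 A = (unif \x cube_measure n)%E (@cons_point R n @^-1` A).
Proof. by []. Qed.

(** Fubini's theorem, one coordinate at a time: under [unif \x cube_measure n]
    the first coordinate is independent of the others. *)
Lemma cube_prod n (f : 'I_n -> R -> R) : (forall i, L1 unif (f i)) ->
  L1 (cube_measure n) (fun x => \prod_(i < n) f i (tnth x i)) /\
  Ex (cube_measure n) (fun x => \prod_(i < n) f i (tnth x i)) = \prod_(i < n) Ex unif (f i).
Proof.
elim: n f => [|n IH] f hf.
  under eq_fun do rewrite big_ord0; rewrite big_ord0 Ex_cst; split => //; exact: L1_cst.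
have [l1 e1] := IH (fun i => f (lift ord0 i)) (fun i => hf _).
set g := (X in L1 _ X) in l1 e1.
pose Q : probability _ R := (unif \x cube_measure n)%E.
have lawf (A : set (measurableTypeR R)) : measurable A -> Q (fst @^-1` A) = unif A.
  move=> mA; rewrite (_ : _ @^-1` _ = A `*` setT); last first.
    by apply/seteqP; split => z /= => [?|[]].
  by rewrite /Q /= product_measure1E// [X in (_ * X)%E]probability_setT mule1.
have laws (A : set (n.-tuple R)) : measurable A -> Q (snd @^-1` A) = cube_measure n A.
  move=> mA; rewrite (_ : _ @^-1` _ = setT `*` A); last first.
    by apply/seteqP; split => z /= => [?|[]].
  by rewrite /Q /= product_measure1E// [X in (X * _)%E]probability_setT mul1e.
have lf := (L1_law measurable_fst lawf (f ord0)).1 (hf ord0).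
have lg := (L1_law measurable_snd laws g).1 l1.
have [] := indep_Ex lf.2 lg.2.
  move=> A B mA mB.
  have mfA : measurable (f ord0 @^-1` A).
    by rewrite -[X in measurable X]setTI; apply: lf.1.
  have mgB : measurable (g @^-1` B).
    by rewrite -[X in measurable X]setTI; apply: lg.1.
  rewrite [X in Q X](_ : _ = (f ord0 @^-1` A) `*` (g @^-1` B)); last by [].
  rewrite /Q /= product_measure1E//; congr (_ * _)%E; last exact/esym/laws.
  exact/esym/lawf.
rewrite -(Ex_law measurable_fst lawf) ?hf// -(Ex_law measurable_snd laws)// e1.
move=> lM eM.
have law (A : set (n.+1.-tuple R)) : measurable A -> Q (@cons_point R n @^-1` A) = cube_measure n.+1 A.
  by [].
pose F (x : n.+1.-tuple R) := \prod_(i < n.+1) f i (tnth x i).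
have eF : F \o @cons_point R n = (fun z => f ord0 z.1 * g z.2).
  apply/funext => z; rewrite /F /= big_ord_recl /=; congr (_ * _).
  by apply: eq_bigr => i _; congr f; rewrite !(tnth_nth 0).
have mF : measurable_fun setT F.
  apply: measurable_prod => i _; apply: measurableT_comp; last exact: measurable_tnth.
  exact: L1_measurable (hf i).
have lF : L1 (cube_measure n.+1) F.
  by apply/(L1_law (@measurable_cons_point R n) law); rewrite eF.
by split => //; rewrite (Ex_law (@measurable_cons_point R n) law)// eF eM big_ord_recl.
Qed.

End Cube.

Section TupleLaw.
Context {d : measure_display} {T : measurableType d} {R : realType}.
Variables (P : probability T R) (I : eqType) (K : set I) (E : I -> set (set T)).
Hypothesis Em : forall q, K q -> E q `<=` measurable.
Hypothesis EI : forall q, setI_closed (E q).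
Hypothesis ET : forall q, E q setT.
Hypothesis Eind : mutually_independent P K E.

(** A random point whose coordinates are uniform and use disjoint groups of
    random variables is uniform in the cube. By induction on the dimension:
    the law of the pair (first coordinate, rest) agrees with the product
    measure on rectangles. *)
Lemma tuple_law n (S : 'I_n -> set I) (Y : 'I_n -> T -> R) :
  (forall i j q, S i q -> S j q -> i = j) -> (forall i, smf K E (S i) (Y i)) ->
  (forall i A, measurable A -> P (Y i @^-1` A) = unif A) ->
  smf K E (fun q => exists i, S i q) (fun w => [tuple Y i w | i < n]) /\
  forall A, measurable A -> P ((fun w => [tuple Y i w | i < n]) @^-1` A) = cube_measure n A.
Proof.
move=> dis mY lawY.
have mt : smf K E (fun q => exists i, S i q) (fun w => [tuple Y i w | i < n]).
  apply/measurable_fun_tnthP => i.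
  rewrite (_ : _ \o _ = Y i); last by apply/funext => w /=; rewrite tnth_mktuple.
  by apply: smf_sub (mY i) => q Sq; exists i.
split => //.
elim: n => [|n IH] in S Y dis mY lawY mt *; move=> A mA.
  rewrite /= (_ : (fun w => _) = fun=> [tuple]); last by apply/funext => w; exact: tuple0.
  have [A0|A0] := pselect (A [tuple]).
    rewrite (_ : _ @^-1` A = setT); last by apply/seteqP; split.
    by rewrite probability_setT diracE mem_set.
  rewrite (_ : _ @^-1` A = set0); last by apply/seteqP; split.
  by rewrite measure0 diracE memNset.
pose S' i := S (lift ord0 i); pose Y' i := Y (lift ord0 i).
have dis' i j q : S' i q -> S' j q -> i = j by move=> h1 h2; exact: (lift_inj (dis _ _ _ h1 h2)).
have mt' : smf K E (fun q => exists i, S' i q) (fun w => [tuple Y' i w | i < n]).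
  apply/measurable_fun_tnthP => i.
  rewrite (_ : _ \o _ = Y' i); last by apply/funext => w /=; rewrite tnth_mktuple.
  by apply: smf_sub (mY _) => q Sq; exists i.
have {}IH := IH S' Y' dis' (fun i => mY _) (fun i => lawY _) mt'.
have m0 := smf_measurable Em (mY ord0); have m1 := smf_measurable Em mt'.
pose Z w := (Y ord0 w : measurableTypeR R, [tuple Y' i w | i < n]).
have mZ : measurable_fun setT Z by apply/measurable_fun_pairP; split.
pose Z' : {mfun T >-> (measurableTypeR R * n.-tuple R)%type} :=
  HB.pack Z (isMeasurableFun.Build _ _ _ _ Z mZ).
rewrite cube_measureS.
rewrite (@product_measure_unique _ _ _ _ _ unif (cube_measure n) (distribution P Z')); last 2 first.
- move=> B C mB mC; rewrite [LHS](_ : _ = P ((Y ord0 @^-1` B) `&` ((fun w => [tuple Y' i w | i < n]) @^-1` C)))//.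
  rewrite (sigS_indep Em EI ET Eind (S := S ord0) (S' := fun q => exists i, S' i q)).
  + by rewrite lawY// IH.
  + by move=> q h0 [i hi]; have := dis _ _ _ h0 hi.
  + by have /smfP := mY ord0; apply.
  + by have /smfP := mt'; apply.
- by rewrite -[X in measurable X]setTI; exact: measurable_cons_point.
rewrite /distribution /pushforward /=; congr (P _).
apply/seteqP; split => w /=; congr A; apply/val_inj => /=; rewrite enum_ordSl /= -map_comp//.
Qed.

End TupleLaw.

(** * Positive semidefinite matrices and their order *)

Section PositiveSemidefinite.
Context {R : rcfType}.

Definition quad n (M : 'I_n -> 'I_n -> R) (x : 'I_n -> R) : R :=
  \sum_i \sum_j x i * x j * M i j.

Definition psd n (M : 'I_n -> 'I_n -> R) : Prop :=
  (forall i j, M i j = M j i) /\ forall x, 0 <= quad M x.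

Lemma quadS n (M : 'I_n.+1 -> 'I_n.+1 -> R) x : (forall i j, M i j = M j i) ->
  quad M x = x ord0 ^+ 2 * M ord0 ord0
    + 2 * x ord0 * (\sum_j x (lift ord0 j) * M ord0 (lift ord0 j))
    + quad (fun i j => M (lift ord0 i) (lift ord0 j)) (fun i => x (lift ord0 i)).
Proof.
move=> sM; rewrite /quad big_ord_recl big_ord_recl.
have -> : \sum_(i < n) \sum_j x (lift ord0 i) * x j * M (lift ord0 i) j =
  x ord0 * (\sum_j x (lift ord0 j) * M ord0 (lift ord0 j)) +
  \sum_(i < n) \sum_(j < n) x (lift ord0 i) * x (lift ord0 j) * M (lift ord0 i) (lift ord0 j).
  rewrite mulr_sumr -big_split /=; apply: eq_bigr => i _.
  by rewrite big_ord_recl (sM _ ord0); congr (_ + _); ring.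
have -> : \sum_(i < n) x ord0 * x (lift ord0 i) * M ord0 (lift ord0 i) =
   x ord0 * (\sum_j x (lift ord0 j) * M ord0 (lift ord0 j)).
  by rewrite mulr_sumr; apply: eq_bigr => i _; ring.
by ring.
Qed.

(** Otherwise the form, restricted to the plane of the first and the [j]-th
    vector, would be affine in the first variable and take negative values. *)
Lemma psd_row0 n (M : 'I_n.+1 -> 'I_n.+1 -> R) j : psd M ->
  M ord0 ord0 = 0 -> M ord0 (lift ord0 j) = 0.
Proof.
move=> [sM pM] M0; apply/eqP; apply: contraT => Mj.
pose x c i : R := if unlift ord0 i is Some k then (k == j)%:R else c.
(* at this point of the plane the form takes the value -1 *)
have := pM (x (- (M (lift ord0 j) (lift ord0 j) + 1) / (2 * M ord0 (lift ord0 j)))).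
rewrite quadS// M0 /x unlift_none mulr0 add0r.
under eq_bigr do rewrite liftK.
rewrite (bigD1 j)//= eqxx big1 ?addr0 ?mul1r; last first.
  by move=> i /negPf ->; rewrite mul0r.
rewrite /quad (bigD1 j)//= (bigD1 j)//= !liftK eqxx !mul1r big1 ?addr0; last first.
  by move=> i /negPf ij; rewrite liftK ij mulr0 mul0r.
rewrite big1 ?addr0; last first.
  move=> i /negPf ij; rewrite big1// => k _; by rewrite liftK ij !mul0r.
rewrite (_ : _ + _ = -1); first by rewrite ler0N1.
by field.
Qed.

(** Completing the square in the first variable leaves a form in the remaining
    ones, so a positive semidefinite form is a sum of squares of linear forms. *)
Lemma psd_sos n (M : 'I_n -> 'I_n -> R) : psd M ->
  exists m (v : 'I_m -> 'I_n -> R), forall i j, M i j = \sum_(l < m) v l i * v l j.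
Proof.
elim: n M => [|n IH] M pM; first by exists 0%N, (fun _ _ => 0) => -[].
have M00 : 0 <= M ord0 ord0.
  have := pM.2 (fun i => (i == ord0)%:R); rewrite quadS; last exact: pM.1.
  rewrite eqxx expr1n mul1r big1; last by move=> i _; rewrite mul0r.
  by rewrite mulr0 addr0 /quad big1 ?addr0// => i _; rewrite big1// => j _; rewrite !mul0r.
(* the Schur complement; if the pivot is 0, so is its row, and nothing is subtracted *)
pose M' i j := M (lift ord0 i) (lift ord0 j) - M ord0 (lift ord0 i) * M ord0 (lift ord0 j) / M ord0 ord0.
have pM' : psd M'.
  split=> [i j|x]; first by rewrite /M' (pM.1 (lift _ _)); congr (_ - _ / _); rewrite mulrC.
  pose s := \sum_j x j * M ord0 (lift ord0 j).
  have qM' : quad M' x = quad (fun i j => M (lift ord0 i) (lift ord0 j)) x - s ^+ 2 / M ord0 ord0.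
    rewrite /quad /s expr2 mulr_suml mulr_suml -sumrB; apply: eq_bigr => i _.
    rewrite mulr_sumr mulr_suml -sumrB; apply: eq_bigr => j _; rewrite /M'; ring.
  rewrite qM'.
  have := pM.2 (fun i => if unlift ord0 i is Some k then x k else - s / M ord0 ord0).
  rewrite quadS; last exact: pM.1.
  rewrite unlift_none; under eq_bigr do rewrite liftK.
  rewrite -/s; set q := quad _ _; set q' := quad _ _.
  have -> : q = q'.
    by rewrite /q /q' /quad; apply: eq_bigr => i _; apply: eq_bigr => j _; rewrite !liftK.
  have [M0|M0] := eqVneq (M ord0 ord0) 0.
    by rewrite M0 invr0 !mulr0 mul0r !add0r subr0.
  by rewrite (_ : _ + _ = q' - s ^+ 2 / M ord0 ord0)//; field.
have [m [v vE]] := IH _ pM'.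
exists m.+1, (fun l i => if unlift ord0 l is Some l' then
   (if unlift ord0 i is Some i' then v l' i' else 0)
   else M ord0 i / Num.sqrt (M ord0 ord0)).
move=> i j; rewrite big_ord_recl unlift_none.
have -> : M ord0 i / Num.sqrt (M ord0 ord0) * (M ord0 j / Num.sqrt (M ord0 ord0)) =
   M ord0 i * M ord0 j / M ord0 ord0.
  by rewrite mulrACA -invfM -expr2 sqr_sqrtr.
under eq_bigr do rewrite liftK.
have [M0|M0] := eqVneq (M ord0 ord0) 0.
  have z k : M ord0 k = 0.
    by case: (unliftP ord0 k) => [k' ->|->//]; exact: psd_row0.
  rewrite !z !mul0r add0r.
  case: (unliftP ord0 i) => [i' ->|->]; last first.
    by rewrite z big1// => l _; rewrite mul0r.
  case: (unliftP ord0 j) => [j' ->|->]; last first.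
    by rewrite pM.1 z big1// => l _; rewrite mulr0.
  by rewrite -vE /M' !z !mul0r subr0.
case: (unliftP ord0 i) => [i' ->|->]; last first.
  by rewrite big1 ?addr0 => [|l _]; [field | rewrite mul0r].
case: (unliftP ord0 j) => [j' ->|->]; last first.
  by rewrite pM.1 big1 ?addr0 => [|l _]; [field | rewrite mulr0].
by rewrite -vE /M'; ring.
Qed.

Section Closure.
Variable n : nat.
Implicit Types M N : 'I_n -> 'I_n -> R.

Lemma psd_rank1 (v : 'I_n -> R) : psd (fun i j => v i * v j).
Proof.
split=> [i j|x]; first by rewrite mulrC.
rewrite (_ : quad _ _ = (\sum_i x i * v i) ^+ 2) ?sqr_ge0//.
rewrite /quad expr2 mulr_suml; apply: eq_bigr => i _.
by rewrite mulr_sumr; apply: eq_bigr => j _; ring.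
Qed.

Lemma psdD M N : psd M -> psd N -> psd (fun i j => M i j + N i j).
Proof.
move=> [sM pM] [sN pN]; split=> [i j|x]; first by rewrite sM sN.
rewrite (_ : quad _ _ = quad M x + quad N x) ?addr_ge0//.
rewrite /quad -big_split; apply: eq_bigr => i _.
by rewrite -big_split; apply: eq_bigr => j _; rewrite mulrDr.
Qed.

Lemma psdZ c M : 0 <= c -> psd M -> psd (fun i j => c * M i j).
Proof.
move=> c0 [sM pM]; split=> [i j|x]; first by rewrite sM.
rewrite (_ : quad _ _ = c * quad M x) ?mulr_ge0//.
rewrite /quad mulr_sumr; apply: eq_bigr => i _.
by rewrite mulr_sumr; apply: eq_bigr => j _; ring.
Qed.

Lemma psd0 : psd (fun _ _ : 'I_n => 0).
Proof.
by split=> // x; rewrite /quad big1// => i _; rewrite big1// => j _; rewrite mulr0.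
Qed.

Lemma psd1 : psd (fun _ _ : 'I_n => 1).
Proof. by have := psd_rank1 (fun=> 1); rewrite mulr1. Qed.

Lemma psd_sum (J : Type) (r : seq J) (p : pred J) (M : J -> 'I_n -> 'I_n -> R) :
  (forall l, p l -> psd (M l)) -> psd (fun i j => \sum_(l <- r | p l) M l i j).
Proof.
move=> pM; elim: r => [|l r IH].
  rewrite (_ : (fun i j => _) = fun _ _ => 0); first exact: psd0.
  by apply/funext => i; apply/funext => j; rewrite big_nil.
rewrite (_ : (fun i j => _) = fun i j =>
  (if p l then M l i j else 0) + \sum_(l <- r | p l) M l i j).
  apply: psdD IH; case: (boolP (p l)) => pl; [exact: pM | exact: psd0].
by apply/funext => i; apply/funext => j; rewrite big_cons; case: ifP; rewrite ?add0r.
Qed.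

(** Schur's product theorem: after writing [N] as a sum of squares, the form
    of the product is a sum of values of the form of [M]. *)
Lemma psdM M N : psd M -> psd N -> psd (fun i j => M i j * N i j).
Proof.
move=> pM pN; have [m [v vE]] := psd_sos pN.
rewrite (_ : (fun i j => _) = fun i j => \sum_(l < m) v l i * v l j * M i j); last first.
  by apply/funext => i; apply/funext => j; rewrite vE mulrC mulr_suml.
apply: psd_sum => l _; case: pM => sM pM; split=> [i j|x]; first by rewrite sM [v l i * _]mulrC.
rewrite (_ : quad _ _ = quad M (fun i => v l i * x i))//.
by apply: eq_bigr => i _; apply: eq_bigr => j _; ring.
Qed.

Lemma psd_prod (J : Type) (r : seq J) (p : pred J) (M : J -> 'I_n -> 'I_n -> R) :
  (forall l, p l -> psd (M l)) -> psd (fun i j => \prod_(l <- r | p l) M l i j).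
Proof.
move=> pM; elim: r => [|l r IH].
  rewrite (_ : (fun i j => _) = fun _ _ => 1); first exact: psd1.
  by apply/funext => i; apply/funext => j; rewrite big_nil.
rewrite (_ : (fun i j => _) = fun i j =>
  (if p l then M l i j else 1) * \prod_(l <- r | p l) M l i j).
  apply: psdM IH; case: (boolP (p l)) => pl; [exact: pM | exact: psd1].
by apply/funext => i; apply/funext => j; rewrite big_cons; case: ifP; rewrite ?mul1r.
Qed.

(** All the inequalities between one-dimensional quantities are stated in this
    order, because it is stable under products ([psd_le_prod]) and so passes
    to tensor products. *)
Definition psd_le M N := psd (fun i j => N i j - M i j).

Lemma psd_le_refl M : psd_le M M.
Proof.
by rewrite /psd_le (_ : (fun i j => _) = fun _ _ => 0); [exact: psd0|
  apply/funext => i; apply/funext => j; rewrite subrr].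
Qed.

Lemma psd_le_trans N M K : psd_le M N -> psd_le N K -> psd_le M K.
Proof.
move=> h k; rewrite /psd_le (_ : (fun i j => _) = fun i j => (N i j - M i j) + (K i j - N i j)).
  exact: psdD.
by apply/funext => i; apply/funext => j; ring.
Qed.

Lemma psd_leZ c M N : 0 <= c -> psd_le M N -> psd_le (fun i j => c * M i j) (fun i j => c * N i j).
Proof.
move=> c0 h; rewrite /psd_le (_ : (fun i j => _) = fun i j => c * (N i j - M i j)); first exact: psdZ.
by apply/funext => i; apply/funext => j; ring.
Qed.

Lemma psd_le_coef c e M : c <= e -> psd M -> psd_le (fun i j => c * M i j) (fun i j => e * M i j).
Proof.
move=> ce h; rewrite /psd_le (_ : (fun i j => _) = fun i j => (e - c) * M i j).
  by apply: psdZ => //; rewrite subr_ge0.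
by apply/funext => i; apply/funext => j; ring.
Qed.

Lemma psd_le_psd M N : psd M -> psd_le M N -> psd N.
Proof.
move=> pM h; rewrite (_ : N = fun i j => M i j + (N i j - M i j)); first exact: psdD.
by apply/funext => i; apply/funext => j; ring.
Qed.

Lemma psd_le_sum (J : Type) (r : seq J) (p : pred J) (M N : J -> 'I_n -> 'I_n -> R) :
  (forall l, p l -> psd_le (M l) (N l)) ->
  psd_le (fun i j => \sum_(l <- r | p l) M l i j) (fun i j => \sum_(l <- r | p l) N l i j).
Proof.
move=> h; rewrite /psd_le (_ : (fun i j => _) = fun i j => \sum_(l <- r | p l) (N l i j - M l i j)).
  exact: psd_sum.
by apply/funext => i; apply/funext => j; rewrite sumrB.
Qed.

(** [M' N' - M N = M (N' - N) + (M' - M) N']. *)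
Lemma psd_leM M M' N N' : psd M -> psd N' -> psd_le M M' -> psd_le N N' ->
  psd_le (fun i j => M i j * N i j) (fun i j => M' i j * N' i j).
Proof.
move=> pM pN' h k; rewrite /psd_le (_ : (fun i j => _) = fun i j =>
  (M' i j - M i j) * N' i j + M i j * (N' i j - N i j)).
  by apply: psdD; exact: psdM.
by apply/funext => i; apply/funext => j; ring.
Qed.

Lemma psd_le_prod (J : Type) (r : seq J) (p : pred J) (M N : J -> 'I_n -> 'I_n -> R) :
  (forall l, p l -> psd (M l)) -> (forall l, p l -> psd_le (M l) (N l)) ->
  psd_le (fun i j => \prod_(l <- r | p l) M l i j) (fun i j => \prod_(l <- r | p l) N l i j).
Proof.
move=> pM h; elim: r => [|l r IH].
  rewrite (_ : (fun i j => _) = fun i j => \prod_(l <- [::] | p l) N l i j); first exact: psd_le_refl.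
  by apply/funext => i; apply/funext => j; rewrite !big_nil.
have e K : (fun i j => \prod_(l <- l :: r | p l) K l i j) = fun i j =>
  (if p l then K l i j else 1) * \prod_(l <- r | p l) K l i j.
  by apply/funext => i; apply/funext => j; rewrite big_cons; case: ifP; rewrite ?mul1r.
rewrite !e; apply: psd_leM IH.
- by case: (boolP (p l)) => pl; [exact: pM|exact: psd1].
- by apply: psd_prod => k pk; apply: psd_le_psd (h k pk); exact: pM.
- by case: (boolP (p l)) => pl; [exact: h|exact: psd_le_refl].
Qed.

Lemma psd_total M : psd M -> 0 <= \sum_i \sum_j M i j.
Proof.
move=> [_ /(_ (fun=> 1))]; rewrite /quad.
by under eq_bigr do under eq_bigr do rewrite !mul1r.
Qed.

(** The sum of all entries is the value of the form at [(1, ..., 1)]. Applied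
    to a Gram matrix of elementary tensors it is the squared norm of their
    sum. *)
Lemma psd_le_total M N : psd_le M N -> \sum_i \sum_j M i j <= \sum_i \sum_j N i j.
Proof.
move=> /psd_total h; rewrite -subr_ge0 -sumrB; apply: le_trans h _.
by apply: ler_sum => i _; rewrite sumrB.
Qed.

End Closure.
End PositiveSemidefinite.

(** * Multi-indices, the number of nodes, and the coefficients of the Smolyak sum *)

Section Counting.
Local Open Scope nat_scope.

(** The first entry of a multi-index is determined by the size and the other
    entries. *)
Lemma card_fixed_sum d L v :
  (#|[pred k : {ffun 'I_d.+1 -> 'I_L.+1} | \sum_n k n == v]| <= L.+1 ^ d)%N.
Proof.
pose r (k : {ffun 'I_d.+1 -> 'I_L.+1}) : {ffun 'I_d -> 'I_L.+1} := [ffun i => k (lift ord0 i)].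
have rinj : {in [pred k : {ffun 'I_d.+1 -> 'I_L.+1} | \sum_n k n == v] &, injective r}.
  move=> k k'; rewrite !inE => /eqP kv /eqP kv' /ffunP rk.
  have e i : k (lift ord0 i) = k' (lift ord0 i) by have := rk i; rewrite !ffunE.
  have e0 : k ord0 = k' ord0.
    apply/val_inj/eqP; rewrite /= -(eqn_add2r (\sum_(i < d) k (lift ord0 i))).
    rewrite -(big_ord_recl _ (fun i => k i : nat)) kv.
    under eq_bigr do rewrite e.
    by rewrite -(big_ord_recl _ (fun i => k' i : nat)) kv'.
  by apply/ffunP => i; case: (unliftP ord0 i) => [j ->|->].
rewrite -(card_in_imset rinj) -[X in (_ <= X)%N](_ : #|{: {ffun 'I_d -> 'I_L.+1}}| = _).
  exact: max_card.
by rewrite card_ffun !card_ord.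
Qed.

Lemma sum_ffun_ltn d L (k : {ffun 'I_d.+1 -> 'I_L.+1}) : (\sum_n k n < (d.+1 * L).+1)%N.
Proof.
rewrite ltnS -[X in (_ <= X * _)%N]card_ord -sum_nat_const; apply: leq_sum => i _.
by rewrite -ltnS.
Qed.

End Counting.

Section MultiIndexSums.
Context {R : realType}.

Lemma sum_by_size d L (p : pred nat) (F : nat -> R) : (forall v, 0 <= F v) ->
  \sum_(k : {ffun 'I_d.+1 -> 'I_L.+1} | p (\sum_n k n)%N) F (\sum_n k n)%N
  <= L.+1%:R ^+ d * \sum_(v < (d.+1 * L).+1 | p v) F v.
Proof.
move=> F0.
rewrite (partition_big (fun k : {ffun 'I_d.+1 -> 'I_L.+1} => Ordinal (sum_ffun_ltn k)) (fun v => p v))//=.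
rewrite mulr_sumr; apply: ler_sum => v pv.
rewrite (eq_bigr (fun=> F v)); last by move=> k /andP[_ /eqP <-].
rewrite sumr_const -[leLHS]mulr_natl; apply: ler_wpM2r => //.
rewrite -natrX ler_nat; apply: leq_trans (card_fixed_sum d L v).
apply: subset_leq_card; apply/fintype.subsetP => k.
by rewrite !inE => /andP[_ /eqP <-] /=.
Qed.

(** The ratio is at most [1/2], so the tail is at most its leading bound
    [q ^ M]. *)
Lemma geometric_tail (q : R) (M B : nat) : 0 <= q -> q <= 2^-1 ->
  \sum_(v < B | (M < v)%N) q ^+ v <= q ^+ M.
Proof.
move=> q0 q2.
(* the extra term closes the induction, because 2 q ^ B <= q ^ (B - 1) *)
suff h : \sum_(v < B | (M < v)%N) q ^+ v <= q ^+ M - (if (M < B)%N then q ^+ B.-1 else q ^+ M).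
  apply: le_trans h _; rewrite lerBlDr lerDl; case: ifP => _; exact: exprn_ge0.
elim: B => [|B IH]; first by rewrite big_ord0 subrr.
rewrite big_mkcond big_ord_recr -big_mkcond /=.
rewrite ltnS; case: (ltngtP M B) => MB; last 2 first.
- by apply: le_trans (_ : 0 <= _); rewrite ?subrr// addr0; apply: le_trans IH _;
    rewrite ltnNge (ltnW MB)/= subrr.
- move: IH; rewrite MB ltnn addr0 !subrr => h; exact: h.
move: IH; rewrite MB => IH; apply: le_trans (lerD IH (lexx _)) _.
have qB : q ^+ B <= q ^+ B.-1 * 2^-1.
  case: B MB {IH} => // B _ /=; rewrite exprSr; apply: ler_wpM2l => //; exact: exprn_ge0.
have := exprn_ge0 B q0; have := exprn_ge0 B.-1 q0.
lra.
Qed.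

Lemma multi_tail d L M (q : R) : 0 <= q -> q <= 2^-1 ->
  \sum_(k : {ffun 'I_d.+1 -> 'I_L.+1} | (M < \sum_n k n)%N) q ^+ (\sum_n k n)%N
  <= L.+1%:R ^+ d * q ^+ M.
Proof.
move=> q0 q2; apply: le_trans (sum_by_size d L (fun v => (M < v)%N) (F := fun v => q ^+ v) _) _.
  by move=> v; exact: exprn_ge0.
by apply: ler_wpM2l; [exact: exprn_ge0 | exact: geometric_tail].
Qed.

End MultiIndexSums.

Section Cost.
Local Open Scope nat_scope.

Lemma sum_geometric_nat b m : 1 < b -> \sum_(v < m.+1) b ^ v <= 2 * b ^ m.
Proof.
move=> b1; elim: m => [|m IH]; first by rewrite big_ord_recl big_ord0 expn0.
rewrite big_ord_recr/= mul2n -addnn leq_add2r (leq_trans IH)// expnS leq_mul2r b1 orbT//.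
Qed.

Lemma smolyak_cost_ge b d L : 0 < b -> d.+1 <= L -> b ^ (L - d.+1) <= smolyak_cost b d.+1 L.
Proof.
move=> b0 dL; rewrite /smolyak_cost.
have lt : L - d < L.+1 by lia.
have l1 : 1 < L.+1 by lia.
(* all the excess in one entry: this multi-index alone costs that many nodes *)
pose l : {ffun 'I_d.+1 -> 'I_L.+1} := [ffun n => if n == ord0 then Ordinal lt else Ordinal l1].
have ls : \sum_n l n = L.
  rewrite big_ord_recl ffunE eqxx /= (eq_bigr (fun=> 1)).
    by rewrite sum_nat_const card_ord muln1; lia.
  by move=> i _; rewrite ffunE.
rewrite (bigD1 l)/=; first by rewrite ls leq_addr.
rewrite ls /smolyak_ix ls leqnn andbT; apply/andP; split; last by lia.
by apply/forallP => n; rewrite ffunE; case: ifP => _ /=; lia.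
Qed.

Lemma smolyak_ix_ge d L (l : {ffun 'I_d -> 'I_L.+1}) : smolyak_ix l -> d <= \sum_n l n.
Proof.
move=> /andP[/forallP h _]; rewrite -[X in X <= _](card_ord d) -sum1_card.
by apply: leq_sum => n _; exact: h.
Qed.

(** For [L = d] the only admissible multi-index is [(1, ..., 1)], which costs
    one node, so that [ln N] vanishes. *)
Lemma smolyak_cost_start b d : smolyak_cost b d d <= 1.
Proof.
rewrite /smolyak_cost (eq_bigr (fun=> 1)).
  rewrite sum1_card; apply/card_le1_eqP => l l'; rewrite !unfold_in => /andP[hl _] /andP[hl' _].
  have one (k : {ffun 'I_d -> 'I_d.+1}) : smolyak_ix k -> forall n, k n = 1 :> nat.
    move=> hk n; have /andP[/forallP h s] := hk.
    apply/eqP; rewrite eqn_leq h andbT leqNgt; apply/negP => kn.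
    have : \sum_(i < d) k i > d.
      apply: (@leq_trans (2 + \sum_(i < d | i != n) 1)).
        rewrite sum1_card (cardC1 n) card_ord; have := ltn_ord n; lia.
      rewrite [X in _ <= X](bigD1 n)//=.
      by apply: leq_add => //; apply: leq_sum => i _; exact: h.
    by rewrite ltnNge s.
  by apply/ffunP => n; apply/val_inj; rewrite /= !one.
by move=> l /andP[hl _]; have /andP[_ s] := hl; move: s; rewrite -subn_eq0 => /eqP ->; rewrite expn0.
Qed.

End Cost.

Section CostUpper.
Context {R : realType}.

Lemma smolyak_cost_le b d L : (1 < b)%N -> (d.+1 <= L)%N ->
  (smolyak_cost b d.+1 L)%:R <= 2 * L.+1%:R ^+ d * (b ^ (L - d.+1))%:R :> R.
Proof.
move=> b1 dL.
pose p v := (d.+1 <= v <= L)%N.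
apply: (@le_trans _ _ (\sum_(k : {ffun 'I_d.+1 -> 'I_L.+1} | p (\sum_n k n)%N) (b ^ (\sum_n k n - d.+1))%:R)).
  rewrite natr_sum big_mkcond [leRHS]big_mkcond/=; apply: ler_sum => k _.
  have [/andP[hk _]|_] := ifP; last by case: ifP.
  by rewrite /p smolyak_ix_ge//=; have /andP[_ ->] := hk.
apply: le_trans (sum_by_size d L p (F := fun v => (b ^ (v - d.+1))%:R) _) _.
  by move=> v; exact: ler0n.
rewrite -mulrA mulrCA; apply: ler_wpM2l; first exact: exprn_ge0.
rewrite -natr_sum -natrM ler_nat.
apply: leq_trans (sum_geometric_nat (L - d.+1) b1).
rewrite -(big_mkord (fun v => p v) (fun v => b ^ (v - d.+1))%N).
rewrite -(big_mkord xpredT (fun v => b ^ v)%N).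
apply: (@leq_trans (\sum_(d.+1 <= v < L.+1) b ^ (v - d.+1))%N).
  have dB : (L < (d.+1 * L).+1)%N by rewrite ltnS mulSn leq_addr.
  rewrite (@big_cat_nat _ _ _ d.+1) ?(leq_trans _ dB)//= ?(leqW (ltnW dL))//=; last by lia.
  rewrite big1_seq ?add0n; last by move=> v /=; rewrite mem_index_iota /p; lia.
  rewrite (@big_cat_nat _ _ _ L.+1) //=; last by lia.
  rewrite [X in (_ + X)%N]big1_seq ?addn0; last by move=> v /=; rewrite mem_index_iota /p; lia.
  by rewrite big_mkcond; apply: leq_sum => v _; case: ifP.
rewrite -{1}[d.+1]add0n big_addn subSn//.
by under eq_bigr do rewrite addnK.
Qed.

End CostUpper.

Section SmolyakCoefficient.
Context {R : realType}.

(** Coefficient of [U_k - I] (of [I] for [k = 0]) in [U_l - U_(l-1)]. *)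
Definition delta_coef (l k : nat) : R :=
  if k is 0 then (l == 1)%N%:R else (l == k)%:R - (l == k.+1)%:R.

(** Coefficient of the product of the [U_(k n) - I] (of [I] where [k n = 0])
    in the Smolyak sum. *)
Definition smolyak_coef d L (k : 'I_d -> nat) : R :=
  \sum_(l : {ffun 'I_d -> 'I_L.+1} | smolyak_ix l) \prod_n delta_coef (l n) (k n).

Let sgn (k : nat) (v : bool) : R := if v then - (0 < k)%:R else 1.

(** A uniform shape of the coefficient: a plus term at [max (k, 1)] and, if
    [k > 0], a minus term one level higher. *)
Lemma delta_coefE l k : delta_coef l k = \sum_(v : bool) sgn k v * (l == maxn k 1 + v)%N%:R.
Proof.
rewrite big_bool /sgn /delta_coef; case: k => [|k] /=; first by rewrite oppr0 mul0r add0r mul1r.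
rewrite (maxn_idPl _)// addn1 addn0 mulN1r mul1r addrC; by [].
Qed.

Lemma smolyak_ix_indic d L (e : 'I_d -> nat) : (forall n, (0 < e n)%N) ->
  \sum_(l : {ffun 'I_d -> 'I_L.+1} | smolyak_ix l) \prod_n ((l n == e n :> nat)%:R : R)
  = (\sum_n e n <= L)%N%:R.
Proof.
move=> e0.
have eprod (l : {ffun 'I_d -> 'I_L.+1}) : \prod_n ((l n == e n :> nat)%:R : R) = [forall n, l n == e n :> nat]%:R.
  case: (boolP [forall n, _]) => [/forallP h|]; first by rewrite big1// => n _; rewrite (eqP (h n)) eqxx.
  by rewrite negb_forall => /existsP[n /negPf h]; rewrite (bigD1 n)//= h mul0r.
have [eL|eL] := leqP; last first.
  rewrite big1// => l /andP[_ lL]; rewrite eprod; case: forallP => // h.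
  by move: eL; rewrite ltnNge -(eq_bigr _ (fun n _ => eqP (h n))) lL.
have en n : (e n < L.+1)%N.
  by rewrite ltnS (leq_trans _ eL)// (bigD1 n)//= leq_addr.
pose l0 : {ffun 'I_d -> 'I_L.+1} := [ffun n => Ordinal (en n)].
rewrite (bigD1 l0)/=; last first.
  apply/andP; split; first by apply/forallP => n; rewrite ffunE /= e0.
  by rewrite (eq_bigr e)// => n _; rewrite ffunE.
rewrite eprod (_ : [forall n, _]); last by apply/forallP => n; rewrite ffunE.
rewrite big1 ?addr0// => l /andP[_ ll0]; rewrite eprod; case: forallP => // h.
case/eqP: ll0; apply/ffunP => n; apply/val_inj; rewrite ffunE /=; exact/eqP/h.
Qed.

Lemma smolyak_coefE d L (k : 'I_d -> nat) :
  smolyak_coef L k = \sum_(v : {ffun 'I_d -> bool})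
    (\prod_n sgn (k n) (v n)) * (\sum_n (maxn (k n) 1 + v n) <= L)%N%:R.
Proof.
rewrite /smolyak_coef.
under eq_bigr => l _ do under eq_bigr => n _ do rewrite delta_coefE.
under eq_bigr => l _ do rewrite bigA_distr_bigA/=.
rewrite exchange_big/=; apply: eq_bigr => v _.
under eq_bigr => l _ do rewrite big_split/=.
rewrite -mulr_sumr smolyak_ix_indic// => n.
by rewrite addn_gt0 leq_max orbT.
Qed.

(** Up to size [L - d] the Smolyak sum reproduces the tensor product exactly:
    the only surviving term is that of [k = 0], the integral. *)
Lemma smolyak_coef_small d L (k : 'I_d -> nat) : (\sum_n k n + d <= L)%N ->
  smolyak_coef L k = [forall n, k n == 0%N]%:R.
Proof.
move=> kL; rewrite smolyak_coefE.
(* the bound on the size is satisfied by all nonzero terms, so the sum factorizes, and a factor with k n > 0 is 1 - 1 *)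
transitivity (\sum_(v : {ffun 'I_d -> bool}) \prod_n sgn (k n) (v n)).
  apply: eq_bigr => v _; have [vk|] := boolP [forall n, v n ==> (0 < k n)%N].
    rewrite (_ : (_ <= L)%N) ?mulr1//; apply: leq_trans kL.
    rewrite -[X in (_ <= _ + X)%N](card_ord d) -sum1_card -big_split/=.
    apply: leq_sum => n _; have := forallP vk n.
    by case: (v n) => /=; case: (k n) => // *; rewrite ?maxnE; lia.
  rewrite negb_forall => /existsP[n]; rewrite negb_imply lt0n negbK => /andP[vn /eqP kn].
  by rewrite (bigD1 n)//= /sgn vn kn oppr0 !mul0r.
rewrite -(bigA_distr_bigA (fun n v => sgn (k n) v)).
have e n : \sum_(v : bool) sgn (k n) v = (k n == 0%N)%:R.
  by rewrite big_bool /sgn; case: (k n) => [|m] /=; rewrite ?oppr0 ?add0r// addNr.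
under eq_bigr do rewrite e.
case: (boolP [forall n, _]) => [/forallP h|]; first by rewrite big1// => n _; rewrite h.
by rewrite negb_forall => /existsP[n /negPf h]; rewrite (bigD1 n)//= h mul0r.
Qed.

Lemma smolyak_coef_bound d L (k : 'I_d -> nat) : `|smolyak_coef L k| <= 2 ^+ d.
Proof.
rewrite smolyak_coefE; apply: le_trans (ler_norm_sum _ _ _) _.
apply: (@le_trans _ _ (\sum_(v : {ffun 'I_d -> bool}) 1)).
  apply: ler_sum => v _; rewrite normrM normr_nat.
  apply: (@le_trans _ _ (\prod_(n < d) 1 * 1)); last by rewrite big1// mulr1.
  apply: ler_pM => //; last by case: (_ <= L)%N.
  rewrite normr_prod; apply: ler_prod => n _; rewrite normr_ge0/=.
  by rewrite /sgn; case: (v n); rewrite ?normr1// normrN normr_nat; case: (0 < k n)%N.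
by rewrite sumr_const card_ffun card_bool card_ord natrX.
Qed.

End SmolyakCoefficient.

Section FinalRate.
Context {R : realType}.

(** With [Z = b ^ (L - (d + 1))], the error is of order
    [sqrt (L ^ d Z ^ -(2 alpha + 1))]. The cost [N] is at least [Z], at most
    of order [L ^ d Z], and [L] is at most of order [ln N]; hence the error is
    at most of order [L ^ (d (1 + alpha)) N ^ -(alpha + 1/2)]. *)
Lemma smolyak_rate (b d : nat) (alpha K : R) : (1 < b)%N -> 0 < alpha -> 0 <= K ->
  exists C : R, forall L, (d.+1 <= L)%N ->
    (d.+1 == 1%N) || (1 < smolyak_cost b d.+1 L)%N ->
    (K * (L.+1%:R ^+ d * (b%:R `^ (- (2 * alpha + 1))) ^+ (L - d.+1))) `^ 2^-1 <=
    C * (ln (smolyak_cost b d.+1 L)%:R `^ (d%:R * (1 + alpha))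
         / (smolyak_cost b d.+1 L)%:R `^ (alpha + 2^-1)).
Proof.
move=> b1 a0 K0.
have b0 : (0 < b)%N by exact: ltnW.
(* with this c, L + 1 <= c ln N when L > d + 1, because N >= 2 ^ (L - d - 1) *)
pose c : R := d.+3%:R / ln 2.
have ln2 : 0 < ln 2 :> R by rewrite ln_gt0// ltr1n.
exists (K `^ 2^-1 * 2 `^ (alpha + 2^-1) * c `^ (d%:R * (1 + alpha))) => L dL hN.
set N := smolyak_cost b d.+1 L in hN *.
pose Z : R := (b ^ (L - d.+1))%:R; pose W : R := L.+1%:R ^+ d.
have Z1 : 1 <= Z by rewrite /Z ler1n expn_gt0 b0.
have Z0 : 0 < Z by exact: lt_le_trans Z1.
have W0 : 0 < W by rewrite exprn_gt0.
have NZ : Z <= N%:R by rewrite ler_nat smolyak_cost_ge.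
have NW : N%:R <= 2 * W * Z by exact: smolyak_cost_le.
have N0 : 0 < N%:R :> R by exact: lt_le_trans NZ.
have g0 : 0 <= alpha + 2^-1 by rewrite addr_ge0// ?ltW// invr_gt0.
have e1 : (b%:R `^ (- (2 * alpha + 1))) ^+ (L - d.+1) = (Z `^ (alpha + 2^-1)) ^- 2.
  rewrite -powR_mulrn ?powR_ge0// powRAC powR_mulrn ?ler0n// -natrX -/Z powRN; congr (_^-1).
  by rewrite -powR_mulrn ?powR_ge0// -powRrM; congr (_ `^ _); field.
have Zi0 : 0 <= (Z `^ (alpha + 2^-1)) ^- 2 by rewrite invr_ge0 exprn_ge0// powR_ge0.
rewrite e1 -/W (powRM _ K0) ?mulr_ge0// ?(ltW W0)// (powRM _ (ltW W0) Zi0).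
have e2 : ((Z `^ (alpha + 2^-1)) ^- 2) `^ 2^-1 = (Z `^ (alpha + 2^-1))^-1.
  rewrite powR12_sqrt; last by rewrite invr_ge0 exprn_ge0// powR_ge0.
  by rewrite -exprVn sqrtr_sqr ger0_norm// invr_ge0 powR_ge0.
rewrite e2 -!mulrA; apply: ler_wpM2l; first exact: powR_ge0.
rewrite !mulrA ler_pdivrMr ?powR_gt0// mulrAC ler_pdivlMr ?powR_gt0//.
apply: (@le_trans _ _ (W `^ 2^-1 * (2 * W * Z) `^ (alpha + 2^-1))).
  by apply: ler_wpM2l; [exact: powR_ge0|apply: ge0_ler_powR => //; rewrite nnegrE ltW// ?mulr_gt0].
rewrite (powRM _ (ltW (mulr_gt0 _ W0)) (ltW Z0))// (powRM _ _ (ltW W0))//.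
set z := Z `^ _; set t := 2 `^ _.
suff h : W `^ 2^-1 * W `^ (alpha + 2^-1) <= c `^ (d%:R * (1 + alpha)) * ln N%:R `^ (d%:R * (1 + alpha)).
  have := ler_wpM2l (powR_ge0 2 (alpha + 2^-1)) (ler_wpM2r (powR_ge0 Z (alpha + 2^-1)) h).
  by rewrite -/z -/t => h'; move: h'; set x1 := W `^ _; set x2 := W `^ _; set x3 := c `^ _;
    set x4 := ln _ `^ _; lra.
rewrite -powRD; last by rewrite (gt_eqF W0) implybT.
rewrite /W -powR_mulrn// -powRrM (_ : 2^-1 + _ = 1 + alpha); last by field.
clear z t e2 e1 Zi0.
case: d => [|d'] in c Z W dL N hN Z1 Z0 W0 NZ NW N0 *.
  by rewrite !mul0r !powRr0 mulr1.
have LN : (d'.+2 < L)%N.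
  rewrite ltn_neqAle dL andbT; apply/eqP => eL.
  by move: hN; rewrite /N -eL ltnNge smolyak_cost_start.
have lnN : (L - d'.+2)%:R * ln 2 <= ln N%:R :> R.
  apply: (@le_trans _ _ (ln Z)); last by rewrite ler_ln// posrE.
  rewrite /Z natrX lnXn ?ltr0n// -[leRHS]mulr_natl; apply: ler_wpM2l => //.
  by rewrite ler_ln ?posrE ?ltr0n// ler_nat.
rewrite -powRM; last 2 first.
- by rewrite /c divr_ge0// ltW.
- by rewrite (le_trans _ lnN)// mulr_ge0// ltW.
apply: ge0_ler_powR.
- by rewrite mulr_ge0// addr_ge0// ltW.
- by rewrite nnegrE.
- rewrite nnegrE mulr_ge0 ?divr_ge0 ?(ltW ln2)//.
  by rewrite (le_trans _ lnN)// mulr_ge0// ltW.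
rewrite /c mulrAC ler_pdivlMr//.
apply: (@le_trans _ _ (d'.+4%:R * ((L - d'.+2)%:R * ln 2))); last exact: ler_wpM2l.
rewrite mulrA; apply: ler_wpM2r; first exact: ltW.
rewrite -natrM ler_nat; nia.
Qed.

End FinalRate.

(** * Resolution levels of a function on the unit interval *)

Section Uniform.
Context {R : realType}.
Local Notation mu := (@lebesgue_measure R).

Lemma measurable_unit_itv : measurable (@unit_itv R).
Proof. exact: measurable_itv. Qed.

(** The uniform law is taken on the closed interval, which differs from
    [[0, 1)] by a null set. *)
Lemma unif_lebesgue (A : set R) : measurable A -> @unif R A = mu (A `&` unit_itv).
Proof.
move=> mA; rewrite /unif /= /uniform_prob integral_uniform_pdf.
have mI : measurable (A `&` `[0, 1]) by apply: measurableI.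
have mU : measurable (A `&` unit_itv) by apply: measurableI => //; exact: measurable_unit_itv.
rewrite (eq_integral (fun=> 1%E)); last first.
  move=> x; rewrite inE => -[_]; rewrite /= in_itv/= /uniform_pdf => ->.
  by rewrite subr0 invr1.
rewrite integral_cst// mul1e; apply/eqP; rewrite eq_le; apply/andP; split.
  apply: (@le_trans _ _ (mu ((A `&` unit_itv) `|` [set 1]))).
    apply: le_measure; rewrite ?inE//; first exact: measurableU.
    move=> x [Ax]; rewrite /= in_itv/= => /andP[x0]; rewrite le_eqVlt => /orP[/eqP ->|x1]; first by right.
    by left; split => //; rewrite /unit_itv /= in_itv/= x0 x1.
  apply: le_trans (measureU2 _ _ _) _ => //.
  by rewrite [X in (_ + X)%E]lebesgue_measure_set1 adde0.
apply: le_measure; rewrite ?inE//.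
by apply: setIS; apply: subset_itvl; rewrite bnd_simp.
Qed.

Lemma ge0_integral_unit_itv (f : R -> \bar R) : measurable_fun unit_itv f ->
  (forall x, unit_itv x -> 0 <= f x)%E ->
  (\int[mu]_(x in unit_itv) f x = \int[@unif R]_x (f \_ unit_itv) x)%E.
Proof.
move=> mf f0; rewrite /unif /= integral_uniform.
- rewrite subr0 invr1 mul1e -integral_mkcondr; congr integral.
  by apply/esym/setIidr; apply: subset_itvl; rewrite bnd_simp.
- by apply/(measurable_restrictT _ measurable_unit_itv).
- by move=> x; rewrite patchE; case: ifP => // /[!inE] /f0.
Qed.

(** The image of Lebesgue measure under an affine map, times the slope, agrees
    with it on intervals. *)
Lemma affine_lebesgue (s t : R) (A : set R) : 0 < s -> measurable A ->
  mu ((fun u => s * u + t) @^-1` A) = ((s^-1)%:E * mu A)%E.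
Proof.
move=> s0 mA.
pose phi (u : R) := s * u + t.
have mphi : measurable_fun setT (phi : measurableTypeR R -> measurableTypeR R).
  by apply: measurable_funD => //; apply: measurable_funM.
pose m1 : {measure set (measurableTypeR R) -> \bar R} :=
  mscale (NngNum (ltW s0)) (measure_function_pushforward__canonical__measure_function_Measure mu mphi).
suff h : mu A = m1 A.
  by rewrite h /m1 /mscale /= muleA -EFinM mulVf ?gt_eqF// mul1e.
apply: lebesgue_measure_unique => // _ [[a c]] _ <-.
rewrite [RHS](_ : _ = (s%:E * mu (phi @^-1` `]a, c]%classic))%E)//.
have -> : (phi @^-1` `]a, c]) = `](a - t) / s, (c - t) / s]%classic.
  apply/seteqP; split => x /=; rewrite /phi !in_itv/= ltr_pdivrMr// ler_pdivlMr// ltrBlDr lerBrDr [x * s]mulrC//.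
rewrite /= !lebesgue_measure_itv /= !lte_fin ltr_pM2r ?invr_gt0// ltrD2r.
case: ifP => ac; last by rewrite mule0.
by rewrite -!EFinB -EFinM; congr (_%:E); field; rewrite gt_eqF.
Qed.

End Uniform.

Section Cells.
Context {R : realType}.
Variable b : nat.
Hypothesis b1 : (1 < b)%N.

Let b0 : (0 < b)%N. Proof. exact: ltnW. Qed.

(** The integer formed by the first [j] base-[b] digits of [x]. *)
Definition lvl (j : nat) (x : R) : nat := Num.truncn (b%:R ^+ j * x).

Lemma bX_gt0 j : 0 < b%:R ^+ j :> R.
Proof. by rewrite exprn_gt0// ltr0n. Qed.

Lemma lvlS j x : 0 <= x -> (lvl j.+1 x %/ b)%N = lvl j x.
Proof.
move=> x0.
have y0 : 0 <= b%:R ^+ j.+1 * x by rewrite mulr_ge0// ltW// bX_gt0.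
apply/esym/truncn_def; rewrite -/(lvl j.+1 x); have /andP[] := truncn_itv y0; rewrite -/(lvl j.+1 x).
set y := lvl _ _; rewrite exprS -mulrA => h1 h2.
have bR : 0 < b%:R :> R by rewrite ltr0n.
apply/andP; split.
  rewrite -(ler_pM2l bR) -natrM.
  by apply: le_trans h1; rewrite ler_nat mulnC leq_trunc_div.
rewrite -(ltr_pM2l bR) -natrM; apply: lt_le_trans h2 _; rewrite ler_nat mulnC; exact: ltn_ceil.
Qed.

Lemma lvl_div j r x : 0 <= x -> (lvl (j + r) x %/ b ^ r)%N = lvl j x.
Proof.
move=> x0; elim: r => [|r IH]; first by rewrite addn0 expn0 divn1.
by rewrite addnS expnS divnMA lvlS.
Qed.

Lemma lvl_lt j x : 0 <= x < 1 -> (lvl j x < b ^ j)%N.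
Proof.
move=> /andP[x0 x1]; rewrite truncn_lt_nat; last by rewrite mulr_ge0// ltW// bX_gt0.
by rewrite natrX -[ltRHS]mulr1 ltr_pM2l// bX_gt0.
Qed.

Lemma lvl0 x : 0 <= x < 1 -> lvl 0 x = 0%N.
Proof. by move=> /(lvl_lt 0); rewrite expn0 ltnS leqn0 => /eqP. Qed.

Definition cell (j k : nat) : set R := [set x | 0 <= x < 1 /\ lvl j x = k].

Lemma cellE j k : (k < b ^ j)%N ->
  cell j k = `[k%:R / b%:R ^+ j, k.+1%:R / b%:R ^+ j[%classic.
Proof.
move=> kj; have B := bX_gt0 j.
apply/seteqP; split => x /=; rewrite in_itv/=.
  move=> [/andP[x0 x1] <-]; rewrite ler_pdivrMr// ltr_pdivlMr// mulrC.
  by apply: truncn_itv; rewrite mulr_ge0// ltW.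
rewrite ler_pdivrMr// ltr_pdivlMr// mulrC => h.
have h0 : 0 <= b%:R ^+ j * x by case/andP: h => + _; apply: le_trans.
split; last exact: truncn_def.
rewrite -(pmulr_rge0 x B) h0/=; case/andP: h => _ h.
by rewrite -(ltr_pM2l B) mulr1; apply: lt_le_trans h _; rewrite -natrX ler_nat.
Qed.

Lemma cell_out j k : (b ^ j <= k)%N -> cell j k = set0.
Proof.
by move=> jk; apply/seteqP; split => // x [/(lvl_lt j) + e]; rewrite e ltnNge jk.
Qed.

Lemma measurable_cell j k : measurable (cell j k).
Proof.
have [kj|kj] := ltnP k (b ^ j); first by rewrite cellE.
by rewrite cell_out.
Qed.

Lemma unif_cell j k : (k < b ^ j)%N -> @unif R (cell j k) = ((b%:R ^- j)%:E)%E.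
Proof.
move=> kj; rewrite unif_lebesgue; last exact: measurable_cell.
rewrite setIidl; last by move=> x [+ _]; rewrite /unit_itv /= in_itv.
rewrite cellE// lebesgue_measure_itv/= lte_fin ltr_pM2r ?invr_gt0 ?bX_gt0//.
rewrite ltr_nat ltnSn -EFinB -mulrBl -natrB// subSnn mul1r//.
Qed.

(** Vanishing outside [[0, 1)] makes sums over the cells hold everywhere, not
    only almost everywhere. *)
Definition uL2 (f : R -> R) := L2 (@unif R) f /\ forall x, ~~ (0 <= x < 1) -> f x = 0.

Definition cint (j k : nat) (f : R -> R) : R := Ex (@unif R) (fun x => \1_(cell j k) x * f x).

Lemma L1_cint j k f : uL2 f -> L1 (@unif R) (fun x => \1_(cell j k) x * f x).
Proof. by move=> [hf _]; apply: L2_L1; apply: L2_indicM => //; exact: measurable_cell. Qed.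

Lemma indic_cell j k x : 0 <= x < 1 -> \1_(cell j k) x = (lvl j x == k)%:R :> R.
Proof.
move=> hx; rewrite indicE (_ : (x \in cell j k) = (lvl j x == k))//; apply/idP/eqP; first by rewrite inE => -[].
by move=> e; rewrite inE.
Qed.

Lemma uL2_out f x : uL2 f -> ~~ (0 <= x < 1) -> f x = 0.
Proof. by case=> _; apply. Qed.

(** A cell is the disjoint union of its subcells [r] levels further down. *)
Lemma cint_refine j r k f : uL2 f ->
  cint j k f = \sum_(k' < b ^ (j + r) | (k' %/ b ^ r == k)%N) cint (j + r) k' f.
Proof.
move=> hf; rewrite /cint -Ex_sum; last by move=> k' _; exact: L1_cint.
congr Ex; apply/funext => x.
have [hx|hx] := boolP (0 <= x < 1); last first.
  by rewrite (uL2_out hf hx) mulr0 big1// => i _; rewrite mulr0.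
rewrite -mulr_suml indic_cell//; congr (_ * _).
under eq_bigr do rewrite indic_cell//.
rewrite big_mkcond/= (bigD1 (Ordinal (lvl_lt (j + r) hx)))//= eqxx lvl_div; last by case/andP: hx.
rewrite big1 ?addr0; first by case: ifP.
move=> i ni; case: ifP => // _; case: eqP => // e; case/eqP: ni; apply/val_inj; by rewrite /= -e.
Qed.

Lemma cintD j k c f g : uL2 f -> uL2 g -> cint j k (fun x => c * f x + g x) = c * cint j k f + cint j k g.
Proof.
move=> hf hg; rewrite /cint -ExZ; last exact: L1_cint.
rewrite -ExD; [|apply: L1Z; exact: L1_cint|exact: L1_cint].
by congr Ex; apply/funext => x; ring.
Qed.

Lemma uL2D c f g : uL2 f -> uL2 g -> uL2 (fun x => c * f x + g x).
Proof.
move=> [hf f0] [hg g0]; split; first by apply: L2D => //; exact: L2Z.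
by move=> x hx; rewrite f0// g0// mulr0 addr0.
Qed.

(** The scalar product of the two step functions obtained by averaging [f] and
    [g] over the cells of level [j]. *)
Definition av (j : nat) (f g : R -> R) : R :=
  b%:R ^+ j * \sum_(k < b ^ j) cint j k f * cint j k g.

Lemma av0 f g : uL2 f -> uL2 g -> av 0 f g = Ex (@unif R) f * Ex (@unif R) g.
Proof.
move=> hf hg; rewrite /av expr0 mul1r expn0 big_ord1.
have e h : uL2 h -> cint 0 (@ord0 0) h = Ex (@unif R) h.
  move=> hh; congr Ex; apply/funext => x.
  have [hx|hx] := boolP (0 <= x < 1); last by rewrite (uL2_out hh hx) mulr0.
  by rewrite indic_cell// lvl0// eqxx mul1r.
by rewrite !e.
Qed.

Lemma av_ge0 j f : 0 <= av j f f.
Proof.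
apply: mulr_ge0; first exact/ltW/bX_gt0.
apply: sumr_ge0 => k _.
by rewrite -expr2 sqr_ge0.
Qed.

(** The difference of the two sides is half the sum of all the
    [(c i - c j)^2]. *)
Lemma sqr_sum_le (I : finType) (p : pred I) (c : I -> R) :
  (\sum_(i | p i) c i) ^+ 2 <= #|p|%:R * \sum_(i | p i) c i ^+ 2.
Proof.
have h : 0 <= \sum_(i | p i) \sum_(j | p j) (c i - c j) ^+ 2.
  by apply: sumr_ge0 => i _; apply: sumr_ge0 => j _; exact: sqr_ge0.
have e : \sum_(i | p i) \sum_(j | p j) (c i - c j) ^+ 2 =
  2 * (#|p|%:R * \sum_(i | p i) c i ^+ 2) - 2 * (\sum_(i | p i) c i) ^+ 2.
  set S := \sum_(i | p i) c i; set Q := \sum_(i | p i) c i ^+ 2.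
  transitivity (\sum_(i | p i) (#|p|%:R * c i ^+ 2 + (Q - 2 * S * c i))).
    apply: eq_bigr => i _.
    transitivity (\sum_(j | p j) (c i ^+ 2 + (c j ^+ 2 - 2 * c i * c j))).
      by apply: eq_bigr => j _; ring.
    rewrite big_split/= sumrB/= (_ : \sum_(j | p j) c i ^+ 2 = #|p|%:R * c i ^+ 2).
      by rewrite -mulr_sumr -/S -/Q; ring.
    by rewrite sumr_const mulr_natl.
  rewrite big_split/= sumrB/= -/Q (_ : \sum_(j | p j) Q = #|p|%:R * Q).
    by rewrite -!mulr_sumr -/S -/Q; ring.
  by rewrite sumr_const mulr_natl.
rewrite e in h; lra.
Qed.

(** Averaging over smaller cells captures more energy. *)
Lemma av_mono j f : uL2 f -> av j f f <= av j.+1 f f.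
Proof.
move=> hf; rewrite /av exprSr -mulrA; apply: ler_wpM2l; first exact/ltW/bX_gt0.
have bj0 : (0 < b ^ j)%N by rewrite expn_gt0 b0.
have klt (k : 'I_(b ^ (j + 1))) : (k %/ b ^ 1 < b ^ j)%N.
  rewrite expn1 ltn_divLR//; have := ltn_ord k; move: (nat_of_ord k) => k'.
  by rewrite addn1 expnSr.
rewrite -addn1 (partition_big (fun k => Ordinal (klt k)) xpredT)//= mulr_sumr.
apply: ler_sum => k _.
rewrite (cint_refine j 1 k hf) -expr2.
pose p (k' : 'I_(b ^ (j + 1))) := ((k' %/ b ^ 1)%N == k).
rewrite -[X in X ^+ 2]/(\sum_(i | p i) cint (j + 1) i f).
have -> : \sum_(i < b ^ (j + 1) | Ordinal (klt i) == k) cint (j + 1) i f * cint (j + 1) i f =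
   \sum_(i < b ^ (j + 1) | p i) cint (j + 1) i f ^+ 2.
  by apply: eq_big => // i _; rewrite expr2.
apply: le_trans (sqr_sum_le p _) _; apply: ler_wpM2r.
  by apply: sumr_ge0 => i _; exact: sqr_ge0.
rewrite ler_nat -[X in (_ <= X)%N]card_ord.
have inj : {in p &, injective (fun i : 'I_(b ^ (j + 1)) => Ordinal (ltn_pmod i b0))}.
  move=> i i'; rewrite !unfold_in /p expn1 => /eqP hi /eqP hi' [] e.
  by apply/val_inj; rewrite /= (divn_eq i b) (divn_eq i' b) hi hi' e.
by rewrite -(card_in_imset inj); exact: max_card.
Qed.

Lemma sum_indic_cell j x : 0 <= x < 1 -> \sum_(k < b ^ j) \1_(cell j k) x = 1 :> R.
Proof.
move=> hx; under eq_bigr do rewrite indic_cell//.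
rewrite (bigD1 (Ordinal (lvl_lt j hx)))//= eqxx big1 ?addr0// => i ni.
by case: eqP => // e; case/eqP: ni; apply/val_inj; rewrite /= -e.
Qed.

Lemma Ex_cells j (f g : R -> R) : uL2 f -> uL2 g ->
  Ex (@unif R) (fun x => f x * g x) =
  \sum_(k < b ^ j) Ex (@unif R) (fun x => \1_(cell j k) x * (f x * g x)).
Proof.
move=> hf hg; rewrite -Ex_sum; last first.
  move=> k _; have := L2_mul (L2_indicM (P := @unif R) (measurable_cell j k) hf.1) hg.1.
  by under eq_fun do rewrite -mulrA.
congr Ex; apply/funext => x; rewrite -mulr_suml.
have [hx|hx] := boolP (0 <= x < 1); last by rewrite (uL2_out hf hx) !mul0r mulr0.
by rewrite sum_indic_cell// mul1r.
Qed.

(** Jensen's inequality on each cell. *)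
Lemma av_le j f : uL2 f -> av j f f <= Ex (@unif R) (fun x => f x * f x).
Proof.
move=> hf; rewrite (Ex_cells j hf hf) /av mulr_sumr; apply: ler_sum => k _.
rewrite -expr2; have := cauchy_indic (P := @unif R) (measurable_cell j k) hf.1.
rewrite unif_cell// /= mulrC.
under [X in _ <= Ex _ X * _]eq_fun do rewrite expr2.
by rewrite ler_pdivlMr ?bX_gt0// mulrC.
Qed.

(** [lev m j] is the energy of the resolution level [j]; the last level
    [m.+1] collects everything finer than the cells of side [b ^ -m]. *)
Definition upto (m j : nat) (f g : R -> R) : R :=
  if (j <= m)%N then av j f g else Ex (@unif R) (fun x => f x * g x).

Definition lev (m j : nat) (f g : R -> R) : R :=
  if j is j'.+1 then upto m j'.+1 f g - upto m j' f g else upto m 0 f g.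

Lemma upto_sum m j f g : upto m j f g = \sum_(i < j.+1) lev m i f g.
Proof.
elim: j => [|j IH]; first by rewrite big_ord1.
by rewrite big_ord_recr /= -IH addrC subrK.
Qed.

Lemma upto_sym m j f g : upto m j f g = upto m j g f.
Proof.
rewrite /upto; case: ifP => _.
  by congr (_ * _); apply: eq_bigr => k _; rewrite mulrC.
by congr Ex; apply/funext => x; rewrite mulrC.
Qed.

Lemma upto_lin m j c f g h : uL2 f -> uL2 g -> uL2 h ->
  upto m j (fun x => c * f x + g x) h = c * upto m j f h + upto m j g h.
Proof.
move=> hf hg hh; rewrite /upto; case: ifP => _.
  rewrite /av mulrCA -mulrDr; congr (_ * _); rewrite mulr_sumr -big_split/=.
  by apply: eq_bigr => k _; rewrite cintD//; ring.
rewrite -ExZ; last exact: L2_mul hf.1 hh.1.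
rewrite -ExD; [|apply: L1Z; exact: L2_mul hf.1 hh.1|exact: L2_mul hg.1 hh.1].
by congr Ex; apply/funext => x; ring.
Qed.

Lemma lev_ge0 m j f : uL2 f -> 0 <= lev m j f f.
Proof.
move=> hf; case: j => [|j] /=; first by rewrite /upto av_ge0.
rewrite subr_ge0 /upto; case: (ltngtP j m) => jm //=.
- exact: av_mono.
- by rewrite jm; exact: av_le.
Qed.

Lemma lev_sym m j f g : lev m j f g = lev m j g f.
Proof. by case: j => [|j] /=; rewrite !(upto_sym m _ f g). Qed.

Lemma lev_lin m j c f g h : uL2 f -> uL2 g -> uL2 h ->
  lev m j (fun x => c * f x + g x) h = c * lev m j f h + lev m j g h.
Proof. by move=> hf hg hh; case: j => [|j] /=; rewrite !upto_lin//; ring. Qed.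

End Cells.

Section FormPsd.
Context {R : rcfType}.

(** The form of the Gram matrix at [x] is the value of [B] at the linear
    combination of the [f i] with coefficients [x i]. As [B] is linear only on
    the class [C], the combination is built up one term at a time. *)
Lemma gram_psd (C : (R -> R) -> Prop) (B : (R -> R) -> (R -> R) -> R) :
  C (fun=> 0) -> (forall c f g, C f -> C g -> C (fun x => c * f x + g x)) ->
  (forall f g, C f -> C g -> B f g = B g f) ->
  (forall c f g h, C f -> C g -> C h -> B (fun x => c * f x + g x) h = c * B f h + B g h) ->
  (forall f, C f -> 0 <= B f f) ->
  forall n (f : 'I_n -> R -> R), (forall i, C (f i)) -> psd (fun i j => B (f i) (f j)).
Proof.
move=> C0 CD sB lB pB n f hf; split=> [i j|x]; first exact: sB.
have B0 h : C h -> B (fun=> 0) h = 0.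
  move=> hh; have := lB 1 _ _ h C0 C0 hh.
  under eq_fun do rewrite mulr0 addr0.
  by rewrite mul1r => /eqP; rewrite -subr_eq0 opprD addrA subrr sub0r oppr_eq0 => /eqP.
pose F (r : seq 'I_n) y := \sum_(i <- r) x i * f i y.
have FE i r : F (i :: r) = fun y => x i * f i y + F r y.
  by apply/funext => y; rewrite /F big_cons.
have F0 : F [::] = fun=> 0 by apply/funext => y; rewrite /F big_nil.
have CF r : C (F r).
  by elim: r => [|i r IH]; [rewrite F0 | rewrite FE; exact: CD].
have BF r h : C h -> B (F r) h = \sum_(i <- r) x i * B (f i) h.
  move=> hh; elim: r => [|i r IH]; first by rewrite F0 B0// big_nil.
  by rewrite FE lB// IH big_cons.
suff -> : quad (fun i j => B (f i) (f j)) x = B (F (index_enum 'I_n)) (F (index_enum 'I_n)) by exact: pB.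
rewrite BF//; apply: eq_bigr => i _; rewrite sB// BF// mulr_sumr; apply: eq_bigr => j _.
by rewrite (sB (f j))//; ring.
Qed.

End FormPsd.

Section LevelPsd.
Context {R : realType}.
Variable b : nat.
Hypothesis b1 : (1 < b)%N.

Lemma uL2_0 : @uL2 R (fun=> 0).
Proof. by split => //; exact: L2_cst. Qed.

(** [lev_ge0] says that the increments of the averages are nonnegative
    quadratic forms. *)
Lemma lev_psd m j n (f : 'I_n -> R -> R) : (forall i, uL2 (f i)) ->
  psd (fun i i' => lev b m j (f i) (f i')).
Proof.
apply: (@gram_psd R (@uL2 R) (lev b m j)).
- exact: uL2_0.
- exact: uL2D.
- by move=> f' g' _ _; exact: lev_sym.
- exact: lev_lin.
- exact: lev_ge0.
Qed.

End LevelPsd.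

(** * The Sobolev norm dominates the weighted energies of the levels *)

Section SobolevLevels.
Context {R : realType}.
Local Notation mu := (@lebesgue_measure R).
Local Notation U := (@unif R).
Local Notation Q2 := ((U \x U)%E : probability _ R).

(** The values outside [[0, 1)] are irrelevant in the function spaces, but not
    to the algebra of random variables. *)
Definition zext (f : R -> R) : R -> R := f \_ unit_itv.

Lemma zextE f x : zext f x = if 0 <= x < 1 then f x else 0.
Proof.
rewrite /zext patchE; have -> : (x \in unit_itv) = (0 <= x < 1); last by [].
by apply/idP/idP; rewrite inE /unit_itv /= in_itv.
Qed.

Lemma zext_in f x : 0 <= x < 1 -> zext f x = f x.
Proof. by rewrite zextE => ->. Qed.

Lemma measurable_zext f : measurable_fun unit_itv f -> measurable_fun setT (zext f).
Proof. by move=> mf; apply/(measurable_restrictT _ measurable_unit_itv). Qed.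

Lemma L2sq_zext f : measurable_fun unit_itv f ->
  L2sq f = (\int[U]_x (zext f x ^+ 2)%:E)%E.
Proof.
move=> mf; rewrite /L2sq ge0_integral_unit_itv.
- apply: eq_integral => x _; rewrite patchE /zext patchE.
  by case: ifP => //; rewrite expr0n.
- by apply/measurable_EFinP; apply: measurable_funX.
- by move=> x _; rewrite lee_fin sqr_ge0.
Qed.

Lemma uL2_zext f : measurable_fun unit_itv f -> (L2sq f < +oo)%E -> uL2 (zext f).
Proof.
move=> mf fin; split; last by move=> x /negPf hx; rewrite zextE hx.
split; first exact: measurable_zext.
apply/integrableP; split.
  by apply/measurable_EFinP; apply: measurable_funX; exact: measurable_zext.
rewrite (L2sq_zext mf) in fin; apply: le_lt_trans fin.
rewrite le_eqVlt; apply/orP; left; apply/eqP; apply: eq_integral => x _ /=.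
by rewrite ger0_norm ?sqr_ge0.
Qed.

Lemma Ex_L2sq f : measurable_fun unit_itv f -> (L2sq f < +oo)%E ->
  (Ex U (fun x => zext f x * zext f x))%:E = L2sq f.
Proof.
move=> mf fin; rewrite (L2sq_zext mf) Ex_EFin; last first.
  by have := L2_mul (uL2_zext mf fin).1 (uL2_zext mf fin).1.
by apply: eq_integral => x _; rewrite expr2.
Qed.

(** The two coordinates of a uniform point of the square are independent. *)
Lemma Ex_square (g h : R -> R) : L1 U g -> L1 U h ->
  L1 Q2 (fun z => g z.1 * h z.2) /\ Ex Q2 (fun z => g z.1 * h z.2) = Ex U g * Ex U h.
Proof.
move=> hg hh.
have lf (A : set (measurableTypeR R)) : measurable A -> Q2 (fst @^-1` A) = U A.
  move=> mA; rewrite (_ : _ @^-1` _ = A `*` setT); last by apply/seteqP; split => z /= => [?|[]].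
  by rewrite /= product_measure1E// [X in (_ * X)%E]probability_setT mule1.
have ls (A : set (measurableTypeR R)) : measurable A -> Q2 (snd @^-1` A) = U A.
  move=> mA; rewrite (_ : _ @^-1` _ = setT `*` A); last by apply/seteqP; split => z /= => [?|[]].
  by rewrite /= product_measure1E// [X in (X * _)%E]probability_setT mul1e.
have [mg Lg] := (L1_law measurable_fst lf g).1 hg.
have [mh Lh] := (L1_law measurable_snd ls h).1 hh.
have [] := indep_Ex Lg Lh.
  move=> A B mA mB.
  have mgA : measurable (g @^-1` A : set (measurableTypeR R)) by rewrite -[X in measurable X]setTI; apply: mg.
  have mhB : measurable (h @^-1` B : set (measurableTypeR R)) by rewrite -[X in measurable X]setTI; apply: mh.
  rewrite [X in Q2 X](_ : _ = (g @^-1` A) `*` (h @^-1` B)); last by [].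
  rewrite /= product_measure1E//; congr (_ * _)%E; [exact/esym/lf|exact/esym/ls].
by rewrite -(Ex_law measurable_fst lf hg) -(Ex_law measurable_snd ls hh).
Qed.

(** The uniform law of the square is the restriction of Lebesgue measure to
    it; it is a probability, so that expectations can be used. *)
Lemma integral_unit_square (F : R * R -> \bar R) : measurable_fun setT F ->
  (forall z, 0 <= F z)%E -> (forall z, ~ (unit_itv `*` unit_itv) z -> F z = 0%E) ->
  (\int[mu \x mu]_z F z = \int[Q2]_z F z)%E.
Proof.
move=> mF F0 Fout.
have h (g : R -> \bar R) : measurable_fun setT g -> (forall x, 0 <= g x)%E ->
    (forall x, ~ unit_itv x -> g x = 0%E) -> (\int[mu]_x g x = \int[U]_x g x)%E.
  move=> mg g0 gout.
  have e : g = g \_ unit_itv.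
    apply/funext => x; rewrite patchE; case: ifPn => //.
    by rewrite notin_setE => /gout.
  rewrite [in LHS]e -integral_mkcond ge0_integral_unit_itv//; last exact: measurable_funTS.
  by rewrite -e.
have mFx x : measurable_fun setT (fun y => F (x, y)).
  by apply: measurableT_comp => //; exact: measurable_pair1.
rewrite !fubini_tonelli1//.
rewrite h//; last 3 first.
- exact: measurable_fun_fubini_tonelli_F.
- by move=> x; apply: integral_ge0.
- by move=> x hx; apply: integral0_eq => y _; apply: Fout => -[].
apply: eq_integral => x _; apply: h => // y hy.
by apply: Fout => -[].
Qed.

Section Energy.
Variable b : nat.
Hypothesis b1 : (1 < b)%N.
Local Notation lvl := (@lvl R b).
Local Notation cell := (@cell R b).
Local Notation cint := (cint b).
Local Notation av := (av b).
Local Notation lev := (lev b).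

(** Indicator that the two coordinates lie in the same cell of level [j]. *)
Definition same (j : nat) (z : R * R) : R :=
  \sum_(k < b ^ j) \1_(cell j k) z.1 * \1_(cell j k) z.2.

(** [2 h (int f^2 - (int f)^2 / h)] on a cell of length [h] is the integral of
    [(f x - f y)^2] over the square of the cell. *)
Lemma variance_cells j f : uL2 f ->
  L1 Q2 (fun z => same j z * (f z.1 - f z.2) ^+ 2) /\
  Ex U (fun x => f x * f x) - av j f f =
  2^-1 * b%:R ^+ j * Ex Q2 (fun z => same j z * (f z.1 - f z.2) ^+ 2).
Proof.
move=> hf.
pose C k x : R := \1_(cell j k) x.
have l1 k : L1 U (C k) by apply: L1_indic; exact: measurable_cell.
have l2 k : L1 U (fun x => C k x * f x) by exact: L1_cint.
have l3 k : L1 U (fun x => C k x * (f x * f x)).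
  have := L2_mul (L2_indicM (P := U) (measurable_cell b1 j k) hf.1) hf.1.
  by under eq_fun do rewrite -mulrA.
pose T k (z : R * R) := (C k z.1 * (f z.1 * f z.1)) * C k z.2
  + C k z.1 * (C k z.2 * (f z.2 * f z.2))
  + (-2) * ((C k z.1 * f z.1) * (C k z.2 * f z.2)).
have [la ea] : (forall k, L1 Q2 (fun z => (C k z.1 * (f z.1 * f z.1)) * C k z.2)) /\
   (forall k, Ex Q2 (fun z => (C k z.1 * (f z.1 * f z.1)) * C k z.2) = Ex U (fun x => C k x * (f x * f x)) * Ex U (C k)).
  by split=> k; have [] := Ex_square (l3 k) (l1 k).
have [lb eb] : (forall k, L1 Q2 (fun z => C k z.1 * (C k z.2 * (f z.2 * f z.2)))) /\
   (forall k, Ex Q2 (fun z => C k z.1 * (C k z.2 * (f z.2 * f z.2))) = Ex U (C k) * Ex U (fun x => C k x * (f x * f x))).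
  by split=> k; have [] := Ex_square (l1 k) (l3 k).
have [lc ec] : (forall k, L1 Q2 (fun z => (C k z.1 * f z.1) * (C k z.2 * f z.2))) /\
   (forall k, Ex Q2 (fun z => (C k z.1 * f z.1) * (C k z.2 * f z.2)) = cint j k f * cint j k f).
  by split=> k; have [] := Ex_square (l2 k) (l2 k).
have lT k : L1 Q2 (T k).
  by apply: L1D; [apply: L1D; [exact: la|exact: lb]|apply: L1Z; exact: lc].
have eT : (fun z => same j z * (f z.1 - f z.2) ^+ 2) = fun z => \sum_(k < b ^ j) T k z.
  apply/funext => z; rewrite mulr_suml; apply: eq_bigr => k _; rewrite /T /C; ring.
rewrite eT; split; first exact: L1_sum.
rewrite Ex_sum// (Ex_cells b1 j hf hf) /av [X in _ - X]mulr_sumr [RHS]mulr_sumr -sumrB.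
apply: eq_bigr => k _.
have B0 := bX_gt0 (R := R) b1 j.
rewrite ExD; [|apply: L1D; [exact: la|exact: lb]|apply: L1Z; exact: lc].
rewrite ExD; [|exact: la|exact: lb].
rewrite ExZ; last exact: lc.
rewrite ea eb ec.
have -> : Ex U (C k) = b%:R ^- j.
  rewrite /C Ex_indic ?unif_cell//; exact: measurable_cell.
by field; rewrite gt_eqF.
Qed.

Lemma sameE j x y : 0 <= x < 1 -> 0 <= y < 1 -> same j (x, y) = (lvl j x == lvl j y)%:R.
Proof.
move=> hx hy; rewrite /same /=.
under eq_bigr do rewrite !indic_cell//.
rewrite (bigD1 (Ordinal (lvl_lt b1 j hx)))//= eqxx mul1r eq_sym big1 ?addr0// => i ni.
case: eqP => [e|_]; last by rewrite mul0r.
by case/eqP: ni; apply/val_inj; rewrite /= -e.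
Qed.

(** Points with the same first [j] digits are less than [b ^ -j] apart. *)
Lemma same_lvl_dist j x y : 0 <= x < 1 -> 0 <= y < 1 -> lvl j x = lvl j y ->
  b%:R ^+ j * `|x - y| < 1.
Proof.
move=> /andP[x0 _] /andP[y0 _] e; have B := bX_gt0 (R := R) b1 j.
rewrite -[b%:R ^+ j]ger0_norm ?ltW// -normrM mulrBr ltr_norml.
have /andP[] := truncn_itv (mulr_ge0 (ltW B) x0); rewrite -/(lvl j x) e.
have /andP[] := truncn_itv (mulr_ge0 (ltW B) y0); rewrite -/(lvl j y).
rewrite -!natr1; move: (lvl j y)%:R => t h1 h2 h3 h4; apply/andP; split; lra.
Qed.

(** The terms grow geometrically, so the sum is dominated by the last level at
    which [x] and [y] share a cell; the side of this cell is at least their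
    distance. *)
Lemma level_kernel (beta : R) J x y : 1 <= beta -> 0 <= x < 1 -> 0 <= y < 1 -> x != y ->
  \sum_(j < J) (b%:R `^ beta) ^+ j * (lvl j x == lvl j y)%:R <= 2 * `|x - y| `^ (- beta).
Proof.
move=> be1 hx hy xy.
have d0 : 0 < `|x - y| by rewrite normr_gt0 subr_eq0.
have z2 : 2 <= b%:R `^ beta :> R.
  apply: (@le_trans _ _ b%:R); first by rewrite ler_nat.
  by apply: le1r_powR => //; rewrite ler1n ltnW.
have geo J' : \sum_(j < J'.+1) (b%:R `^ beta) ^+ j <= 2 * (b%:R `^ beta) ^+ J' :> R.
  elim: J' => [|J' IH]; first by rewrite big_ord1 expr0 mulr1 ler1n.
  rewrite big_ord_recr/=; apply: le_trans (lerD IH (lexx _)) _.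
  rewrite exprS.
  have := exprn_ge0 J' (le_trans (ler0n _ 2) z2); set t := _ ^+ J' => t0.
  have := ler_wpM2r t0 z2; lra.
elim: J => [|J IH]; first by rewrite big_ord0 mulr_ge0// powR_ge0.
rewrite big_ord_recr /=; case: eqP => [e|_]; last by rewrite mulr0 addr0.
apply: (@le_trans _ _ (\sum_(j < J.+1) (b%:R `^ beta) ^+ j)).
  rewrite big_ord_recr /= mulr1 lerD2r; apply: ler_sum => i _.
  by case: (_ == _); rewrite ?mulr1 ?mulr0// exprn_ge0// powR_ge0.
apply: le_trans (geo J) _; rewrite ler_pM2l//.
have B := bX_gt0 (R := R) b1 J.
rewrite -powR_mulrn ?powR_ge0// powRAC powR_mulrn ?ler0n//.
rewrite powRN -ler_pV2 ?invrK//; rewrite ?inE ?unitfE.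
- have bb : `|x - y| <= (b%:R ^+ J)^-1.
    by rewrite -div1r ler_pdivlMr// mulrC ltW// same_lvl_dist.
  have := ge0_ler_powR (le_trans ler01 be1) (normr_ge0 (x - y)) _ bb.
  rewrite nnegrE invr_ge0 ltW// => /(_ isT) h.
  apply: le_trans h _.
  have t0 : (b%:R ^+ J) `^ beta != 0 by rewrite gt_eqF// powR_gt0.
  rewrite (_ : (b%:R ^- J) `^ beta = ((b%:R ^+ J) `^ beta)^-1)//.
  by apply: (mulIf t0); rewrite mulVf// -powRM ?mulVf ?gt_eqF ?invr_ge0 ?powR1// ltW.
- by rewrite !gt_eqF ?invr_gt0 ?powR_gt0//= invr_gt0 powR_gt0.
- by rewrite !gt_eqF ?powR_gt0//= powR_gt0.
Qed.

Section Alpha.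
Variable alpha : R.
Hypothesis alpha0 : 0 < alpha.
Local Notation B := (b%:R `^ (2 * alpha)).

Lemma sobolev_measurable f : sobolev alpha f -> measurable_fun unit_itv f.
Proof. by case. Qed.

Lemma slob_ge0 f : (0 <= slobodeckij_sq alpha f)%E.
Proof.
by apply: integral_ge0 => z _; rewrite lee_fin mulr_ge0 ?sqr_ge0// invr_ge0 powR_ge0.
Qed.

Lemma L2sq_ge0 (f : R -> R) : (0 <= L2sq f)%E.
Proof. by apply: integral_ge0 => z _; rewrite lee_fin sqr_ge0. Qed.

Lemma sobolev_L2sq f : sobolev alpha f -> (L2sq f < +oo)%E.
Proof.
move=> [_]; apply: le_lt_trans; rewrite /sobolev_normsq leeDl//; exact: slob_ge0.
Qed.

Lemma sobolev_slob f : sobolev alpha f -> (slobodeckij_sq alpha f < +oo)%E.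
Proof.
move=> [_]; apply: le_lt_trans; rewrite /sobolev_normsq leeDr//; exact: L2sq_ge0.
Qed.

Lemma uL2_sobolev f : sobolev alpha f -> uL2 (zext f).
Proof. by move=> hf; apply: uL2_zext; [exact: sobolev_measurable hf|exact: sobolev_L2sq]. Qed.

Definition slob_kernel (f : R -> R) (z : R * R) : R :=
  (f z.1 - f z.2) ^+ 2 * `|z.1 - z.2| `^ (- (1 + 2 * alpha)).

Lemma measurable_slob_kernel f : measurable_fun unit_itv f ->
  measurable_fun setT (slob_kernel (zext f)).
Proof.
move=> mf; apply: measurable_funM.
  apply: measurable_funX; apply: measurable_funB.
    by apply: (measurableT_comp (measurable_zext mf)); exact: measurable_fst.
  by apply: (measurableT_comp (measurable_zext mf)); exact: measurable_snd.
have h : measurable_fun setT (fun z : R * R => `|z.1 - z.2|).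
  apply: (measurableT_comp (@normr_measurable _ _)); apply: measurable_funB;
    [exact: measurable_fst|exact: measurable_snd].
exact: (measurableT_comp (measurable_powR (- (1 + 2 * alpha))) h).
Qed.

Lemma slob_kernel_ge0 f z : 0 <= slob_kernel f z.
Proof. by rewrite mulr_ge0 ?sqr_ge0 ?powR_ge0. Qed.

Definition unit_square (z : R * R) : bool := (0 <= z.1 < 1) && (0 <= z.2 < 1).

Lemma measurable_unit_square : measurable_fun setT (fun z : R * R => (unit_square z)%:R : R).
Proof.
rewrite (_ : (fun z => _) = \1_((unit_itv : set R) `*` (unit_itv : set R))).
  by apply: measurable_indic; apply: measurableX; exact: measurable_unit_itv.
apply/funext => z; rewrite indicE (_ : (z \in _) = unit_square z)//.
by apply/idP/idP; rewrite inE /unit_itv /= !in_itv /unit_square /= => /andP.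
Qed.

Lemma slobE f : measurable_fun unit_itv f ->
  slobodeckij_sq alpha f = (\int[Q2]_z ((unit_square z)%:R * slob_kernel (zext f) z)%:E)%E.
Proof.
move=> mf; rewrite /slobodeckij_sq integral_mkcond -integral_unit_square.
- apply: eq_integral => z _; rewrite patchE.
  have -> : (z \in unit_itv `*` unit_itv) = unit_square z.
    by apply/idP/idP; rewrite inE /unit_itv /= !in_itv /unit_square /= => /andP.
  case: ifP => [/andP[h1 h2]|_]; last by rewrite mul0r.
  by rewrite mul1r /slob_kernel !zext_in// powRN.
- apply/measurable_EFinP; apply: measurable_funM; [exact: measurable_unit_square|exact: measurable_slob_kernel].
- by move=> z; rewrite lee_fin mulr_ge0// slob_kernel_ge0.
- move=> z hz; have -> : unit_square z = false; last by rewrite mul0r.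
  by apply/negP => /andP[h1 h2]; apply: hz; rewrite /unit_itv /= !in_itv.
Qed.

(** By [variance_cells] the left-hand side is an integral of [(f x - f y)^2]
    against a sum over the levels at which [x] and [y] share a cell, and
    [level_kernel] bounds that sum by the singular kernel. *)
Lemma energy_le_slob m f : sobolev alpha f ->
  ((\sum_(j < m) B ^+ j.+1 * (Ex U (fun x => zext f x * zext f x) - av j (zext f) (zext f)))%:E
   <= B%:E * slobodeckij_sq alpha f)%E.
Proof.
move=> hf; have hz := uL2_sobolev hf; have mf := sobolev_measurable hf.
pose g z := \sum_(j < m) B ^+ j.+1 * (2^-1 * b%:R ^+ j) * (same j z * (zext f z.1 - zext f z.2) ^+ 2).
have lg : L1 Q2 g by apply: L1_sum => j _; apply: L1Z; exact: (variance_cells j hz).1.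
have -> : \sum_(j < m) B ^+ j.+1 * (Ex U (fun x => zext f x * zext f x) - av j (zext f) (zext f)) = Ex Q2 g.
  rewrite Ex_sum; last by move=> j _; apply: L1Z; exact: (variance_cells j hz).1.
  apply: eq_bigr => j _; have [l e] := variance_cells j hz.
  by rewrite e ExZ// mulrA.
rewrite Ex_EFin// slobE// -ge0_integralZl//; last 2 first.
- apply/measurable_EFinP; apply: measurable_funM; [exact: measurable_unit_square|exact: measurable_slob_kernel].
- by move=> z _; rewrite lee_fin mulr_ge0// slob_kernel_ge0.
have g0 z : 0 <= g z.
  apply: sumr_ge0 => j _; apply: mulr_ge0.
    by rewrite !mulr_ge0 ?exprn_ge0 ?powR_ge0 ?invr_ge0.
  apply: mulr_ge0; last exact: sqr_ge0.
  by apply: sumr_ge0 => k _; rewrite mulr_ge0// indicE.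
apply: ge0_le_integral => //.
- by move=> z _; rewrite lee_fin.
- by apply/measurable_EFinP; exact: (L1_measurable lg).
- apply/measurable_EFinP; apply: measurable_funM => //.
  apply: measurable_funM; [exact: measurable_unit_square|exact: measurable_slob_kernel].
move=> [x y] _; rewrite -EFinM lee_fin.
have [/andP[/= hx hy]|out] := boolP (unit_square (x, y)); last first.
  rewrite mul0r mulr0 /g big1// => j _.
  suff -> : same j (x, y) = 0 by rewrite mul0r mulr0.
  rewrite /same big1// => k _ /=; rewrite !indicE.
  move: out; rewrite /unit_square /= negb_and => /orP[h|h].
    by rewrite memNset ?mul0r// => -[h' _]; rewrite h' in h.
  by rewrite (memNset (u := y)) ?mulr0// => -[h' _]; rewrite h' in h.
rewrite mul1r /g /slob_kernel /=.
set D := (_ - _) ^+ 2.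
have D0 : 0 <= D by exact: sqr_ge0.
have [e|xy] := eqVneq x y.
  have -> : D = 0 by rewrite /D e subrr expr0n.
  by rewrite mul0r mulr0 big1// => j _; rewrite !mulr0.
have -> : \sum_(j < m) B ^+ j.+1 * (2^-1 * b%:R ^+ j) * (same j (x, y) * D) =
  2^-1 * B * (\sum_(j < m) (b%:R `^ (1 + 2 * alpha)) ^+ j * (lvl j x == lvl j y)%:R) * D.
  rewrite mulr_sumr mulr_suml; apply: eq_bigr => j _; rewrite sameE//.
  rewrite powRD; last by rewrite pnatr_eq0 -lt0n (ltnW b1) implybT.
  rewrite powRr1 ?ler0n// exprMn exprS; ring.
have a1 : 1 <= 1 + 2 * alpha by rewrite lerDl mulr_ge0// ltW.
have := level_kernel m a1 hx hy xy.
set s := \sum_(j < m) _; set t := _ `^ _ => k.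
have B0 : 0 <= B by exact: powR_ge0.
have := ler_wpM2r (mulr_ge0 B0 D0) k.
move: (b%:R `^ (2 * alpha)) => z k'; lra.
Qed.

(** The squared Haar wavelet norm up to level [m] as a bilinear form, with one
    term for everything finer; its weight is that of the level [m + 1]. *)
Definition henergy (m : nat) (f g : R -> R) : R :=
  \sum_(j < m.+2) B ^+ j * lev m j f g.

Lemma B_ge1 : 1 <= B :> R.
Proof.
have b1R : 1 <= b%:R :> R by rewrite ler1n ltnW.
rewrite -[X in X <= _](powRr0 b%:R); apply: ler_powR => //.
by rewrite mulr_ge0// ltW.
Qed.

(** The energy of level [j + 1] is at most what is left of [f] after averaging
    over the cells of level [j]. *)
Lemma henergy_le m f : sobolev alpha f ->
  ((henergy m (zext f) (zext f))%:E <= B%:E * sobolev_normsq alpha f)%E.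
Proof.
move=> hf; have hz := uL2_sobolev hf; set F := zext f in hz *.
have mf := sobolev_measurable hf; have fin := sobolev_L2sq hf.
set E := Ex U (fun x => F x * F x).
have E0 : 0 <= E by apply: Ex_ge0 => x; rewrite -expr2 sqr_ge0.
have up j : upto b m j F F <= E by rewrite /upto; case: ifP => // _; exact: av_le.
apply: (@le_trans _ _ (E + \sum_(j < m.+1) B ^+ j.+1 * (E - av j F F))%:E).
  rewrite lee_fin /henergy big_ord_recl expr0 mul1r; apply: lerD; first exact: up.
  apply: ler_sum => j _; apply: ler_wpM2l; first by rewrite exprn_ge0// powR_ge0.
  rewrite lift0 /= lerB//.
  by rewrite /upto -ltnS ltn_ord.
rewrite EFinD /sobolev_normsq muleDr//; last first.
  by rewrite ge0_adde_def// inE; [exact: L2sq_ge0|exact: slob_ge0].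
apply: leeD; last exact: energy_le_slob.
rewrite /E Ex_L2sq// -[X in (X <= _)%E]mul1e; apply: lee_wpmul2r; first exact: L2sq_ge0.
by rewrite lee_fin B_ge1.
Qed.

Lemma zext_lin c f g : zext (fun x => c * f x + g x) = fun x => c * zext f x + zext g x.
Proof. by apply/funext => x; rewrite !zextE; case: ifP; rewrite ?mulr0 ?addr0. Qed.

Lemma sobolev0 : sobolev alpha (fun=> 0).
Proof.
split => //; rewrite /sobolev_normsq /L2sq /slobodeckij_sq.
rewrite integral0_eq => [|x _]; last by rewrite expr0n.
rewrite integral0_eq ?adde0 ?ltry// => z _; by rewrite subrr expr0n mul0r.
Qed.

(** From [(x + y)^2 <= 2 x^2 + 2 y^2], applied to the functions and to their
    increments. *)
Lemma sobolev_lin c f g : sobolev alpha f -> sobolev alpha g ->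
  sobolev alpha (fun x => c * f x + g x).
Proof.
move=> hf hg; have mf := sobolev_measurable hf; have mg := sobolev_measurable hg.
have mh : measurable_fun unit_itv (fun x => c * f x + g x).
  by apply: measurable_funD => //; apply: measurable_funM.
split => //; rewrite /sobolev_normsq; apply: lte_add_pinfty.
- rewrite L2sq_zext// zext_lin.
  have /integrableP[_] := (uL2D c (uL2_sobolev hf) (uL2_sobolev hg)).1.2.
  apply: le_lt_trans; rewrite le_eqVlt; apply/orP; left; apply/eqP.
  by apply: eq_integral => x _ /=; rewrite ger0_norm ?sqr_ge0.
pose K h z := (unit_square z)%:R * slob_kernel (zext h) z.
have K0 h z : 0 <= K h z by rewrite /K mulr_ge0// slob_kernel_ge0.
have mK h : measurable_fun unit_itv h -> measurable_fun setT (K h).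
  by move=> ?; apply: measurable_funM; [exact: measurable_unit_square|exact: measurable_slob_kernel].
(* the bound for the seminorm, under the integral sign *)
apply: (@le_lt_trans _ _ (\int[Q2]_z ((2 * c ^+ 2)%:E * (K f z)%:E + 2%:E * (K g z)%:E))%E).
  rewrite slobE//; apply: ge0_le_integral => //.
  + by move=> z _; rewrite lee_fin; exact: K0.
  + by apply/measurable_EFinP; exact: (mK (fun x => c * f x + g x) mh).
  + by apply/measurable_EFinP; apply: measurable_funD; apply: measurable_funM => //; exact: mK.
  + move=> z _; rewrite -!EFinM -EFinD lee_fin -/(K _ z) /K /slob_kernel zext_lin.
    set u : R := (unit_square z)%:R; set p := _ `^ _.
    have up : 0 <= u * p by rewrite mulr_ge0// powR_ge0.
    set A := zext f z.1 - zext f z.2; set A' := zext g z.1 - zext g z.2.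
    have -> : c * zext f z.1 + zext g z.1 - (c * zext f z.2 + zext g z.2) = c * A + A'.
      by rewrite /A /A'; ring.
    have := mulr_ge0 up (sqr_ge0 (c * A - A')).
    by move: u p up => u p up; lra.
rewrite ge0_integralD//; last 4 first.
- by move=> z _; rewrite lee_fin mulr_ge0// mulr_ge0// sqr_ge0.
- by apply/measurable_EFinP; apply: measurable_funM => //; exact: mK.
- by move=> z _; rewrite lee_fin mulr_ge0.
- by apply/measurable_EFinP; apply: measurable_funM => //; exact: mK.
rewrite !ge0_integralZl//; last 5 first.
- by apply/measurable_EFinP; exact: mK.
- by move=> z _; rewrite lee_fin.
- by apply/measurable_EFinP; exact: mK.
- by move=> z _; rewrite lee_fin.
- by rewrite lee_fin mulr_ge0// sqr_ge0.
rewrite -!slobE//; apply: lte_add_pinfty; apply: lte_mul_pinfty => //.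
- by rewrite lee_fin mulr_ge0// sqr_ge0.
- exact: sobolev_slob.
- exact: sobolev_slob.
Qed.

(** In the order of positive semidefinite matrices, the weighted level Gram
    matrices are dominated by the Gram matrix of any equivalent inner product,
    uniformly in the finest level. *)
Lemma henergy_gram (ip : (R -> R) -> (R -> R) -> R) : sobolev_inner_product alpha ip ->
  exists2 C, 0 < C & forall m n (f : 'I_n -> R -> R), (forall i, sobolev alpha (f i)) ->
    psd_le (fun i i' => henergy m (zext (f i)) (zext (f i'))) (fun i i' => C * ip (f i) (f i')).
Proof.
move=> [ips ipl [c1 [c2 [c10 _ ipe]]]].
exists (B / c1); first by rewrite divr_gt0// (lt_le_trans _ B_ge1).
move=> m n f hf.
apply: (@gram_psd R (sobolev alpha) (fun f g => B / c1 * ip f g - henergy m (zext f) (zext g))) => //.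
- exact: sobolev0.
- exact: sobolev_lin.
- move=> f' g' hf' hg'; rewrite ips//; congr (_ - _).
  by apply: eq_bigr => j _; rewrite lev_sym.
- move=> c f' g' h hf' hg' hh; rewrite ipl// zext_lin /henergy.
  have -> : \sum_(j < m.+2) B ^+ j * lev m j (fun x => c * zext f' x + zext g' x) (zext h) =
     c * (\sum_(j < m.+2) B ^+ j * lev m j (zext f') (zext h)) + \sum_(j < m.+2) B ^+ j * lev m j (zext g') (zext h).
    rewrite mulr_sumr -big_split/=; apply: eq_bigr => j _.
    by rewrite lev_lin//; [ring|exact: uL2_sobolev|exact: uL2_sobolev|exact: uL2_sobolev].
  by ring.
- move=> f' hf'; rewrite subr_ge0 -lee_fin; apply: le_trans (henergy_le m hf') _.
  have [h _] := ipe _ hf'.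
  have B0 : 0 <= B by exact: powR_ge0.
  rewrite !EFinM -muleA; apply: lee_wpmul2l; first by rewrite lee_fin.
  rewrite -(@lee_pmul2l _ c1%:E) ?lte_fin// -[X in (_ <= _ * X)%E]EFinM.
  by rewrite -[leRHS]EFinM mulVKf ?gt_eqF.
Qed.

End Alpha.
End Energy.
End SobolevLevels.

(** * The tensor product space as a space of functions on the cube *)

Section CubeFunctions.
Context {R : realType}.
Variable D : nat.
Local Notation U := (@unif R).
Local Notation Q := (@cube_measure R D).
Implicit Types F G : D.-tuple R -> R.

Lemma measurable_unit_cube : measurable (@unit_cube R D).
Proof.
rewrite (_ : unit_cube (n:=D) = \bigcap_(i in [set: 'I_D]) ((fun x => tnth x i) @^-1` unit_itv)).
  apply: fin_bigcap_measurable => // i _.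
  rewrite -[X in measurable X]setTI; apply: measurable_tnth => //.
  exact: measurable_unit_itv.
apply/seteqP; split => x /= h i.
  by move=> _; rewrite /unit_itv /= in_itv; exact: h.
by have := h i I; rewrite /unit_itv /= in_itv.
Qed.

(** The counterpart of [zext] on the cube: it turns integrals over the
    half-open cube into expectations. *)
Definition zcube F : D.-tuple R -> R := F \_ (@unit_cube R D).

Lemma zcube_in F x : unit_cube x -> zcube F x = F x.
Proof. by move=> hx; rewrite /zcube patchE mem_set. Qed.

Lemma zcube_out F x : ~ unit_cube x -> zcube F x = 0.
Proof. by move=> hx; rewrite /zcube patchE memNset. Qed.

Lemma cube_integralE F : cube_integral F = Ex Q (zcube F).
Proof. by rewrite /cube_integral Rintegral_mkcond. Qed.

Lemma measurable_zcube F : measurable_fun (@unit_cube R D) F <-> measurable_fun setT (zcube F).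
Proof. exact: measurable_restrictT measurable_unit_cube. Qed.

Lemma cube_L2sqE F : cube_L2sq F = (\int[Q]_x (zcube F x ^+ 2)%:E)%E.
Proof.
rewrite /cube_L2sq integral_mkcond; apply: eq_integral => x _.
by rewrite /zcube !patchE; case: ifP => // _; rewrite expr0n.
Qed.

Lemma L2_zcube F : cube_L2 F <-> L2 Q (zcube F).
Proof.
split.
  move=> [/measurable_zcube mF fin]; split => //.
  apply/integrableP; split; first by apply/measurable_EFinP; apply: measurable_funX.
  rewrite cube_L2sqE in fin; apply: le_lt_trans fin; rewrite le_eqVlt; apply/orP; left; apply/eqP.
  by apply: eq_integral => x _ /=; rewrite ger0_norm ?sqr_ge0.
move=> [mF /integrableP[_ fin]]; split; first exact/measurable_zcube.
rewrite cube_L2sqE; apply: le_lt_trans fin; rewrite le_eqVlt; apply/orP; left; apply/eqP.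
by apply: eq_integral => x _ /=; rewrite ger0_norm ?sqr_ge0.
Qed.

Lemma Ex_zcube_sq F : cube_L2 F -> (Ex Q (fun x => zcube F x ^+ 2))%:E = cube_L2sq F.
Proof. by move=> /L2_zcube [_ h]; rewrite Ex_EFin// cube_L2sqE. Qed.

Lemma zcubeD F G : zcube (fun x => F x + G x) = fun x => zcube F x + zcube G x.
Proof. by apply/funext => x; rewrite /zcube !patchE; case: ifP; rewrite ?addr0. Qed.

Lemma zcubeB F G : zcube (fun x => F x - G x) = fun x => zcube F x - zcube G x.
Proof. by apply/funext => x; rewrite /zcube !patchE; case: ifP; rewrite ?subr0. Qed.

Lemma zcubeM F G : zcube (fun x => F x * G x) = fun x => zcube F x * zcube G x.
Proof. by apply/funext => x; rewrite /zcube !patchE; case: ifP; rewrite ?mulr0. Qed.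

Lemma zcube_prod (f : 'I_D -> R -> R) :
  zcube (fun x => \prod_t f t (tnth x t)) = fun x => \prod_t zext (f t) (tnth x t).
Proof.
apply/funext => x; have [hx|hx] := pselect (unit_cube x).
  by rewrite zcube_in//; apply: eq_bigr => t _; rewrite zext_in.
rewrite zcube_out//; have /existsNP[t ht] := hx.
by rewrite (bigD1 t)//= zextE (negPf (introN idP ht)) mul0r.
Qed.

Lemma L2_cube_prod (f : 'I_D -> R -> R) : (forall t, uL2 (f t)) ->
  L2 Q (fun x => \prod_t f t (tnth x t)).
Proof.
move=> hf; split.
  apply: measurable_prod => i _; apply: (measurableT_comp (hf i).1.1).
  exact: measurable_tnth.
have [h _] := @cube_prod R D (fun t x => f t x ^+ 2) (fun t => (hf t).1.2).
by under eq_fun do rewrite -prodrXl.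
Qed.

Lemma Ex_cube_prod (f : 'I_D -> R -> R) : (forall t, uL2 (f t)) ->
  Ex Q (fun x => \prod_t f t (tnth x t)) = \prod_t Ex U (f t).
Proof. by move=> hf; have [] := cube_prod (fun t => L2_L1 (hf t).1). Qed.

End CubeFunctions.

Section FiniteTensors.
Context {R : realType}.
Variables (alpha : R) (D : nat).
Implicit Types u v : ftensor (R := R) D.

Definition ft_sobolev u := forall i t, sobolev alpha (@ft_fac R D u i t).

Lemma zcube_ft u : zcube (ft_eval u) =
  fun x => \sum_(i < ft_size u) \prod_t zext (ft_fac i t) (tnth x t).
Proof.
apply/funext => x; rewrite -(eq_bigr _ (fun i _ => congr1 (@^~ x) (zcube_prod (@ft_fac R D u i)))).
have [hx|hx] := pselect (unit_cube x).
  by rewrite zcube_in//; apply: eq_bigr => i _; rewrite zcube_in.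
by rewrite zcube_out// big1// => i _; rewrite zcube_out.
Qed.

Lemma L2_ft u : ft_sobolev u -> L2 (cube_measure D) (zcube (ft_eval u)).
Proof.
move=> hu; rewrite zcube_ft; apply: L2_sum => i _; apply: (L2_cube_prod (f := fun t => zext (ft_fac i t))) => t.
exact: uL2_sobolev (hu i t).
Qed.

Section InnerProduct.
Variable ip : (R -> R) -> (R -> R) -> R.
Hypothesis hip : sobolev_inner_product alpha ip.

Lemma ip_psd n (f : 'I_n -> R -> R) : (forall i, sobolev alpha (f i)) ->
  psd (fun i j => ip (f i) (f j)).
Proof.
case: hip => [ips ipl [c1 [c2 [c10 _ ipe]]]].
apply: (@gram_psd R (sobolev alpha)) => //.
- exact: sobolev0.
- exact: sobolev_lin.
- move=> f' hf'; have [h _] := ipe _ hf'; rewrite -lee_fin; apply: le_trans h.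
  apply: mule_ge0; first by rewrite lee_fin ltW.
  by apply: adde_ge0; [exact: L2sq_ge0|exact: slob_ge0].
Qed.

Lemma ft_gram_psd n (f : 'I_n -> 'I_D -> R -> R) : (forall i t, sobolev alpha (f i t)) ->
  psd (fun i j => \prod_t ip (f i t) (f j t)).
Proof. by move=> hf; apply: psd_prod => t _; apply: ip_psd => i. Qed.

Lemma ft_ip_ge0 u : ft_sobolev u -> 0 <= ft_ip ip u u.
Proof. by move=> hu; apply: psd_total; exact: ft_gram_psd. Qed.

(** The Gram matrix of all the terms of [u] and [v] together is positive
    semidefinite; the coefficients are [1] on the terms of [u] and [s] on
    those of [v]. *)
Lemma ft_ip_line u v (s : R) : ft_sobolev u -> ft_sobolev v ->
  0 <= ft_ip ip u u + 2 * s * ft_ip ip u v + s ^+ 2 * ft_ip ip v v.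
Proof.
move=> hu hv; case: hip => [ips _ _].
pose f (i : 'I_(ft_size u + ft_size v)) := match fintype.split i with
  | inl i => ft_fac i | inr i => ft_fac i end.
pose x (i : 'I_(ft_size u + ft_size v)) : R := match fintype.split i with
  | inl _ => 1 | inr _ => s end.
have hf i t : sobolev alpha (f i t) by rewrite /f; case: fintype.split => j; [exact: hu|exact: hv].
have [_ /(_ x)] := ft_gram_psd hf.
rewrite /quad big_split_ord /=.
under eq_bigr do rewrite big_split_ord /=.
under [X in _ + X]eq_bigr do rewrite big_split_ord /=.
have sl j : fintype.split (lshift (ft_size v) j) = inl j :> 'I_(ft_size u) + 'I_(ft_size v).
  by have := unsplitK (inl j : 'I_(ft_size u) + 'I_(ft_size v)).
have sr j : fintype.split (rshift (ft_size u) j) = inr j :> 'I_(ft_size u) + 'I_(ft_size v).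
  by have := unsplitK (inr j : 'I_(ft_size u) + 'I_(ft_size v)).
rewrite !big_split /=.
have e1 : \sum_(i < ft_size u) \sum_(j < ft_size u) x (lshift (ft_size v) i) * x (lshift (ft_size v) j)
   * \prod_t ip (f (lshift (ft_size v) i) t) (f (lshift (ft_size v) j) t) = ft_ip ip u u.
  by apply: eq_bigr => i _; apply: eq_bigr => j _; rewrite /x /f !sl !mul1r.
have e2 : \sum_(i < ft_size u) \sum_(j < ft_size v) x (lshift (ft_size v) i) * x (rshift (ft_size u) j)
   * \prod_t ip (f (lshift (ft_size v) i) t) (f (rshift (ft_size u) j) t) = s * ft_ip ip u v.
  rewrite /ft_ip mulr_sumr; apply: eq_bigr => i _; rewrite mulr_sumr; apply: eq_bigr => j _.
  by rewrite /x /f sl sr mul1r.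
have e3 : \sum_(i < ft_size v) \sum_(j < ft_size u) x (rshift (ft_size u) i) * x (lshift (ft_size v) j)
   * \prod_t ip (f (rshift (ft_size u) i) t) (f (lshift (ft_size v) j) t) = s * ft_ip ip u v.
  rewrite exchange_big /ft_ip mulr_sumr; apply: eq_bigr => i _; rewrite mulr_sumr; apply: eq_bigr => j _.
  rewrite /x /f sl sr mulr1; congr (_ * _); apply: eq_bigr => t _.
  by rewrite ips.
have e4 : \sum_(i < ft_size v) \sum_(j < ft_size v) x (rshift (ft_size u) i) * x (rshift (ft_size u) j)
   * \prod_t ip (f (rshift (ft_size u) i) t) (f (rshift (ft_size u) j) t) = s ^+ 2 * ft_ip ip v v.
  rewrite /ft_ip mulr_sumr; apply: eq_bigr => i _; rewrite mulr_sumr; apply: eq_bigr => j _.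
  by rewrite /x /f !sr expr2.
rewrite e1 e2 e3 e4; congr (_ <= _); ring.
Qed.

(** The reverse triangle inequality. It needs care because the tensor norm is
    only known to be a seminorm here. *)
Lemma ft_norm_diff u v : ft_sobolev u -> ft_sobolev v ->
  (Num.sqrt (ft_ip ip u u) - Num.sqrt (ft_ip ip v v)) ^+ 2 <= ft_distsq ip u v.
Proof.
move=> hu hv; have a0 := ft_ip_ge0 hu; have c0 := ft_ip_ge0 hv.
rewrite /ft_distsq; set a := ft_ip ip u u in a0 *; set c := ft_ip ip v v in c0 *.
set e := ft_ip ip u v.
have h s : 0 <= a + 2 * s * e + s ^+ 2 * c by exact: ft_ip_line.
have ra := sqr_sqrtr a0; have rc := sqr_sqrtr c0.
have ra0 := sqrtr_ge0 a; have rc0 := sqrtr_ge0 c.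
set A := Num.sqrt a in ra ra0 *; set C := Num.sqrt c in rc rc0 *.
(* the Cauchy-Schwarz inequality, which ft_ip_line gives at s = - A / C *)
suff : e <= A * C by move=> k; rewrite -ra -rc; lra.
have [C0|Cn0] := eqVneq C 0.
  rewrite C0 mulr0; rewrite -rc C0 expr0n /= in h.
  have [//|e0] := leP e 0.
  have := h (- (a + 1) / (2 * e)); rewrite mulr0 addr0.
  rewrite (_ : _ + _ = -1); first by rewrite ler0N1.
  by field; rewrite gt_eqF.
have {}rc0 : 0 < C by rewrite lt_def Cn0.
have := h (- (A / C)); rewrite -ra -rc.
rewrite (_ : _ + _ = 2 * A * (A * C - e) / C); last by field.
have [A0|An0] := eqVneq A 0.
  move=> _; rewrite A0 mul0r.
  have [//|e0] := leP e 0.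
  have := h (- e / c); rewrite -ra A0 -rc.
  rewrite (_ : _ + _ = - (e ^+ 2 / C ^+ 2)); last by field.
  rewrite oppr_ge0 leNgt divr_gt0// exprn_gt0//.
have {}ra0 : 0 < A by rewrite lt_def An0.
rewrite pmulr_lge0 ?invr_gt0// pmulr_rge0 ?mulr_gt0//.
by rewrite subr_ge0.
Qed.

Section Limits.
Variable F : D.-tuple R -> R.
Variable u : nat -> ftensor (R := R) D.
Hypothesis mF : measurable_fun (@unit_cube R D) F.
Hypothesis hu : mix_represents alpha ip F u.

Let su k : ft_sobolev (u k). Proof. by case: hu => h _ _ i t; exact: h. Qed.

(** By the reverse triangle inequality the norms form a Cauchy sequence. *)
Lemma mix_norm_cvg : exists v : R, ft_ip ip (u k) (u k) @[k --> \oo] --> v.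
Proof.
pose r k := Num.sqrt (ft_ip ip (u k) (u k)).
have cr : cvgn r.
  apply/cauchy_cvgP/cauchy_exP => e e0.
  have [_ /(_ (e ^+ 2)) h _] := hu.
  have [K hK] := h (exprn_gt0 2 e0).
  exists (r K); exists K => // k /= Kk.
  rewrite /ball /=; rewrite -(ltr_pXn2r (n := 2))// ?nnegrE// ?ltW//.
  rewrite real_normK ?num_real//.
  by apply: (le_lt_trans (ft_norm_diff (@su K) (@su k))); exact: hK.
exists (limn r ^+ 2).
rewrite (_ : (fun k => _) = fun k => r k ^+ 2); last first.
  by apply/funext => k; rewrite sqr_sqrtr// ft_ip_ge0.
by rewrite expr2; under eq_fun do rewrite expr2; exact: cvgM.
Qed.

Lemma mix_cvg_near (e : R) : 0 < e -> \forall k \near \oo,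
  (cube_L2sq (fun x => F x - ft_eval (u k) x)%R < e%:E)%E.
Proof.
move=> e0; have [_ _ /fine_cvgP[fin]] := hu.
move=> /cvgrPdist_lt /(_ e e0) h.
near=> k.
have fk : cube_L2sq (fun x => F x - ft_eval (u k) x) \is a fin_num by near: k.
rewrite -(fineK fk) lte_fin.
have : `|0 - fine (cube_L2sq (fun x => F x - ft_eval (u k) x))| < e by near: k.
by rewrite sub0r normrN ger0_norm// fine_ge0// integral_ge0// => x _; rewrite lee_fin sqr_ge0.
Unshelve. all: by end_near.
Qed.

Lemma mix_diff_L2 k : (cube_L2sq (fun x => F x - ft_eval (u k) x)%R < +oo)%E ->
  cube_L2 (fun x => F x - ft_eval (u k) x).
Proof.
move=> h; split => //; apply/measurable_zcube; rewrite zcubeB.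
apply: measurable_funB; first exact/measurable_zcube.
exact: (L2_ft (@su k)).1.
Qed.

Lemma mix_L2 : cube_L2 F.
Proof.
have [K _ /(_ K (leqnn K)) h] := mix_cvg_near ltr01.
have d := mix_diff_L2 (lt_trans h (ltry _)).
apply/L2_zcube; move/L2_zcube : d; rewrite zcubeB => d.
have := L2D d (L2_ft (@su K)).
by under eq_fun do rewrite subrK.
Qed.

(** Passing to the limit: a bound by the tensor norm of the approximants, up to
    a multiple of the squared L2 error, survives for [F]. *)
Lemma mix_limit (v X c c' : R) : 0 <= c' ->
  ft_ip ip (u k) (u k) @[k --> \oo] --> v ->
  (forall k, cube_L2 (fun x => F x - ft_eval (u k) x) ->
    X <= c * ft_ip ip (u k) (u k) +
         c' * Ex (cube_measure D) (fun x => zcube (fun x => F x - ft_eval (u k) x) x ^+ 2)) ->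
  X <= c * v.
Proof.
move=> c0 hv h; apply/ler_addgt0Pr => e e0.
have e1 : 0 < e / (c' + 1) by rewrite divr_gt0// ltr_wpDl.
suff : X - e <= c * v by rewrite lerBlDr.
have hc : c * ft_ip ip (u k) (u k) @[k --> \oo] --> c * v by apply: cvgMl_tmp.
rewrite -(cvg_lim (@Rhausdorff R) hc); apply: limr_ge; first by apply/cvg_ex; exists (c * v).
near=> k.
have hk : (cube_L2sq (fun x => F x - ft_eval (u k) x)%R < (e / (c' + 1))%:E)%E.
  by near: k; exact: mix_cvg_near.
have d := mix_diff_L2 (lt_trans hk (ltry _)).
rewrite lerBlDr; apply: le_trans (h k d) _; rewrite lerD2l.
move: hk; rewrite -(Ex_zcube_sq d) lte_fin; set y := Ex _ _ => /ltW hy.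
apply: le_trans (ler_wpM2l c0 hy) _.
rewrite mulrA ler_pdivrMr ?ltr_wpDl// mulrC mulrDr mulr1 lerDl; exact: ltW.
Unshelve. all: by end_near.
Qed.

End Limits.
End InnerProduct.
End FiniteTensors.

(** * The embedding into the Haar wavelet space *)

Section HaarSystem.
Context {R : realType}.
Variable b : nat.
Hypothesis b1 : (1 < b)%N.
Local Notation U := (@unif R).
Local Notation cell := (@cell R b).
Local Notation lvl := (@lvl R b).
Local Notation cint := (cint b).

Let b0 : (0 < b)%N. Proof. exact: ltnW. Qed.

Definition zhaar (j i k : nat) : R -> R := zext (haar b j i k).

Lemma floor_shift (y : R) (n i : nat) : 0 <= y ->
  (Num.floor (y - n%:R) == i%:Z) = (Num.truncn y == n + i)%N.
Proof.
move=> y0; rewrite floor_eq truncn_eq//.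
have -> : (i%:Z + 1 = i.+1%:Z)%R by rewrite -addn1 PoszD.
rewrite -!pmulrn lerBrDr ltrBlDr -!natrD.
by rewrite addnC addSn addnC.
Qed.

Lemma zhaar0 i k : zhaar 0 i k = \1_(cell 0 0).
Proof.
apply/funext => x; rewrite /zhaar zextE indicE /=.
have [hx|hx] := boolP (0 <= x < 1).
  by rewrite in_itv/= hx mem_set//; split => //; rewrite lvl0.
by rewrite memNset// => -[h _]; rewrite h in hx.
Qed.

(** The wavelet is a combination of the indicators of a cell and of one of its
    [b] subcells. *)
Lemma zhaarS j i k x : (i < b)%N ->
  zhaar j.+1 i k x = Num.sqrt (b%:R ^+ j) *
    (Num.sqrt b%:R * \1_(cell j.+1 (b * k + i)) x - (Num.sqrt b%:R)^-1 * \1_(cell j k) x).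
Proof.
move=> ib; rewrite /zhaar zextE.
have [hx|hx] := boolP (0 <= x < 1); last first.
  rewrite !indicE !memNset ?mulr0 ?subrr ?mulr0//; by move=> [h _]; rewrite h in hx.
rewrite /= /haar_mother !indic_cell//.
have x0 : 0 <= x by case/andP: hx.
have e1 : (Num.floor (b%:R * (b%:R ^+ j * x - k%:R)) == i%:Z) = (lvl j.+1 x == b * k + i)%N.
  rewrite mulrBr mulrA -exprS -natrM floor_shift// mulr_ge0// ltW// bX_gt0//.
have e2 : (Num.floor (b%:R ^+ j * x - k%:R) == 0) = (lvl j x == k)%N.
  by rewrite (floor_shift k 0) ?addn0// mulr_ge0// ltW// bX_gt0.
by rewrite e1 e2.
Qed.

Lemma uL2_indic_cell j k : uL2 (\1_(cell j k) : R -> R).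
Proof.
split; first by apply: L2_indic; exact: measurable_cell.
by move=> x hx; rewrite indicE memNset// => -[h _]; rewrite h in hx.
Qed.

Definition haar_ok (j i k : nat) : bool := (i < if j == 0%N then 1 else b)%N && (k < b ^ j.-1)%N.

Lemma uL2_zhaar j i k : haar_ok j i k -> uL2 (zhaar j i k).
Proof.
case: j => [|j] /andP[/= ib _]; first by rewrite zhaar0; exact: uL2_indic_cell.
pose c : R := Num.sqrt (b%:R ^+ j).
have := uL2D (c * Num.sqrt b%:R) (uL2_indic_cell j.+1 (b * k + i))
  (uL2D (- (c * (Num.sqrt b%:R)^-1)) (uL2_indic_cell j k) (@uL2_0 R)).
by congr uL2; apply/funext => x; rewrite zhaarS// -/c; ring.
Qed.

Definition hcoef (j i k : nat) (f : R -> R) : R := Ex U (fun x => f x * zhaar j i k x).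

Lemma hcoef0 i k f : hcoef 0 i k f = cint 0 0 f.
Proof. by rewrite /hcoef zhaar0; congr Ex; apply/funext => x; rewrite mulrC. Qed.

(** Hence a Haar coefficient only depends on the integrals of [f] over the
    cells. *)
Lemma hcoefS j i k f : (i < b)%N -> uL2 f ->
  hcoef j.+1 i k f = Num.sqrt (b%:R ^+ j) *
    (Num.sqrt b%:R * cint j.+1 (b * k + i) f - (Num.sqrt b%:R)^-1 * cint j k f).
Proof.
move=> ib hf; set c := Num.sqrt (b%:R ^+ j); set s := Num.sqrt b%:R.
rewrite (_ : c * _ = (c * s) * cint j.+1 (b * k + i) f + (- (c * s^-1)) * cint j k f); last by ring.
rewrite /cint -!ExZ; [|exact: L1_cint|exact: L1_cint].
rewrite -ExD; [|apply: L1Z; exact: L1_cint|apply: L1Z; exact: L1_cint].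
by congr Ex; apply/funext => x; rewrite zhaarS// -/c -/s; ring.
Qed.

Lemma sum_blocks (V : nmodType) n m (F : nat -> V) :
  \sum_(K < n * m) F K = \sum_(k < n) \sum_(i < m) F (m * k + i)%N.
Proof.
elim: n => [|n IH]; first by rewrite mul0n !big_ord0.
rewrite mulSnr big_split_ord/= IH big_ord_recr/=; congr (_ + _).
by apply: eq_bigr => i _; rewrite mulnC.
Qed.

(** The Haar coefficients at level [j] carry exactly the energy of that level:
    within a cell, the [psi_i] are the projections of an orthonormal basis. *)
Lemma haar_level m j f g : uL2 f -> uL2 g -> (j <= m)%N ->
  \sum_(i < (if j == 0 then 1 else b)%N) \sum_(k < b ^ j.-1) hcoef j i k f * hcoef j i k g
  = lev b m j f g.
Proof.
move=> hf hg; case: j => [|j] jm /=.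
  by rewrite expn0 !big_ord1 !hcoef0 /upto leq0n /av expr0 mul1r expn0 big_ord1.
rewrite /upto jm (ltnW jm) /av exchange_big/=.
have -> : \sum_(k < b ^ j.+1) cint j.+1 k f * cint j.+1 k g =
   \sum_(k < b ^ j) \sum_(i < b) cint j.+1 (b * k + i)%N f * cint j.+1 (b * k + i)%N g.
  by rewrite expnSr (sum_blocks (b ^ j) b (fun k => cint j.+1 k f * cint j.+1 k g)).
rewrite !mulr_sumr -sumrB; apply: eq_bigr => k _.
have cs (h : R -> R) : uL2 h -> cint j k h = \sum_(i < b) cint j.+1 (b * k + i)%N h.
  move=> hh; rewrite (cint_refine b1 j 1 k hh) addn1 expn1.
  rewrite big_mkcond/= (eq_bigr (fun K : 'I_(b ^ j.+1) => if (K %/ b)%N == k then cint j.+1 K h else 0))//.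
  rewrite expnSr (sum_blocks (b ^ j) b (fun K => if (K %/ b)%N == k then cint j.+1 K h else 0)).
  rewrite (bigD1 k)//= [X in _ + X]big1 ?addr0.
    apply: eq_bigr => i _; rewrite (_ : (_ %/ _)%N = k) ?eqxx//.
    by rewrite mulnC divnMDl// divn_small ?addn0.
  move=> k' kk'; rewrite big1// => i _.
  rewrite mulnC divnMDl// divn_small ?addn0//.
  by case: eqP => // e; case/eqP: kk'; apply/val_inj.
have sb : Num.sqrt b%:R != 0 :> R by rewrite gt_eqF// sqrtr_gt0 ltr0n.
have sB : Num.sqrt (b%:R ^+ j) ^+ 2 = b%:R ^+ j :> R by rewrite sqr_sqrtr// ltW// bX_gt0.
have sb2 : Num.sqrt b%:R ^+ 2 = b%:R :> R by rewrite sqr_sqrtr// ler0n.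
transitivity (\sum_(i < b) (b%:R ^+ j * (b%:R * (cint j.+1 (b * k + i)%N f * cint j.+1 (b * k + i)%N g)
   - cint j k g * cint j.+1 (b * k + i)%N f - cint j k f * cint j.+1 (b * k + i)%N g
   + b%:R^-1 * (cint j k f * cint j k g)))).
  apply: eq_bigr => i _; rewrite !hcoefS//.
  set c := Num.sqrt (b%:R ^+ j) in sB *; set r := Num.sqrt b%:R in sb sb2 *.
  by rewrite -sB -sb2; field.
rewrite -mulr_sumr big_split/= !sumrB -!mulr_sumr -!cs// sumr_const card_ord.
rewrite -(mulr_natl (cint j k g) b) exprS.
have bn : b%:R != 0 :> R by rewrite pnatr_eq0 -lt0n.
by field.
Qed.

Section Tensor.
Variable D : nat.
Implicit Types (q : haar_ix D).

Lemma zcube_haar q : zcube (haar_tensor b q : D.-tuple R -> R) =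
  fun x => \prod_t zhaar (ix_j q t) (ix_i q t) (ix_k q t) (tnth x t).
Proof.
by rewrite -(zcube_prod (fun t => haar b (ix_j q t) (ix_i q t) (ix_k q t))).
Qed.

Lemma L2_haar q : haar_range b q -> L2 (cube_measure D) (zcube (haar_tensor b q : D.-tuple R -> R)).
Proof.
move=> hq; rewrite zcube_haar; apply: (L2_cube_prod (f := fun t => zhaar (ix_j q t) (ix_i q t) (ix_k q t))) => t.
by apply: uL2_zhaar; have [h1 h2] := hq t; apply/andP.
Qed.

Lemma haar_coefE (F : D.-tuple R -> R) q : haar_coef b F q =
  Ex (cube_measure D) (fun x => zcube F x * zcube (haar_tensor b q : D.-tuple R -> R) x).
Proof. by rewrite /haar_coef cube_integralE zcubeM. Qed.

(** By Fubini the Haar coefficients of an elementary tensor are products of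
    one-dimensional ones. *)
Lemma haar_coef_ft alpha (u : ftensor D) q : ft_sobolev alpha u -> haar_range b q ->
  haar_coef b (ft_eval u) q =
  \sum_(a < ft_size u) \prod_t hcoef (ix_j q t) (ix_i q t) (ix_k q t) (zext (ft_fac a t)).
Proof.
move=> hu hq; rewrite haar_coefE zcube_ft zcube_haar.
have hz t : uL2 (zhaar (ix_j q t) (ix_i q t) (ix_k q t)).
  by apply: uL2_zhaar; have [h1 h2] := hq t; apply/andP.
have l1 (a : 'I_(ft_size u)) t : L1 U (fun x => zext (ft_fac a t) x * zhaar (ix_j q t) (ix_i q t) (ix_k q t) x).
  by apply: L2_mul; [exact: (uL2_sobolev (hu a t)).1|exact: (hz t).1].
rewrite (_ : (fun x => _) = fun x => \sum_(a < ft_size u) \prod_t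
   (zext (ft_fac a t) (tnth x t) * zhaar (ix_j q t) (ix_i q t) (ix_k q t) (tnth x t))); last first.
  by apply/funext => x; rewrite mulr_suml; apply: eq_bigr => a _; rewrite big_split.
rewrite Ex_sum => [|a _]; last first.
  by have [] := cube_prod (fun t => l1 a t).
by apply: eq_bigr => a _; have [_ ->] := cube_prod (fun t => l1 a t).
Qed.

Lemma haar_coefD (F G : D.-tuple R -> R) q : L2 (cube_measure D) (zcube F) -> L2 (cube_measure D) (zcube G) ->
  haar_range b q -> haar_coef b (fun x => F x + G x) q = haar_coef b F q + haar_coef b G q.
Proof.
move=> hF hG hq; rewrite !haar_coefE zcubeD -ExD.
- by congr Ex; apply/funext => x; rewrite mulrDl.
- exact: L2_mul (L2_haar hq).
- exact: L2_mul (L2_haar hq).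
Qed.

(** A finite type is needed to distribute products over sums. It holds every
    index [(j, i, k)] of level at most [J], but also others, which [ok1]
    removes. *)
Definition ix1 (J : nat) := ('I_J.+1 * 'I_b * 'I_(b ^ J))%type.
Definition ok1 J (x : ix1 J) : bool := haar_ok x.1.1 x.1.2 x.2.
Definition emb J (c : {ffun 'I_D -> ix1 J}) : haar_ix D :=
  [ffun t => (((c t).1.1 : nat), ((c t).1.2 : nat), ((c t).2 : nat))].

Lemma emb_range J (c : {ffun 'I_D -> ix1 J}) : c \in ffun_on (@ok1 J) -> haar_range b (emb c).
Proof.
move=> /ffun_onP h t; have /andP[h1 h2] := h t.
by rewrite /ix_i /ix_j /ix_k !ffunE.
Qed.

Definition hker (al : R) J f g : R := \sum_(x : ix1 J | ok1 x)
  (b%:R `^ (2 * al)) ^+ x.1.1 * (hcoef x.1.1 x.1.2 x.2 f * hcoef x.1.1 x.1.2 x.2 g).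

Lemma hkerE al J f g : uL2 f -> uL2 g ->
  hker al J f g = \sum_(j < J.+1) (b%:R `^ (2 * al)) ^+ j * lev b J j f g.
Proof.
move=> hf hg; rewrite /hker.
rewrite -(pair_big_dep xpredT (fun (x : 'I_J.+1 * 'I_b) (k : 'I_(b ^ J)) => haar_ok x.1 x.2 k)
  (fun x k => (b%:R `^ (2 * al)) ^+ x.1 * (hcoef x.1 x.2 k f * hcoef x.1 x.2 k g)))/=.
rewrite -(pair_big_dep xpredT (fun (j : 'I_J.+1) (i : 'I_b) => true)
  (fun j i => \sum_(k < b ^ J | haar_ok j i k) (b%:R `^ (2 * al)) ^+ j * (hcoef j i k f * hcoef j i k g)))/=.
apply: eq_bigr => j _; rewrite -(haar_level hf hg (_ : (j <= J)%N)); last by rewrite -ltnS.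
rewrite mulr_sumr.
have nb : ((if j == 0%N :> nat then 1 else b) <= b)%N by case: ifP.
have nk : (b ^ j.-1 <= b ^ J)%N.
  by rewrite leq_exp2l// (leq_trans (leq_pred _))// -ltnS.
rewrite (big_ord_widen _ (fun i => (b%:R `^ (2 * al)) ^+ j * \sum_(k < b ^ j.-1) hcoef j i k f * hcoef j i k g) nb).
rewrite [RHS]big_mkcond/=; apply: eq_bigr => i _; case: ifP => ib; last first.
  by rewrite big1// => k; rewrite /haar_ok ib.
rewrite (big_ord_widen _ (fun k => hcoef j i k f * hcoef j i k g) nk) mulr_sumr.
by apply: eq_bigl => k; rewrite /haar_ok ib.
Qed.

Section Bound.
Variable alpha : R.
Hypothesis alpha0 : 0 < alpha.
Local Notation B := (b%:R `^ (2 * alpha)).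

(** The two forms differ by the term of the finest level, which is positive
    semidefinite. *)
Lemma hker_henergy J n (f : 'I_n -> R -> R) : (forall i, uL2 (f i)) ->
  psd (fun i i' => hker alpha J (f i) (f i')) /\
  psd_le (fun i i' => hker alpha J (f i) (f i')) (fun i i' => henergy b alpha J (f i) (f i')).
Proof.
move=> hf; have B0 : 0 <= B by exact: powR_ge0.
rewrite /psd_le (_ : (fun i i' => hker _ _ _ _) = fun i i' =>
  \sum_(j < J.+1) B ^+ j * lev b J j (f i) (f i')); last first.
  by apply/funext => i; apply/funext => i'; rewrite hkerE.
split; first by apply: psd_sum => j _; apply: psdZ; [exact: exprn_ge0|exact: lev_psd].
rewrite (_ : (fun i j => _) = fun i i' => B ^+ J.+1 * lev b J J.+1 (f i) (f i')).
  by apply: psdZ; [exact: exprn_ge0|exact: lev_psd].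
by apply/funext => i; apply/funext => i'; rewrite hkerE// /henergy big_ord_recr/= [X in X - _]addrC addrK.
Qed.

Lemma weight_emb J (c : {ffun 'I_D -> ix1 J}) :
  b%:R `^ (2 * alpha * (\sum_t ix_j (emb c) t)%:R) = \prod_t B ^+ (c t).1.1 :> R.
Proof.
rewrite powRrM powR_mulrn ?powR_ge0// -prodrXr.
by apply: eq_bigr => t _; rewrite /ix_j ffunE.
Qed.

(** The Haar wavelet norm restricted to the levels [0 .. J] in each
    coordinate. *)
Definition box_energy J (F : D.-tuple R -> R) : R := \sum_(c in ffun_on (@ok1 J))
  b%:R `^ (2 * alpha * (\sum_t ix_j (emb c) t)%:R) * haar_coef b F (emb c) ^+ 2.

(** The sum over the box factorizes into one-dimensional sums, one for each
    coordinate. *)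
Lemma box_energy_ft J (u : ftensor D) : ft_sobolev alpha u ->
  box_energy J (ft_eval u) = \sum_(a < ft_size u) \sum_(a' < ft_size u)
     \prod_t hker alpha J (zext (ft_fac a t)) (zext (ft_fac a' t)).
Proof.
move=> hu; pose H a (c : {ffun 'I_D -> ix1 J}) :=
  \prod_t hcoef (c t).1.1 (c t).1.2 (c t).2 (zext (@ft_fac R D u a t)).
transitivity (\sum_(c in ffun_on (@ok1 J)) \sum_(a < ft_size u) \sum_(a' < ft_size u)
    (\prod_t B ^+ (c t).1.1) * (H a c * H a' c)).
  apply: eq_bigr => c hc; rewrite weight_emb (haar_coef_ft hu (emb_range hc)).
  have -> : \sum_(a < ft_size u) \prod_t hcoef (ix_j (emb c) t) (ix_i (emb c) t) (ix_k (emb c) t) (zext (ft_fac a t))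
    = \sum_a H a c.
    by apply: eq_bigr => a _; apply: eq_bigr => t _; rewrite /ix_j /ix_i /ix_k !ffunE.
  rewrite expr2 mulr_suml mulr_sumr; apply: eq_bigr => a _.
  by rewrite mulr_sumr mulr_sumr.
rewrite exchange_big/=; apply: eq_bigr => a _.
rewrite exchange_big/=; apply: eq_bigr => a' _.
rewrite /hker bigA_distr_big/=; apply: eq_bigr => c _.
by rewrite !big_split.
Qed.

(** The inequality between Gram matrices of [henergy_gram], multiplied over
    the coordinates; the constant does not depend on [J]. *)
Lemma box_energy_le (ip : (R -> R) -> (R -> R) -> R) : sobolev_inner_product alpha ip ->
  exists2 C, 0 < C & forall J (u : ftensor D), ft_sobolev alpha u ->
    box_energy J (ft_eval u) <= C * ft_ip ip u u.
Proof.
move=> hip; have [C C0 hC] := henergy_gram b1 alpha0 hip.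
exists (C ^+ D); first exact: exprn_gt0.
move=> J u hu; rewrite box_energy_ft//.
have := @psd_le_prod R (ft_size u) 'I_D (index_enum _) xpredT
  (fun t a a' => hker alpha J (zext (ft_fac a t)) (zext (ft_fac a' t)))
  (fun t a a' => C * ip (ft_fac a t) (ft_fac a' t)).
move=> h; have {h} := h _ _; move=> h.
apply: le_trans (psd_le_total (h _ _)) _.
- by move=> t _; have [] := @hker_henergy J _ (fun a => zext (ft_fac a t)) (fun a => uL2_sobolev (hu a t)).
- move=> t _; apply: psd_le_trans (hC J _ (fun a => ft_fac a t) (fun a => hu a t)).
  by have [] := @hker_henergy J _ (fun a => zext (ft_fac a t)) (fun a => uL2_sobolev (hu a t)).
rewrite /ft_ip mulr_sumr; apply: ler_sum => a _; rewrite mulr_sumr; apply: ler_sum => a' _.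
by rewrite big_split/= prodr_const card_ord.
Qed.

Lemma box_energy_split J F G : L2 (cube_measure D) (zcube F) -> L2 (cube_measure D) (zcube G) ->
  box_energy J (fun x => F x + G x) <= 2 * box_energy J F + 2 * box_energy J G.
Proof.
move=> hF hG; rewrite /box_energy !mulr_sumr -big_split/=; apply: ler_sum => c hc.
rewrite (haar_coefD hF hG (emb_range hc)).
have := powR_ge0 (b%:R : R) (2 * alpha * (\sum_t ix_j (emb c) t)%:R).
set w := _ `^ _; set x := haar_coef b F _; set y := haar_coef b G _ => w0.
have := mulr_ge0 w0 (sqr_ge0 (x - y)); lra.
Qed.

(** This constant does depend on [J], which is enough for passing to the limit
    with [mix_limit]. *)
Lemma box_energy_L2 J : exists2 C, 0 <= C & forall F, L2 (cube_measure D) (zcube F) ->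
  box_energy J F <= C * Ex (cube_measure D) (fun x => zcube F x ^+ 2).
Proof.
exists (\sum_(c in ffun_on (@ok1 J)) b%:R `^ (2 * alpha * (\sum_t ix_j (emb c) t)%:R)
  * Ex (cube_measure D) (fun x => zcube (haar_tensor b (emb c) : D.-tuple R -> R) x ^+ 2)).
  apply: sumr_ge0 => c _; rewrite mulr_ge0 ?powR_ge0//; apply: Ex_ge0 => x; exact: sqr_ge0.
move=> F hF; rewrite mulr_suml; apply: ler_sum => c hc.
rewrite -[leRHS]mulrA; apply: ler_wpM2l; first exact: powR_ge0.
by rewrite haar_coefE mulrC; apply: cauchy_schwarz => //; apply: L2_haar; exact: emb_range.
Qed.

(** A sum of nonnegative terms is the supremum of its finite partial sums, and
    every finite set of Haar indices lies in a box. *)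
Lemma haar_normsq_box (F : D.-tuple R -> R) (M : R) : (forall J, box_energy J F <= M) ->
  (haar_normsq b alpha F <= M%:E)%E.
Proof.
move=> hM; apply: ge_ereal_sup => _ [A [finA AS] <-].
rewrite fsbig_finite//=.
(* any bound for the levels that occur would do *)
pose J := (\sum_(q <- fset_set A) \sum_t ix_j q t)%N.
have hA q : q \in fset_set A -> haar_range b q by rewrite in_fset_set// => /set_mem /AS.
have hJ q t : q \in fset_set A -> (ix_j q t <= J)%N.
  move=> qA; rewrite /J (big_rem q)//= (bigD1 t)//= -addnA leq_addr//.
have bJ : (0 < b ^ J)%N by rewrite expn_gt0 b0.
pose pr (q : haar_ix D) : {ffun 'I_D -> ix1 J} :=
  [ffun t => (insubd (ord0 : 'I_J.+1) (ix_j q t), insubd (Ordinal b0) (ix_i q t),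
              insubd (Ordinal bJ) (ix_k q t))].
have prK q : q \in fset_set A -> emb (pr q) = q.
  move=> qA; apply/ffunP => t; rewrite !ffunE /=.
  have [h1 h2] := hA _ qA t; have h3 := hJ _ t qA.
  rewrite !insubdK ?unfold_in/=.
  - by rewrite /ix_j /ix_i /ix_k; case: (q t) => -[].
  - apply: leq_trans h2 _; rewrite leq_exp2l// (leq_trans (leq_pred _))//.
  - by apply: leq_trans h1 _; case: ifP.
  - by rewrite ltnS.
have prok q : q \in fset_set A -> pr q \in ffun_on (@ok1 J).
  move=> qA; apply/ffun_onP => t; have [h1 h2] := hA _ qA t.
  have := prK _ qA => /ffunP/(_ t); rewrite ffunE => e.
  rewrite unfold_in /ok1 /haar_ok.
  by move: h1 h2; rewrite /ix_i /ix_j /ix_k -e /= => -> ->.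
pose w (q : haar_ix D) := b%:R `^ (2 * alpha * (\sum_t ix_j q t)%:R) * haar_coef b F q ^+ 2.
rewrite sumEFin lee_fin; apply: le_trans (hM J).
have w0 q : 0 <= w q by rewrite mulr_ge0 ?powR_ge0 ?sqr_ge0.
rewrite -[X in X <= _]/(\sum_(q <- fset_set A) w q).
have -> : \sum_(q <- fset_set A) w q = \sum_(c <- map pr (fset_set A)) w (emb c).
  by rewrite big_map; apply: eq_big_seq => q qA; rewrite prK.
have um : uniq (map pr (fset_set A)).
  rewrite map_inj_in_uniq ?fset_uniq// => q q' qA qA' e.
  by rewrite -(prK _ qA) -(prK _ qA') e.
rewrite big_uniq//= /box_energy big_mkcond [leRHS]big_mkcond/=; apply: ler_sum => c _.
case: ifP => [/mapP[q qA ->]|_]; first by rewrite prok.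
by case: ifP => // _; exact: w0.
Qed.

End Bound.
End Tensor.

(** The bound on finite tensors passes to the limit in each box, and then to
    the supremum over the boxes. *)
Lemma haar_embedding (alpha : R) D (ip : (R -> R) -> (R -> R) -> R) : 0 < alpha ->
  sobolev_inner_product alpha ip ->
  exists K : R, forall F : D.-tuple R -> R, sobolev_mix alpha ip F ->
    haar_space b alpha F /\ haar_norm b alpha F <= K * sobolev_mix_norm alpha ip F.
Proof.
move=> a0 hip; have [C C0 hC] := box_energy_le D a0 hip.
exists (Num.sqrt (2 * C)) => F [mF [u hu]].
have [v0 hv0] := mix_norm_cvg hip hu.
rewrite /sobolev_mix_norm; set S := [set v : R | _].
have : S (xget 0 S) by apply: xgetPex; exists v0, u; split; [exact: hu|exact: hv0].
set v := xget 0 S => -[u' [hu' hv]].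
have L2F := mix_L2 mF hu'.
have bd J : box_energy alpha J F <= 2 * C * v.
  have [C' C'0 hC'] := box_energy_L2 D alpha J.
  have C'2 : 0 <= 2 * C' by rewrite mulr_ge0.
  apply: (mix_limit mF hu' C'2 hv) => k /L2_zcube hk.
  have hu'k : ft_sobolev alpha (u' k) by case: hu' => h _ _ i t; exact: h.
  have := box_energy_split alpha J (L2_ft hu'k) hk.
  rewrite (_ : (fun x => _ + _) = F); last by apply/funext => x; rewrite addrC subrK.
  move=> h; apply: le_trans h _; rewrite -!mulrA; apply: lerD; rewrite ler_pM2l//.
    exact: hC.
  exact: hC'.
have hn := haar_normsq_box bd.
split; first by split => //; apply: le_lt_trans hn (ltry _).
rewrite /haar_norm -sqrtrM; last by rewrite mulr_ge0// ltW.
apply: ler_wsqrtr; rewrite -lee_fin fineK//.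
rewrite ge0_fin_numE; first exact: le_lt_trans hn (ltry _).
by apply: esum_ge0 => q _; rewrite lee_fin mulr_ge0 ?powR_ge0 ?sqr_ge0.
Qed.

End HaarSystem.

(** * The scrambled digits of two points *)

Section UniformPermutation.
Context {R : realType}.
Variable b : nat.
Implicit Types s : {perm 'I_b}.

(** Composing with a transposition exchanges the permutations that send [d] to
    [e'] with those that send [d] to [e], so all [b] values are equally
    frequent. *)
Lemma card_perm_image (d : 'I_b) (e : 'I_b) :
  (b * #|[pred s : {perm 'I_b} | s d == e]| = b`!)%N.
Proof.
have h e' : #|[pred s : {perm 'I_b} | s d == e']| = #|[pred s : {perm 'I_b} | s d == e]|.
  rewrite -(card_imset _ (mulIg (tperm e' e))); apply: eq_card => s.
  apply/imsetP/idP => [[s' hs' ->]|hs].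
    by move: hs'; rewrite !inE permM => /eqP ->; rewrite tpermL.
  exists (s * (tperm e' e)^-1)%g; last by rewrite mulgKV.
  by move: hs; rewrite !inE permM tpermV => /eqP ->; rewrite tpermR.
rewrite -[RHS](_ : #|{: {perm 'I_b}}| = _); last by rewrite card_Sn.
rewrite -[in RHS]sum1_card (partition_big (fun s : {perm 'I_b} => s d) xpredT)//=.
rewrite (eq_bigr (fun=> #|[pred s : {perm 'I_b} | s d == e]|)).
  by rewrite sum_nat_const card_ord.
by move=> e' _; rewrite sum1_card -(h e'); apply: eq_card => s; rewrite !inE.
Qed.

(** The same argument for the second value, among the [b - 1] values left by
    the first one. *)
Lemma card_perm_image2 (d d' e e' : 'I_b) : d != d' -> e != e' ->
  ((b * b.-1) * #|[pred s : {perm 'I_b} | (s d == e) && (s d' == e')]| = b`!)%N.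
Proof.
move=> dd ee.
have h e1 : e1 != e -> #|[pred s : {perm 'I_b} | (s d == e) && (s d' == e1)]| =
    #|[pred s : {perm 'I_b} | (s d == e) && (s d' == e')]|.
  move=> e1e; rewrite -(card_imset _ (mulIg (tperm e1 e'))); apply: eq_card => s.
  have fe : tperm e1 e' e = e by rewrite tpermD// 1?eq_sym.
  apply/imsetP/idP => [[s' hs' ->]|hs].
    by move: hs'; rewrite !inE !permM => /andP[/eqP -> /eqP ->]; rewrite fe tpermL !eqxx.
  exists (s * (tperm e1 e')^-1)%g; last by rewrite mulgKV.
  by move: hs; rewrite !inE !permM !tpermV => /andP[/eqP -> /eqP ->]; rewrite fe tpermR !eqxx.
rewrite -(card_perm_image d e) -mulnA; congr (_ * _)%N.
rewrite -[in RHS]sum1_card (partition_big (fun s : {perm 'I_b} => s d') (fun e1 => e1 != e))/=; last first.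
  by move=> s; rewrite inE => /eqP <-; rewrite (inj_eq perm_inj) eq_sym.
rewrite (eq_bigr (fun=> #|[pred s : {perm 'I_b} | (s d == e) && (s d' == e')]|)).
  rewrite sum_nat_const; congr (_ * _)%N.
  by rewrite (_ : #|_| = #|predC1 e|) ?cardC1 ?card_ord//; apply: eq_card => x; rewrite !inE.
by move=> e1 h1; rewrite sum1_card -(h e1 h1); apply: eq_card => s; rewrite !inE.
Qed.

End UniformPermutation.

Section Digits.
Context {R : realType}.
Variable b : nat.
Hypothesis hb : (1 < b)%N.
Implicit Types x : R.
Local Notation lvl := (@lvl R b).

Lemma bdigitE x k : bdigit hb x k = (lvl k.+1 x %% b)%N :> nat.
Proof. by []. Qed.

Lemma lvl_digit x k : 0 <= x -> lvl k.+1 x = (b * lvl k x + bdigit hb x k)%N.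
Proof. by move=> x0; rewrite bdigitE -(lvlS hb k x0) mulnC -divn_eq. Qed.

(** The first [j] digits and the integer that they form determine each
    other. *)
Lemma prefix_lvl x x' j : 0 <= x < 1 -> 0 <= x' < 1 ->
  (mkseq (bdigit hb x) j == mkseq (bdigit hb x') j) = (lvl j x == lvl j x').
Proof.
move=> hx hx'; have x0 : 0 <= x by case/andP: hx. have x0' : 0 <= x' by case/andP: hx'.
elim: j => [|j IH]; first by rewrite !lvl0// !eqxx.
rewrite !mkseqS eqseq_rcons IH !lvl_digit//; apply/andP/eqP => [[/eqP -> /eqP ->]//|].
move=> e; have e1 : lvl j x = lvl j x'.
  have := congr1 (fun n => n %/ b)%N e.
  by rewrite ![(b * _)%N]mulnC !divnMDl ?(ltnW hb)// !divn_small ?addn0.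
by split; apply/eqP => //; apply/val_inj; move: e; rewrite e1 => /addnI.
Qed.

End Digits.

HB.instance Definition _ b s d := gen_eqMixin (rv_ix b s d).

Section Randomized.
Context {R : realType} {d0 : measure_display} {Omega : measurableType d0}.
Variable P : probability Omega R.
Variables b s d : nat.
Hypothesis hb : (1 < b)%N.
Variable pi : 'I_d -> nat -> 'I_s -> seq 'I_b -> Omega -> {perm 'I_b}.
Variable xi : 'I_d -> forall m : nat, 'I_s -> 'I_(b ^ m) -> Omega -> R.
Hypothesis hrand : independently_randomized P pi xi.
Local Notation U := (@unif R).
Local Notation lvl := (@lvl R b).
Local Notation K := (@rv_used b s d).
Local Notation E := (rv_events pi xi).
Local Notation sigR := (sigS K E).
Local Notation smfR := (smf K E).
Local Notation prob A := (fine (P A)).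

Let b0 : (0 < b)%N. Proof. exact: ltnW. Qed.
Let bR0 : (b%:R : R) != 0. Proof. by rewrite pnatr_eq0 -lt0n. Qed.

Lemma rv_Em q : K q -> E q `<=` measurable.
Proof. exact: (rand_measurable hrand). Qed.

Lemma rv_EI q : setI_closed (E q).
Proof.
case: q => [n m t pre|n m t i] _ _ [A hA <-] [B hB <-] /=.
  by exists (A `&` B).
by exists (A `&` B) => //; exact: measurableI.
Qed.

Lemma rv_ET q : E q setT.
Proof. by case: q => [n m t pre|n m t i] /=; exists setT. Qed.

Lemma rv_Eind : mutually_independent P K E.
Proof. exact: (rand_independent hrand). Qed.

Lemma rv_indep S S' A B : (forall q, S q -> S' q -> False) ->
  sigR S A -> sigR S' B -> P (A `&` B) = (P A * P B)%E.
Proof. exact: sigS_indep rv_Em rv_EI rv_ET rv_Eind _ _ _ _. Qed.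

Lemma rv_measurable S A : sigR S A -> measurable A.
Proof. exact: measurable_sigS rv_Em _ _. Qed.

Lemma rv_prob S S' A B : (forall q, S q -> S' q -> False) ->
  sigR S A -> sigR S' B -> prob (A `&` B) = prob A * prob B.
Proof.
move=> dis sA sB; rewrite (rv_indep dis sA sB) fineM//; apply: fin_num_measure;
  [exact: rv_measurable sA|exact: rv_measurable sB].
Qed.

Lemma sigR_I S A B : sigR S A -> sigR S B -> sigR S (A `&` B).
Proof. exact: (@measurableI _ (g_sigma_algebraType (gens K E S))). Qed.

Lemma sigR_sub S S' : S `<=` S' -> sigR S `<=` sigR S'.
Proof. exact: sigS_sub. Qed.

Section Coordinate.
Variables (n : 'I_d) (m : nat) (t : 'I_s).

Definition perms (Z : seq 'I_b -> Prop) : set (rv_ix b s d) :=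
  [set q | exists2 pre, q = PermIx n m t pre & Z pre].

Lemma sig_perm pre (B : set {perm 'I_b}) (Z : seq 'I_b -> Prop) : (size pre < m)%N -> Z pre ->
  sigR (perms Z) (pi n m t pre @^-1` B).
Proof.
move=> hp hZ; apply: sub_sigma_algebra; exists (PermIx n m t pre).
  by split => //; exists pre.
by exists B.
Qed.

(** The integer formed by the first [r] scrambled digits of [x]. *)
Fixpoint kst (r : nat) (x : R) (w : Omega) : nat :=
  if r is r'.+1 then (b * kst r' x w + pi n m t (mkseq (bdigit hb x) r') w (bdigit hb x r'))%N else 0%N.

Lemma kst_lt r x w : (kst r x w < b ^ r)%N.
Proof.
elim: r => [//|r IH] /=; have := ltn_ord (pi n m t (mkseq (bdigit hb x) r) w (bdigit hb x r)).
rewrite expnS; set e := nat_of_ord _ => he; nia.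
Qed.

Lemma scramble_kst x w :
  scramble hb m (fun pre => pi n m t pre w) x = (kst m x w)%:R / b%:R ^+ m.
Proof.
suff h (r : nat) : \sum_(k < r) (nat_of_ord (pi n m t (mkseq (bdigit hb x) k) w (bdigit hb x k)))%:R / b%:R ^+ k.+1
    = (kst r x w)%:R / b%:R ^+ r :> R by exact: h.
elim: r => [|r IH]; first by rewrite big_ord0 mul0r.
rewrite big_ord_recr IH /= natrD natrM mulrDl; congr (_ + _).
by rewrite exprS invfM mulrACA divff// mul1r.
Qed.

(** The next scrambled digit is the remainder modulo [b] of the next
    integer. *)
Lemma kstS_event r x k :
  [set w | kst r.+1 x w = k] =
  [set w | kst r x w = k %/ b]%N `&`
  (pi n m t (mkseq (bdigit hb x) r) @^-1` [set s : {perm 'I_b} | s (bdigit hb x r) = (k %% b)%N :> nat]).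
Proof.
apply/seteqP; split => w /=.
  move=> <-; rewrite mulnC divnMDl// divn_small// addn0; split => //.
  by rewrite modnMDl modn_small.
by move=> [-> ->]; rewrite mulnC -divn_eq.
Qed.

Lemma sig_kst r x k : (r <= m)%N -> sigR (perms (fun pre => (size pre < r)%N)) [set w | kst r x w = k].
Proof.
elim: r k => [|r IH] k rm.
  have [->|k0] := eqVneq k 0%N.
    rewrite (_ : [set w | _] = setT); last by apply/seteqP; split.
    exact: (@measurableT _ (g_sigma_algebraType _)).
  rewrite (_ : [set w | _] = set0); last first.
    by apply/seteqP; split => // w /= e; rewrite -e eqxx in k0.
  exact: (@measurable0 _ (g_sigma_algebraType _)).
rewrite kstS_event; apply: sigR_I.
  apply: sigR_sub (IH _ (ltnW rm)) => q [pre -> hp]; exists pre => //; exact: ltnW.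
by apply: sig_perm; rewrite ?size_mkseq.
Qed.

Lemma sig_kst_all x k : sigR (perms (fun pre => True)) [set w | kst m x w = k].
Proof. by apply: sigR_sub (sig_kst x k (leqnn m)) => q [pre -> _]; exists pre. Qed.

Lemma perm_prob pre (p : pred {perm 'I_b}) : (size pre < m)%N ->
  prob (pi n m t pre @^-1` [set s : {perm 'I_b} | p s]) = #|p|%:R / (b`!)%:R.
Proof.
move=> hp.
have mB B : measurable (pi n m t pre @^-1` B).
  by apply: (rv_measurable (sig_perm (Z := fun=> True) B hp _)).
rewrite -(Ex_indic P (mB _)).
rewrite (_ : \1_(_) = fun w => \sum_(s | p s) \1_(pi n m t pre @^-1` [set s]) w); last first.
  apply/funext => w; rewrite indicE; case: (boolP (p (pi n m t pre w))) => pw.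
    rewrite mem_set// (bigD1 (pi n m t pre w))//= indicE mem_set// big1 ?addr0// => s' /andP[_ ns].
    by rewrite indicE memNset// => /= e; rewrite e eqxx in ns.
  rewrite memNset; last by move=> h; rewrite /= h in pw.
  by rewrite big1// => s' ps; rewrite indicE memNset// => /= e; rewrite e ps in pw.
rewrite Ex_sum; last by move=> s' _; apply: L1_indic; exact: mB.
rewrite (eq_bigr (fun=> (b`!)%:R^-1)); last first.
  by move=> s' _; rewrite Ex_indic ?(rand_perm_uniform hrand)//; exact: mB.
by rewrite sumr_const -[LHS]mulr_natl.
Qed.

Lemma digit_prob1 pre (dd e : 'I_b) : (size pre < m)%N ->
  prob (pi n m t pre @^-1` [set s : {perm 'I_b} | s dd = e :> nat]) = b%:R^-1.
Proof.
move=> hp; have := @perm_prob pre [pred s : {perm 'I_b} | s dd == e] hp.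
rewrite (_ : [set s | _] = [set s : {perm 'I_b} | s dd = e :> nat]); last first.
  by apply/seteqP; split => s' /=; [move=> /eqP -> | move=> h; apply/eqP/val_inj].
move=> ->; set c := #|_|.
have hR : (b`!)%:R = b%:R * c%:R :> R by rewrite -natrM (card_perm_image dd e).
have : (b`!)%:R != 0 :> R by rewrite pnatr_eq0 -lt0n fact_gt0.
by rewrite hR mulf_eq0 negb_or => /andP[h1 h2]; field; rewrite h1.
Qed.

Lemma digit_prob2 pre (dd dd' e e' : 'I_b) : (size pre < m)%N -> dd != dd' ->
  prob (pi n m t pre @^-1` [set s : {perm 'I_b} | s dd = e :> nat] `&`
        pi n m t pre @^-1` [set s : {perm 'I_b} | s dd' = e' :> nat]) = (e != e')%:R / (b%:R * (b%:R - 1)).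
Proof.
move=> hp ddn; have := @perm_prob pre [pred s : {perm 'I_b} | (s dd == e) && (s dd' == e')] hp.
rewrite (_ : pi n m t pre @^-1` _ = pi n m t pre @^-1` [set s : {perm 'I_b} | s dd = e :> nat] `&`
        pi n m t pre @^-1` [set s : {perm 'I_b} | s dd' = e' :> nat]); last first.
  apply/seteqP; split => w /=; first by move=> /andP[/eqP -> /eqP ->].
  by move=> [h h']; apply/andP; split; apply/eqP/val_inj.
move=> ->; have [<-|ee] := eqVneq e e'.
  rewrite mul0r (_ : #|_| = 0%N) ?mul0r//; apply: eq_card0 => s'; rewrite !inE.
  by apply/negP => /andP[/eqP h1 /eqP h2]; case/eqP: ddn; apply: (@perm_inj _ s'); rewrite h1 h2.
set c := #|_|.
have bm : b.-1%:R = b%:R - 1 :> R by rewrite -subn1 natrB.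
have hR : (b`!)%:R = b%:R * (b%:R - 1) * c%:R :> R by rewrite -bm -!natrM (card_perm_image2 ddn ee).
have : (b`!)%:R != 0 :> R by rewrite pnatr_eq0 -lt0n fact_gt0.
by rewrite hR !mulf_eq0 !negb_or => /andP[/andP[h1 h2] h3]; rewrite /=; field; rewrite h1 h2.
Qed.

Section Pair.
Variables x x' : R.
Hypothesis hx : 0 <= x < 1.
Hypothesis hx' : 0 <= x' < 1.

Definition same_lvl (j : nat) : bool := lvl j x == lvl j x'.

(** The correlation of two scrambled points at level [j]: it is [1] as long as
    the original points share their first [j] digits, [- 1 / (b - 1)] at the
    first digit where they differ, and [0] after it. *)
Definition gam (j : nat) : R :=
  if j is j'.+1 then (b%:R * (same_lvl j'.+1)%:R - (same_lvl j')%:R) / (b%:R - 1) else 1.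

(** The normalized indicator that two integers of [r] digits share their first
    [j] digits. *)
Definition agree (r j k k' : nat) : R := b%:R ^+ j * ((k %/ b ^ (r - j)) == (k' %/ b ^ (r - j)))%N%:R.

Definition lagree (r j k k' : nat) : R :=
  if j is j'.+1 then agree r j'.+1 k k' - agree r j' k k' else agree r 0 k k'.

(** The joint law of the scrambled digits of two points, up to normalization,
    expanded over the levels. *)
Definition kap (r k k' : nat) : R := \sum_(j < r.+1) gam j * lagree r j k k'.

Lemma same_lvlS j : same_lvl j.+1 -> same_lvl j.
Proof.
have x0 : 0 <= x by case/andP: hx. have x0' : 0 <= x' by case/andP: hx'.
by rewrite /same_lvl -(lvlS hb j x0) -(lvlS hb j x0') => /eqP ->.
Qed.

Lemma same_lvl_le i j : (i <= j)%N -> same_lvl j -> same_lvl i.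
Proof.
move=> ij; rewrite -(subnK ij); elim: (j - i)%N => [//|k IH]; rewrite addSn => /same_lvlS; exact: IH.
Qed.

Lemma gam1 j : same_lvl j -> gam j = 1.
Proof.
case: j => [//|j] h /=; rewrite h (same_lvlS h) mulr1 divff// subr_eq0.
by rewrite -[1]/(1%:R) eqr_nat; apply/eqP => e; move: hb; rewrite e.
Qed.

Lemma gam0 j : ~~ same_lvl j -> gam j.+1 = 0.
Proof.
move=> h; rewrite /gam (negPf h) (_ : same_lvl j.+1 = false) ?mulr0 ?subr0 ?mul0r//.
by apply/negP => /same_lvlS h'; rewrite h' in h.
Qed.

Lemma lagree_sum r j k k' : \sum_(i < j.+1) lagree r i k k' = agree r j k k'.
Proof.
elim: j => [|j IH]; first by rewrite big_ord1.
by rewrite big_ord_recr/= IH addrC subrK.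
Qed.

Lemma kap_same r k k' : same_lvl r -> kap r k k' = agree r r k k'.
Proof.
move=> h; rewrite -lagree_sum; apply: eq_bigr => j _.
by rewrite gam1 ?mul1r//; apply: same_lvl_le h; rewrite -ltnS.
Qed.

Lemma agreeS r j k k' : (j <= r)%N -> agree r.+1 j k k' = agree r j (k %/ b) (k' %/ b).
Proof. by move=> jr; rewrite /agree subSn// expnS !divnMA. Qed.

(** Only the top level is new when a digit is appended. *)
Lemma kapS r k k' : kap r.+1 k k' = kap r (k %/ b) (k' %/ b) +
  gam r.+1 * (agree r.+1 r.+1 k k' - agree r r (k %/ b) (k' %/ b)).
Proof.
rewrite /kap big_ord_recr/= -(agreeS _ _ (leqnn r)); congr (_ + _).
apply: eq_bigr => j _; congr (_ * _); have jr : (j <= r)%N by rewrite -ltnS.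
by case: {+}j jr => -[|j'] ? /= jr; rewrite !agreeS// ltnW.
Qed.

Lemma agreerr r k k' : agree r r k k' = b%:R ^+ r * (k == k')%:R.
Proof. by rewrite /agree subnn expn0 !divn1. Qed.

(** By induction on the number of digits. While the original points agree, the
    same permutation acts on both, so that equal digits stay equal and
    distinct digits become a uniform pair of distinct digits; once they have
    split, independent permutations act. *)
Lemma pair_prob r k k' : (r <= m)%N -> (k < b ^ r)%N -> (k' < b ^ r)%N ->
  prob ([set w | kst r x w = k] `&` [set w | kst r x' w = k']) = (b%:R ^+ r) ^- 2 * kap r k k'.
Proof.
elim: r k k' => [|r IH] k k' rm hk hk'.
  move: hk hk'; rewrite expn0 !ltnS !leqn0 => /eqP -> /eqP ->.
  rewrite (_ : _ `&` _ = setT); last by apply/seteqP; split.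
  by rewrite probability_setT /kap big_ord1 /= /agree subnn !divn1 eqxx !expr0 expr1n invr1 !mulr1.
have kb : (k %/ b < b ^ r)%N by rewrite ltn_divLR// -expnSr.
have kb' : (k' %/ b < b ^ r)%N by rewrite ltn_divLR// -expnSr.
rewrite !kstS_event setIACA.
set pre := mkseq (bdigit hb x) r; set pre' := mkseq (bdigit hb x') r.
have sp : (size pre < m)%N by rewrite size_mkseq.
have sp' : (size pre' < m)%N by rewrite size_mkseq.
pose e : 'I_b := Ordinal (ltn_pmod k b0); pose e' : 'I_b := Ordinal (ltn_pmod k' b0).
set A := pi n m t pre @^-1` _; set A' := pi n m t pre' @^-1` _.
have sA : sigR (perms (fun q => size q = r)) A by apply: sig_perm => //; rewrite size_mkseq.
have sA' : sigR (perms (fun q => size q = r)) A' by apply: sig_perm => //; rewrite size_mkseq.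
rewrite (rv_prob (S := perms (fun q => (size q < r)%N)) (S' := perms (fun q => size q = r))); last 3 first.
- by move=> q [p1 -> h1] [p2 [<-] h2]; rewrite h2 ltnn in h1.
- by apply: sigR_I; apply: sig_kst; exact: ltnW.
- exact: sigR_I.
rewrite IH// ?(ltnW rm)// kapS !agreerr.
have bb1 : b%:R - 1 != 0 :> R.
  by rewrite subr_eq0 -[1]/(1%:R) eqr_nat; apply/eqP => h; move: hb; rewrite h.
have kk : (k == k')%N = ((k %/ b == k' %/ b) && (k %% b == k' %% b))%N.
  apply/eqP/andP => [->//|[/eqP h1 /eqP h2]].
  by rewrite (divn_eq k b) (divn_eq k' b) h1 h2.
have bX : b%:R ^+ r != 0 :> R by rewrite expf_neq0.
case: (boolP (same_lvl r)) => sr; last first.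
  rewrite gam0// mul0r addr0.
  rewrite (rv_prob (S := perms (fun q => q = pre)) (S' := perms (fun q => q = pre'))); last 3 first.
  - move=> q [p1 -> ->] [p2 [<-] e2]; move: sr; rewrite /same_lvl -(prefix_lvl hb r hx hx').
    by rewrite -/pre -/pre' e2 eqxx.
  - exact: sig_perm.
  - exact: sig_perm.
  rewrite (digit_prob1 (bdigit hb x r) e sp) (digit_prob1 (bdigit hb x' r) e' sp').
  move: bX; rewrite [b%:R ^+ r.+1]exprS; move: (b%:R ^+ r) => X X0.
  by field; rewrite X0.
have prepre : pre = pre' by apply/eqP; rewrite prefix_lvl.
rewrite (kap_same _ _ sr) agreerr.
case: (boolP (same_lvl r.+1)) => sr1.
  have dd : bdigit hb x' r = bdigit hb x r.
    have : mkseq (bdigit hb x) r.+1 == mkseq (bdigit hb x') r.+1 by rewrite prefix_lvl.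
    by rewrite !mkseqS eqseq_rcons => /andP[_ /eqP].
  rewrite gam1// mul1r addrC subrK /A /A' -prepre dd.
  have [em|em] := eqVneq (k %% b)%N (k' %% b)%N.
    rewrite em setIid (digit_prob1 (bdigit hb x r) e' sp) kk em eqxx andbT [b%:R ^+ r.+1]exprS.
    by move: bX; move: (b%:R ^+ r) => X X0; field; rewrite X0.
  rewrite (_ : _ `&` _ = set0); last first.
    by apply/seteqP; split => // w /= [-> h]; rewrite h eqxx in em.
  by rewrite measure0 kk (negPf em) andbF !mulr0.
have dd : bdigit hb x r != bdigit hb x' r.
  apply: contra sr1 => /eqP e1; rewrite /same_lvl -(prefix_lvl hb r.+1 hx hx').
  by rewrite !mkseqS eqseq_rcons -/pre -/pre' prepre e1 !eqxx.
rewrite /A /A' -prepre (digit_prob2 e e' sp dd).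
rewrite /gam (negPf sr1) sr mulr0 sub0r.
have -> : (e != e') = (k %% b != k' %% b)%N by [].
rewrite kk [b%:R ^+ r.+1]exprS; move: bX; move: (b%:R ^+ r) => X X0.
by case: eqP => h1; case: eqP => h2 /=; field; rewrite X0 bb1 bR0.
Qed.

End Pair.
End Coordinate.
End Randomized.

(** * Moments of the coordinates of scrambled points *)

Section ScrambledCoordinate.
Context {R : realType} {d0 : measure_display} {Omega : measurableType d0}.
Variable P : probability Omega R.
Variables b s d : nat.
Hypothesis hb : (1 < b)%N.
Variable pi : 'I_d -> nat -> 'I_s -> seq 'I_b -> Omega -> {perm 'I_b}.
Variable xi : 'I_d -> forall m : nat, 'I_s -> 'I_(b ^ m) -> Omega -> R.
Hypothesis hrand : independently_randomized P pi xi.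
Local Notation U := (@unif R).
Local Notation K := (@rv_used b s d).
Local Notation E := (rv_events pi xi).
Local Notation sigR := (sigS K E).
Local Notation smfR := (smf K E).
Local Notation prob A := (fine (P A)).
Local Notation mu := (@lebesgue_measure R).
Local Notation cell := (@cell R b).
Local Notation cint := (cint b).

Let b0 : (0 < b)%N. Proof. exact: ltnW. Qed.

Lemma rv_indep_Ex (S S' : set (rv_ix b s d)) (X Y : Omega -> R) : (forall q, S q -> S' q -> False) ->
  smfR S X -> smfR S' Y -> L1 P X -> L1 P Y ->
  L1 P (fun w => X w * Y w) /\ Ex P (fun w => X w * Y w) = Ex P X * Ex P Y.
Proof.
exact: (smf_indep_Ex (rv_Em hrand) (@rv_EI _ _ _ _ _ _ pi xi) (@rv_ET _ _ _ _ _ _ pi xi) (rv_Eind hrand)).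
Qed.

Lemma smf_indic (S : set (rv_ix b s d)) A : sigR S A -> smfR S (\1_A : Omega -> R).
Proof. by move=> sA; apply: (@measurable_indic _ (g_sigma_algebraType (gens K E S))). Qed.

Definition rv_coord (n : 'I_d) (m : nat) (t : 'I_s) : set (rv_ix b s d) := [set q | match q with
  | PermIx n' m' t' _ => [/\ n' = n, m' = m & t' = t]
  | UnifIx n' m' t' _ => [/\ n' = n, m' = m & t' = t] end].

Section Fixed.
Variables (n : 'I_d) (m : nat) (t : 'I_s).
Local Notation kst := (kst hb pi n m t).

(** The [t]-th coordinate of the [i]-th point, started from the coordinate [x]
    of the net. *)
Definition Ypt (x : R) (i : 'I_(b ^ m)) (w : Omega) : R :=
  scramble hb m (fun pre => pi n m t pre w) x + b%:R ^- m * xi n t i w.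

Let bX : 0 < b%:R ^+ m :> R. Proof. exact: bX_gt0. Qed.

Lemma YptE x i w : Ypt x i w = ((kst m x w)%:R + xi n t i w) / b%:R ^+ m.
Proof. by rewrite /Ypt scramble_kst mulrDl [X in _ + X]mulrC. Qed.

Lemma Ypt_itv x i w : 0 <= Ypt x i w < 1.
Proof.
rewrite YptE; have /andP[x0 x1] := rand_xi_range hrand n t i w.
rewrite divr_ge0 ?addr_ge0 ?(ltW bX)//= ltr_pdivrMr// mul1r.
have := kst_lt hb pi n m t m x w; rewrite -(ler_nat R) natrX -natr1.
lra.
Qed.

Lemma lvl_Ypt x i w : lvl b m (Ypt x i w) = kst m x w.
Proof.
apply: truncn_def; rewrite YptE mulrC divfK ?gt_eqF//.
have /andP[x0 x1] := rand_xi_range hrand n t i w.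
by rewrite -natr1 lerDl x0 ltrD2l.
Qed.

Definition ucoord (i : 'I_(b ^ m)) : set (rv_ix b s d) := [set UnifIx n t i].

Lemma unifix_inj (i i' : 'I_(b ^ m)) : @UnifIx b s d n m t i = UnifIx n t i' -> i = i'.
Proof.
move=> /(congr1 (fun q : rv_ix b s d => if q is UnifIx _ _ _ i then nat_of_ord i else 0%N)) /= e.
exact/val_inj.
Qed.

Let ksig (x : R) (k : nat) : sigR (perms n m t (fun=> True)) [set w | kst m x w = k].
Proof. exact: sig_kst_all. Qed.

Lemma smf_xi i : smfR (ucoord i) (xi n t i).
Proof.
apply/smfP => B mB; apply: sub_sigma_algebra; exists (UnifIx n t i); first by split.
by exists B.
Qed.

Lemma smf_Ypt x i : smfR (rv_coord n m t) (Ypt x i).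
Proof.
rewrite (_ : Ypt x i = fun w => (\sum_(k < b ^ m) k%:R * \1_[set w | kst m x w = k] w
   + xi n t i w) * (b%:R ^- m)); last first.
  apply/funext => w; rewrite YptE; congr ((_ + _) * _).
  have kl := kst_lt hb pi n m t m x w.
  rewrite (bigD1 (Ordinal kl))//= indicE mem_set// mulr1 big1 ?addr0// => i' ni.
  by rewrite indicE memNset ?mulr0// => /= e; case/eqP: ni; apply/val_inj.
apply: measurable_funM => //; apply: measurable_funD.
  apply: measurable_sum => k; apply: measurable_funM => //.
  have h : sigR (rv_coord n m t) [set w | kst m x w = k].
    by apply: (sigR_sub _ (@ksig x k)) => q [pre -> _]; split.
  exact: (@measurable_indic _ (g_sigma_algebraType (gens K E (rv_coord n m t)))).
by apply: smf_sub (@smf_xi i) => q ->; split.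
Qed.

Lemma xi_prob (i : 'I_(b ^ m)) (B : set R) : measurable B -> P (xi n t i @^-1` B) = mu (B `&` unit_itv).
Proof. exact: (rand_xi_uniform hrand). Qed.

(** Given its first [m] digits, a scrambled point is uniform in the cell that
    they determine. *)
Lemma xi_cell_prob (i : 'I_(b ^ m)) k (A : set R) : (k < b ^ m)%N -> measurable A -> A `<=` cell m k ->
  P ((fun w => (k%:R + xi n t i w) / b%:R ^+ m) @^-1` A) = ((b%:R ^+ m)%:E * U A)%E.
Proof.
move=> km mA Ak.
pose phi (u : R) := (b%:R ^+ m)^-1 * u + k%:R / b%:R ^+ m.
have mphi : measurable_fun setT phi by apply: measurable_funD => //; apply: measurable_funM.
have -> : ((fun w => (k%:R + xi n t i w) / b%:R ^+ m) @^-1` A) = xi n t i @^-1` (phi @^-1` A).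
  apply/seteqP; split => w /=; have -> : phi (xi n t i w) = (k%:R + xi n t i w) / b%:R ^+ m => //.
    by rewrite /phi mulrDl addrC [X in _ = _ + X]mulrC.
  by rewrite /phi mulrDl addrC [X in _ = _ + X]mulrC.
rewrite xi_prob; last by rewrite -[X in measurable X]setTI; exact: mphi.
rewrite setIidl; last first.
  move=> u /= /Ak; rewrite (cellE hb km) /= in_itv/= /unit_itv /= in_itv/=.
  have -> : phi u = (k%:R + u) / b%:R ^+ m by rewrite /phi mulrDl addrC [X in _ = _ + X]mulrC.
  by rewrite !(ler_pM2r, ltr_pM2r) ?invr_gt0// -natr1 lerDl ltrD2l.
rewrite affine_lebesgue ?invr_gt0// invrK unif_lebesgue// setIidl// => x /Ak [+ _].
by rewrite /unit_itv /= in_itv.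
Qed.

Lemma kst_prob (x : R) (k : nat) : 0 <= x < 1 -> (k < b ^ m)%N -> prob [set w | kst m x w = k] = b%:R ^- m.
Proof.
move=> hx km; have := pair_prob hb hrand n t hx hx (leqnn m) km km.
rewrite setIid kap_same ?agreerr ?eqxx//; last by rewrite /same_lvl.
by move=> ->; rewrite mulr1; field; rewrite gt_eqF.
Qed.

Lemma measurable_kst (x : R) (k : nat) : measurable [set w | kst m x w = k].
Proof. exact: (rv_measurable hrand (@ksig x k)). Qed.

Lemma measurable_Ypt x i : measurable_fun setT (Ypt x i).
Proof. exact: (smf_measurable (rv_Em hrand) (@smf_Ypt x i)). Qed.

(** The scrambled digits are uniform by [kst_prob] and choose the cell; inside
    the cell the jitter, which is independent of them, is uniform. *)
Lemma Ypt_law (x : R) i (A : set R) : 0 <= x < 1 -> measurable A -> P (Ypt x i @^-1` A) = U A.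
Proof.
move=> hx mA.
pose A_ k := A `&` cell m k.
have mA_ k : measurable (A_ k) by apply: measurableI => //; exact: measurable_cell.
(* the event, split according to the cell of the point *)
pose Z_ (k : nat) := [set w | kst m x w = k] `&`
  ((fun w => (k%:R + xi n t i w) / b%:R ^+ m) @^-1` A_ k).
have mphi (k : nat) : measurable_fun setT (fun u : R => (k%:R + u) / b%:R ^+ m).
  by apply: measurable_funM => //; apply: measurable_funD.
have sxi k : sigR (ucoord i) ((fun w => (k%:R + xi n t i w) / b%:R ^+ m) @^-1` A_ k).
  have h := measurableT_comp (mphi k) (@smf_xi i).
  by have /smfP := h; apply.
have mZ k : measurable (Z_ k).
  by apply: measurableI; [exact: measurable_kst|exact: (rv_measurable hrand (sxi k))].
have inZ w (k : 'I_(b ^ m)) : (Z_ k w) <-> (kst m x w = k /\ A (Ypt x i w)).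
  rewrite /Z_ /A_ /= YptE; split=> [[-> [Aw _]]//|[e Aw]]; rewrite e in Aw; split => //; split => //.
  by split; [have := Ypt_itv x i w; rewrite YptE e|have := lvl_Ypt x i w; rewrite YptE e].
have mAY : measurable (Ypt x i @^-1` A) by rewrite -[X in measurable X]setTI; exact: measurable_Ypt.
have mAu : measurable (A `&` unit_itv : set R) by apply: measurableI => //; exact: measurable_unit_itv.
have -> : U A = U (A `&` unit_itv) by rewrite !unif_lebesgue// -setIA setIid.
rewrite -(fineP P mAY) -(fineP U mAu) -(Ex_indic P mAY).
rewrite (_ : \1_(_) = fun w => \sum_(k < b ^ m) \1_(Z_ k) w); last first.
  apply/funext => w; have kl := kst_lt hb pi n m t m x w.
  rewrite (bigD1 (Ordinal kl))//= big1 ?addr0; last first.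
    move=> k nk; rewrite indicE memNset// => /inZ[e _]; case/eqP: nk; exact/val_inj.
  rewrite !indicE; congr (_%:R : R); congr nat_of_bool; apply/idP/idP; rewrite !inE => h.
    by apply/(inZ w (Ordinal kl)).
  by have [_] := (inZ w (Ordinal kl)).1 h.
rewrite Ex_sum; last by move=> k _; exact: L1_indic.
congr (_%:E); transitivity (\sum_(k < b ^ m) fine (U (A_ k))).
  apply: eq_bigr => k _; rewrite Ex_indic//.
  rewrite (rv_prob hrand (S := perms n m t (fun=> True)) (S' := ucoord i)) //.
  - rewrite kst_prob// xi_cell_prob//; last by move=> ? [].
    have fin := fin_num_measure U _ (mA_ k).
    by rewrite fineM ?fin//= mulrA mulVf ?mul1r// gt_eqF.
  by move=> q [pre -> _].
rewrite -(Ex_indic U mAu) (_ : \1_(_) = fun x => \sum_(k < b ^ m) \1_(A_ k) x); last first.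
  apply/funext => y; have [hy|hy] := boolP (0 <= y < 1).
    rewrite (bigD1 (Ordinal (lvl_lt hb m hy)))//= big1 ?addr0; last first.
      move=> k nk; rewrite indicE memNset// => -[_ [_ e]]; case/eqP: nk; exact/val_inj.
    rewrite !indicE; congr (_%:R : R); congr nat_of_bool; apply/idP/idP; rewrite !inE.
      by move=> [Ay _]; split.
    by move=> [Ay _]; split => //; rewrite /unit_itv /= in_itv.
  rewrite indicE memNset; last by rewrite /unit_itv /= in_itv /= => -[_ h]; rewrite h in hy.
  by rewrite big1// => k _; rewrite indicE memNset// => -[_ [h _]]; rewrite h in hy.
rewrite Ex_sum; last by move=> k _; apply: L1_indic; exact: mA_.
by apply: eq_bigr => k _; rewrite Ex_indic//; exact: mA_.
Qed.

Lemma L2_Ypt (x : R) i f : 0 <= x < 1 -> uL2 f -> L2 P (fun w => f (Ypt x i w)).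
Proof.
move=> hx [hf _]; have law A := @Ypt_law x i A hx; exact: (@L2_law _ _ _ (measurableTypeR R) _ P U (Ypt x i) (@measurable_Ypt x i) law f hf).
Qed.

Lemma Ex_Ypt (x : R) i f : 0 <= x < 1 -> L1 U f -> Ex P (fun w => f (Ypt x i w)) = Ex U f.
Proof.
move=> hx hf; apply/esym; have law A := @Ypt_law x i A hx; exact: (@Ex_law _ _ _ (measurableTypeR R) _ P U (Ypt x i) (@measurable_Ypt x i) law f hf).
Qed.

(** The scrambled point, given that its first [m] digits form the integer
    [k]. *)
Definition jit (k : nat) (i : 'I_(b ^ m)) (w : Omega) : R := (k%:R + xi n t i w) / b%:R ^+ m.

Lemma smf_jit k i : smfR (ucoord i) (jit k i).
Proof.
have h : measurable_fun setT (fun u : R => (k%:R + u) / b%:R ^+ m).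
  by apply: measurable_funM => //; apply: measurable_funD.
exact: (measurableT_comp h (@smf_xi i)).
Qed.

Lemma jit_cell k i w : (k < b ^ m)%N -> cell m k (jit k i w).
Proof.
move=> km; rewrite (cellE hb km) /= in_itv/= /jit.
have /andP[x0 x1] := rand_xi_range hrand n t i w.
by rewrite !(ler_pM2r, ltr_pM2r) ?invr_gt0// -natr1 lerDl ltrD2l x0.
Qed.

Lemma L1_jit k i f : (k < b ^ m)%N -> uL2 f -> L1 P (fun w => f (jit k i w)).
Proof.
move=> km hf; have mj : measurable_fun setT (jit k i).
  exact: (smf_measurable (rv_Em hrand) (@smf_jit k i)).
have mf := hf.1.1.
apply/integrableP; split; first by apply/measurable_EFinP; exact: measurableT_comp.
pose h (x : measurableTypeR R) : \bar R := (`|f x|)%:E.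
have mh : measurable_fun setT h by apply/measurable_EFinP; exact: measurableT_comp.
have mC : measurable (cell m k) by exact: measurable_cell.
pose m2 : {measure set (measurableTypeR R) -> \bar R} := mscale (NngNum (ltW bX)) U.
pose j' : Omega -> measurableTypeR R := jit k i.
have e : (\int[P]_w h (jit k i w) = \int[pushforward P j']_(x in cell m k) h x)%E.
  rewrite ge0_integral_pushforward//.
  - by rewrite (_ : _ @^-1` _ = setT)//; apply/seteqP; split => // w _; exact: jit_cell.
  - exact: measurable_funTS.
  - by move=> x _; rewrite lee_fin.
rewrite [ltLHS]e (_ : (\int[_]_(x in _) _)%E = (\int[m2]_(x in cell m k) h x)%E); last first.
  by apply: (@eq_measure_integral _ (measurableTypeR R)) => A mA Ak; exact: xi_cell_prob.
rewrite (_ : (\int[m2]_(x in _) _)%E = ((b%:R ^+ m)%:E * \int[U]_(x in cell m k) h x)%E); last first.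
  apply: ge0_integral_mscale => //; last by move=> x _; rewrite lee_fin.
  exact: (measurable_funS measurableT _ mh).
apply: lte_mul_pinfty => //.
have /integrableP[_] := L2_L1 hf.1; apply: le_lt_trans.
apply: (@ge0_subset_integral _ _ _ U _ _ mC measurableT h mh) => //.
by move=> x _; rewrite lee_fin.
Qed.

(** The expectation over the cell [k] of any scrambled point factorizes into
    the probability of the cell and this expectation; on the other hand it is
    known from the law of the point. *)
Lemma Ex_jit k i f : (k < b ^ m)%N -> uL2 f ->
  Ex P (fun w => f (jit k i w)) = b%:R ^+ m * cint m k f.
Proof.
move=> km hf.
(* the digits of the auxiliary point are those of the scrambled origin *)
have h0 : 0 <= (0 : R) < 1 by rewrite lexx ltr01.
have hA := measurable_kst 0 k.
have m1 : smfR (perms n m t (fun=> True)) (\1_[set w | kst m (0 : R) w = k] : Omega -> R).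
  exact: (@smf_indic _ _ (@ksig (0 : R) k)).
have m2 : smfR (ucoord i) (fun w => f (jit k i w)) by exact: (measurableT_comp hf.1.1 (@smf_jit k i)).
have dis q : perms n m t (fun=> True) q -> ucoord i q -> False by move=> [pre -> _].
have [] := rv_indep_Ex dis m1 m2 (L1_indic P hA) (L1_jit i km hf).
move=> _; rewrite Ex_indic// kst_prob//.
rewrite (_ : (fun w => _) = fun w => (fun x => \1_(cell m k) x * f x) (Ypt 0 i w)); last first.
  apply/funext => w /=; rewrite !indicE.
  have ek : (Ypt 0 i w \in cell m k) = (w \in [set w | kst m (0 : R) w = k]).
    apply/idP/idP; rewrite !inE /=; first by move=> [_]; rewrite lvl_Ypt.
    by move=> e; split; [exact: Ypt_itv|rewrite lvl_Ypt].
  rewrite ek; case: (boolP (_ \in _)) => [|_]; last by rewrite !mul0r.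
  by rewrite inE /= => e; rewrite !mul1r /jit YptE e.
rewrite (Ex_Ypt i h0 (f := fun x => \1_(cell m k) x * f x)); last exact: L1_cint.
by rewrite -/(cint m k f) => ->; rewrite mulrA divff ?mul1r// gt_eqF.
Qed.

(** Decomposition over the values of the scrambled digits; each summand is a
    product of independent factors. *)
Lemma f_Ypt (f : R -> R) x i w : f (Ypt x i w) =
  \sum_(k < b ^ m) \1_[set w | kst m x w = k] w * f (jit k i w).
Proof.
have kl := kst_lt hb pi n m t m x w.
rewrite (bigD1 (Ordinal kl))//= indicE mem_set// mul1r big1 ?addr0; last first.
  by move=> k nk; rewrite indicE memNset ?mul0r// => /= e; case/eqP: nk; exact/val_inj.
by rewrite /jit YptE.
Qed.

(** Cells of level [m] in the same cell of level [j] are summed up to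
    integrals over the latter. *)
Lemma av_agree j (f g : R -> R) : (j <= m)%N -> uL2 f -> uL2 g ->
  \sum_(k < b ^ m) \sum_(k' < b ^ m) agree b m j k k' * (cint m k f * cint m k' g) = av b j f g.
Proof.
move=> jm hf hg; rewrite /av mulr_sumr.
have cr (h : R -> R) k : uL2 h -> cint j k h = \sum_(k' < b ^ m | (k' %/ b ^ (m - j) == k)%N) cint m k' h.
  by move=> hh; have := cint_refine hb j (m - j) k hh; rewrite subnKC.
have klt (k : 'I_(b ^ m)) : (k %/ b ^ (m - j) < b ^ j)%N.
  by rewrite ltn_divLR ?expn_gt0 ?b0// -expnD subnKC.
rewrite (partition_big (fun k => Ordinal (klt k)) xpredT)//=; apply: eq_bigr => q _.
rewrite (cr f)// (cr g)// mulr_suml mulr_sumr.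
apply: eq_big => [k|k /eqP/(congr1 val)/= ek]; first by rewrite -val_eqE.
rewrite !mulr_sumr [RHS]big_mkcond/=; apply: eq_bigr => k' _.
rewrite /agree ek (eq_sym (nat_of_ord q)); case: ifP => _ /=; ring.
Qed.

(** The digits of both points, the first jitter and the second jitter are
    independent. Given the digits the expectation is a product of integrals
    over cells, and [pair_prob] sums these up level by level. *)
Lemma pair_moment (x x' : R) (i i' : 'I_(b ^ m)) f g : 0 <= x < 1 -> 0 <= x' < 1 -> i != i' ->
  uL2 f -> uL2 g ->
  Ex P (fun w => f (Ypt x i w) * g (Ypt x' i' w)) =
  \sum_(j < m.+1) gam b x x' j * lev b m j f g.
Proof.
move=> hx hx' ii hf hg.
pose A (k k' : nat) := [set w | kst m x w = k] `&` [set w | kst m x' w = k'].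
have sA k k' : sigR (perms n m t (fun=> True)) (A k k') by apply: sigR_I; exact: ksig.
have mA k k' : measurable (A k k') by exact: (rv_measurable hrand (sA k k')).
have tri k k' : (k < b ^ m)%N -> (k' < b ^ m)%N ->
  L1 P (fun w => \1_(A k k') w * (f (jit k i w) * g (jit k' i' w))) /\
  Ex P (fun w => \1_(A k k') w * (f (jit k i w) * g (jit k' i' w))) =
    kap b x x' m k k' * (cint m k f * cint m k' g).
  move=> km km'.
  have dis : forall q, ucoord i q -> ucoord i' q -> False.
    by move=> q -> /unifix_inj e; rewrite e eqxx in ii.
  have mj k0 i0 h0 : uL2 h0 -> smfR (ucoord i0) (fun w => h0 (jit k0 i0 w)).
    by move=> h1; exact: (measurableT_comp h1.1.1 (@smf_jit k0 i0)).
  have [l1 e1] := rv_indep_Ex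
    dis (mj k i f hf) (mj k' i' g hg) (L1_jit i km hf) (L1_jit i' km' hg).
  have m1 : smfR (ucoord i `|` ucoord i') (fun w => f (jit k i w) * g (jit k' i' w)).
    apply: measurable_funM.
      by apply: smf_sub (mj k i f hf) => q; left.
    by apply: smf_sub (mj k' i' g hg) => q; right.
  have m2 : smfR (perms n m t (fun=> True)) (\1_(A k k') : Omega -> R).
    exact: (@smf_indic _ _ (sA k k')).
  have dis2 q : perms n m t (fun=> True) q -> (ucoord i `|` ucoord i') q -> False.
    by move=> [pre -> _] [|].
  have [l2 e2] := rv_indep_Ex
    dis2 m2 m1 (L1_indic P (mA k k')) l1.
  split => //; rewrite e2 e1 Ex_indic// !Ex_jit// (pair_prob hb hrand n t hx hx' (leqnn m) km km').
  by field; rewrite gt_eqF.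
rewrite (_ : (fun w => _) = fun w => \sum_(k < b ^ m) \sum_(k' < b ^ m)
   \1_(A k k') w * (f (jit k i w) * g (jit k' i' w))); last first.
  apply/funext => w; rewrite (f_Ypt f x) (f_Ypt g x') mulr_suml; apply: eq_bigr => k _.
  rewrite mulr_sumr; apply: eq_bigr => k' _; rewrite /A indicI /=; ring.
rewrite Ex_sum; last by move=> k _; apply: L1_sum => k' _; exact: (tri k k' _ _).1.
rewrite (eq_bigr (fun k : 'I_(b ^ m) => \sum_(k' < b ^ m) kap b x x' m k k' * (cint m k f * cint m k' g))); last first.
  move=> k _; rewrite Ex_sum; last by move=> k' _; exact: (tri k k' _ _).1.
  by apply: eq_bigr => k' _; exact: (tri k k' _ _).2.
transitivity (\sum_(j < m.+1) gam b x x' j * \sum_(k < b ^ m) \sum_(k' < b ^ m)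
    lagree b m j k k' * (cint m k f * cint m k' g)).
  under eq_bigr do under eq_bigr do rewrite /kap mulr_suml.
  under eq_bigr do rewrite exchange_big/=.
  rewrite exchange_big/=; apply: eq_bigr => j _; rewrite mulr_sumr; apply: eq_bigr => k _.
  by rewrite mulr_sumr; apply: eq_bigr => k' _; rewrite -mulrA.
apply: eq_bigr => j _; congr (_ * _); have jm : (j <= m)%N by rewrite -ltnS.
case: {+}j jm => -[|j'] ? /= jm; first by rewrite av_agree// /upto.
under eq_bigr do under eq_bigr do rewrite mulrBl.
under eq_bigr do rewrite sumrB.
by rewrite sumrB !av_agree// ?(ltnW jm)// /upto jm (ltnW jm).
Qed.

End Fixed.
End ScrambledCoordinate.

(** * Gain coefficients of a net *)

Section Net.
Context {R : realType}.
Variables b s m : nat.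
Hypothesis hb : (1 < b)%N.
Hypothesis hs : (0 < s)%N.
Variable p : 'I_(b ^ m) -> s.-tuple R.
Hypothesis p_inj : injective p.
Hypothesis p_net : is_net b m (range p).
Local Notation lvl := (@lvl R b).

Let b0 : (0 < b)%N. Proof. exact: ltnW. Qed.
Let bR : 0 < b%:R :> R. Proof. by rewrite ltr0n. Qed.
Let bR1 : 0 < b%:R - 1 :> R. Proof. by rewrite subr_gt0 ltr1n. Qed.

Lemma net_itv i t : 0 <= tnth (p i) t < 1.
Proof. by have [_ h _] := p_net; apply: (h (p i)); exists i. Qed.

Let net_ge0 i t : 0 <= tnth (p i) t. Proof. by have /andP[] := net_itv i t. Qed.

Definition inbox (J k : 'I_s -> nat) : pred 'I_(b ^ m) :=
  [pred i | [forall t, lvl (J t) (tnth (p i) t) == k t]].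

Lemma inbox_elementary J k i : (forall t, k t < b ^ J t)%N ->
  inbox J k i <-> elementary_interval b J k (p i).
Proof.
move=> kJ; split=> [/forallP h t|h].
  have : cell b (J t) (k t) (tnth (p i) t) by split; [exact: net_itv|apply/eqP].
  by rewrite (cellE hb (kJ t)) /= in_itv.
apply/forallP => t; have : cell b (J t) (k t) (tnth (p i) t).
  by rewrite (cellE hb (kJ t)) /= in_itv; exact: h.
by case=> _ /eqP.
Qed.

Lemma card_inbox1 J k : (forall t, k t < b ^ J t)%N -> (\sum_t J t = m)%N -> #|inbox J k| = 1%N.
Proof.
move=> kJ sJ; have [_ _ h] := p_net; have [|x [[[i _ ix] Ei] ux]] := h J k kJ.
  by under eq_bigr do rewrite -exprVn; rewrite prodrXr sJ exprVn.
rewrite -(card1 i); apply: eq_card => i'; rewrite inE.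
apply/idP/eqP => [hi|->]; last by apply/(inbox_elementary _ kJ); rewrite ix.
apply: p_inj; rewrite ix; apply/esym/ux; split; first by exists i'.
exact/(inbox_elementary _ kJ).
Qed.

(** Beyond the net property: a larger elementary interval is a union of
    [b ^ (m - |J|)] disjoint ones of volume [b ^ -m]. *)
Lemma card_inbox J k : (forall t, k t < b ^ J t)%N -> (\sum_t J t <= m)%N ->
  #|inbox J k| = (b ^ (m - \sum_t J t))%N.
Proof.
(* the missing r levels are all added in the first coordinate *)
move=> kJ sJ; set r := (m - _)%N; pose t0 := Ordinal hs.
pose J' t := (J t + (t == t0) * r)%N.
pose k' a t := (if t == t0 then k t * b ^ r + a else k t)%N.
have bX n : (0 < b ^ n)%N by rewrite expn_gt0 b0.
pose a_ i : 'I_(b ^ r) := Ordinal (ltn_pmod (lvl (J t0 + r) (tnth (p i) t0)) (bX r)).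
rewrite -sum1_card (partition_big a_ xpredT)//= -[RHS]card_ord -sum1_card.
apply: eq_bigr => a _; rewrite -[RHS](@card_inbox1 J' (k' a)); last 2 first.
- move=> t; rewrite /k' /J'; case: eqP => [->|_]; last by rewrite mul0n addn0.
  rewrite mul1n expnD; have := ltn_ord a; have := kJ t0; nia.
- have -> : (\sum_t J' t = \sum_t J t + \sum_t (t == t0) * r)%N by rewrite -big_split.
  have -> : (\sum_t (t == t0) * r = r)%N.
    by rewrite (bigD1 t0)// eqxx mul1n big1 => [|t /andP[_ /negPf ->]//]; exact: addn0.
  by rewrite subnKC.
rewrite -[RHS]sum1_card; apply: eq_bigl => i.
rewrite !inE -val_eqE /=; apply/andP/forallP => [[/forallP h /eqP e] t|h].
  rewrite /J' /k'; case: (eqVneq t t0) => [->|_]; last by rewrite mul0n addn0.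
  have := h t0; rewrite -(lvl_div hb (J t0) r (net_ge0 i t0)) => /eqP e'.
  by rewrite mul1n -e' -e -divn_eq.
have e0 := h t0; move: (e0); rewrite /J' /k' eqxx mul1n => /eqP ->.
rewrite modnMDl modn_small//; split => //; apply/forallP => t.
have := h t; rewrite /J' /k'; case: (eqVneq t t0) => [->|_]; last by rewrite mul0n addn0.
by rewrite mul1n -(lvl_div hb (J t0) r (net_ge0 i t0)) => /eqP ->; rewrite divnMDl// divn_small ?addn0.
Qed.

(** Decrease positive entries one by one. *)
Lemma shrink (J : 'I_s -> nat) : (m <= \sum_t J t)%N ->
  exists2 J' : 'I_s -> nat, (forall t, J' t <= J t)%N & (\sum_t J' t = m)%N.
Proof.
move: {2}(\sum_t J t - m)%N (leqnn (\sum_t J t - m)) => q; elim: q J => [|q IH] J hq hm.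
  by exists J => //; apply/eqP; rewrite eqn_leq hm andbT -subn_eq0 -leqn0.
have [e|ne] := eqVneq (\sum_t J t)%N m; first by exists J.
have /existsP[t0 Jt0] : [exists t, 0 < J t]%N.
  apply: contraT => /existsPn h.
  case/eqP: ne; apply/eqP; rewrite eqn_leq hm andbT big1// => t _.
  by have := h t; rewrite lt0n negbK => /eqP.
pose J1 t := (J t - (t == t0))%N.
have e : (\sum_t J t = (\sum_t J1 t).+1)%N.
  rewrite (bigD1 t0)// [in RHS](bigD1 t0)//= {1}/J1 eqxx.
  rewrite [in RHS](eq_bigr J); last by move=> t /negPf nt; rewrite /J1 nt subn0.
  lia.
have [||J' h1 h2] := IH J1; [lia|lia|].
by exists J' => // t; apply: leq_trans (h1 t) _; rewrite leq_subr.
Qed.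

(** A smaller elementary interval lies in one of volume [b ^ -m]. *)
Lemma card_inbox_le J k : (forall t, k t < b ^ J t)%N ->
  (#|inbox J k| <= b ^ (m - \sum_t J t))%N.
Proof.
move=> kJ; have [sJ|sJ] := leqP (\sum_t J t) m; first by rewrite card_inbox.
have [J' J'J sJ'] := shrink (ltnW sJ).
have -> : (m - \sum_t J t = 0)%N by apply/eqP; rewrite subn_eq0 ltnW.
pose k' t := (k t %/ b ^ (J t - J' t))%N.
rewrite expn0 -(@card_inbox1 J' k') => [|t|//]; last first.
  by rewrite ltn_divLR ?expn_gt0 ?b0// -expnD subnKC.
apply/subset_leq_card/fintype.subsetP => i; rewrite !inE => /forallP h; apply/forallP => t.
by rewrite /k' -(eqP (h t)) -(lvl_div hb (J' t) (J t - J' t) (net_ge0 i t)) subnKC.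
Qed.

Local Notation sm i i' t := (same_lvl b (tnth (p i) t) (tnth (p i') t)).

Lemma sum_same i (J : 'I_s -> nat) :
  \sum_i' \prod_t (sm i i' t (J t))%:R = #|inbox J (fun t => lvl (J t) (tnth (p i) t))|%:R :> R.
Proof.
rewrite -sum1_card natr_sum [RHS]big_mkcond; apply: eq_bigr => i' _; rewrite inE.
case: forallP => [h|h].
  by rewrite big1// => t _; rewrite /same_lvl (eqP (h t)) eqxx.
apply/eqP; rewrite prodf_seq_eq0 /=.
have /existsP[t nt] : [exists t, lvl (J t) (tnth (p i') t) != lvl (J t) (tnth (p i) t)].
  by apply: contra_notT h => /existsPn hn t; have := hn t; rewrite negbK.
by apply/hasP; exists t; rewrite ?mem_index_enum//= /same_lvl (eq_sym (lvl _ (tnth (p i) t))) (negPf nt).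
Qed.

(** Correlation of two points of the scrambled net at the levels [J]; the last
    level [m + 1] stands for what is left inside the cells of length [b^-m]. *)
Definition net_gam (j : nat) i i' t : R :=
  if (j <= m)%N then gam b (tnth (p i) t) (tnth (p i') t) j else (i == i')%:R.

(** The coefficient of the product of the levels [J] in the second moment of
    the rule, restricted to the pairs whose first point is the [i]-th one. *)
Definition net_gain (J : 'I_s -> nat) i : R := \sum_i' \prod_t net_gam (J t) i i' t.

Lemma net_gain0 J i : (\sum_t J t = 0)%N -> net_gain J i = b%:R ^+ m.
Proof.
move=> /eqP; rewrite sum_nat_eq0 => /forallP h.
rewrite /net_gain (eq_bigr (fun=> 1)); last first.
  by move=> i' _; rewrite big1// => t _; rewrite /net_gam (eqP (h t)).
by rewrite sumr_const card_ord natrX.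
Qed.

Let cf (j : nat) (v : bool) : R :=
  if j is _.+1 then (if v then - (b%:R - 1)^-1 else b%:R / (b%:R - 1)) else (~~ v)%:R.

(** Each correlation is a combination of the indicators of sharing [j] and
    [j - 1] digits. Expanding the product and counting points with
    [card_inbox], the sum over the net becomes the same as for independent
    uniform points, whose correlations vanish. *)
Lemma net_gain_low J i : (0 < \sum_t J t <= m)%N -> net_gain J i = 0.
Proof.
move=> /andP[J0 Jm].
have Jtm t : (J t <= m)%N by apply: leq_trans Jm; rewrite (bigD1 t)//= leq_addr.
have e j i' t : (j <= m)%N -> net_gam j i i' t = \sum_(v : bool) cf j v * (sm i i' t (j - v))%:R.
  rewrite /net_gam => ->; rewrite big_bool /=.
  case: j => [|j] /=; last by rewrite subn1 subn0 /=; field; rewrite gt_eqF.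
  by rewrite subnn /same_lvl !lvl0 ?net_itv// eqxx mul0r add0r mul1r.
rewrite /net_gain (eq_bigr (fun i' => \sum_(V : {ffun 'I_s -> bool})
    \prod_t (cf (J t) (V t) * (sm i i' t (J t - V t))%:R))); last first.
  by move=> i' _; rewrite (eq_bigr _ (fun t _ => e (J t) i' t (Jtm t))) bigA_distr_bigA.
rewrite exchange_big/=.
rewrite (eq_bigr (fun V : {ffun 'I_s -> bool} => b%:R ^+ m * \prod_t (cf (J t) (V t) * b%:R ^- (J t - V t)))); last first.
  move=> V _; under eq_bigr do rewrite big_split/=.
  rewrite -mulr_sumr (sum_same i (fun t => J t - V t)%N) big_split/= mulrCA; congr (_ * _).
  have le : (\sum_t (J t - V t) <= m)%N by apply: leq_trans Jm; apply: leq_sum => t _; exact: leq_subr.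
  rewrite card_inbox//; last by move=> t; apply: lvl_lt => //; exact: net_itv.
  rewrite (eq_bigr (fun t => b%:R^-1 ^+ (J t - V t))) => [|t _]; last by rewrite exprVn.
  by rewrite prodrXr exprVn natrX exprB// unitfE gt_eqF.
rewrite -mulr_sumr -(bigA_distr_bigA (fun t v => cf (J t) v * b%:R ^- (J t - v))).
(* a coordinate with J t = j > 0 gives b / (b - 1) * b ^ -j - 1 / (b - 1) * b ^ -(j - 1) = 0 *)
apply/eqP; rewrite mulf_eq0; apply/orP; right.
have /existsP[t Jt] : [exists t, 0 < J t]%N.
  apply: contraT => /existsPn h.
  by move: J0; rewrite big1// => t _; have := h t; rewrite lt0n negbK => /eqP.
rewrite prodf_seq_eq0; apply/hasP; exists t; rewrite ?mem_index_enum//= big_bool.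
case: (J t) Jt => [//|j] _ /=; rewrite subn1 subn0 /= exprS; apply/eqP; field.
by rewrite !gt_eqF// exprn_gt0.
Qed.

(** A correlation vanishes unless the points share all digits but possibly the
    last, and its size is at most [1 / (b - 1) <= 1] if they differ there. *)
Lemma net_gam_abs j i i' t : `|net_gam j i i' t| <= (sm i i' t j.-1)%:R.
Proof.
rewrite /net_gam; case: ifP => _; last first.
  by case: eqP => [->|_]; rewrite ?normr0// /same_lvl eqxx normr1.
have hi := net_itv i t; have hi' := net_itv i' t.
case: j => [|j]; first by rewrite /= /same_lvl !lvl0// eqxx normr1.
have [h1|h1] := boolP (sm i i' t j.+1); first by rewrite (gam1 hb hi hi' h1) normr1 /= (same_lvlS hb hi hi' h1).
have [h0|h0] := boolP (sm i i' t j); last by rewrite (gam0 hb hi hi' h0) normr0.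
rewrite /= (negPf h1) h0 mulr0 sub0r mulN1r normrN ger0_norm ?invr_ge0 ?(ltW bR1)//.
by rewrite invf_le1// lerBrDr -[1 + 1]/(2%:R) ler_nat.
Qed.

(** By [net_gam_abs] only the points that share [J t - 1] digits in each
    coordinate contribute, and there are at most [b ^ s] of them. *)
Lemma net_gain_high J i : (m < \sum_t J t)%N -> `|net_gain J i| <= b%:R ^+ s.
Proof.
move=> mJ; apply: (@le_trans _ _ (\sum_i' \prod_t (sm i i' t (J t).-1)%:R)).
  apply: le_trans (ler_norm_sum _ _ _) _; apply: ler_sum => i' _.
  by rewrite normr_prod; apply: ler_prod => t _; rewrite normr_ge0 net_gam_abs.
(* lowering each level by one lowers the size by at most s *)
rewrite (sum_same i (fun t => (J t).-1)) -natrX ler_nat.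
apply: leq_trans (card_inbox_le _) _; first by move=> t; apply: lvl_lt => //; exact: net_itv.
rewrite leq_exp2l// leq_subLR; apply: leq_trans (ltnW mJ) _.
rewrite -[X in (_ <= _ + X)%N]card_ord -sum1_card -big_split/=; apply: leq_sum => t _; lia.
Qed.

End Net.

(** * Covariances of one scrambled net rule *)

Section Block.
Context {R : realType} {d0 : measure_display} {Omega : measurableType d0}.
Variable P : probability Omega R.
Variables b s d : nat.
Hypothesis hb : (1 < b)%N.
Hypothesis hs : (0 < s)%N.
Variable pi : 'I_d -> nat -> 'I_s -> seq 'I_b -> Omega -> {perm 'I_b}.
Variable xi : 'I_d -> forall m : nat, 'I_s -> 'I_(b ^ m) -> Omega -> R.
Hypothesis hrand : independently_randomized P pi xi.
Local Notation U := (@unif R).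
Local Notation K := (@rv_used b s d).
Local Notation E := (rv_events pi xi).
Local Notation smfR := (smf K E).

Let bR : 0 < b%:R :> R. Proof. by rewrite ltr0n ltnW. Qed.

Lemma rv_prod_L1 (J : finType) (S : J -> set (rv_ix b s d)) (X : J -> Omega -> R) :
  (forall i j q, S i q -> S j q -> i = j) ->
  (forall j, smfR (S j) (X j)) -> (forall j, L1 P (X j)) ->
  L1 P (fun w => \prod_j X j w) /\ Ex P (fun w => \prod_j X j w) = \prod_j Ex P (X j).
Proof.
move=> dis mX hX.
have [_ l e] := smf_prod_indep (rv_Em hrand) (@rv_EI _ _ _ _ _ _ pi xi) (@rv_ET _ _ _ _ _ _ pi xi)
  (rv_Eind hrand) (index_enum_uniq J) dis mX hX.
by split.
Qed.

Lemma rv_prod_L2 (J : finType) (S : J -> set (rv_ix b s d)) (X : J -> Omega -> R) :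
  (forall i j q, S i q -> S j q -> i = j) ->
  (forall j, smfR (S j) (X j)) -> (forall j, L2 P (X j)) -> L2 P (fun w => \prod_j X j w).
Proof.
move=> dis mX hX; split; first by apply: measurable_prod => j _; exact: (hX j).1.
have mX2 j : smfR (S j) (fun w => X j w ^+ 2) by apply: measurable_funX; exact: mX.
have [+ _] := rv_prod_L1 dis mX2 (fun j => (hX j).2).
by rewrite (_ : (fun w => _) = fun w => (\prod_j X j w) ^+ 2)//; apply/funext => w; rewrite prodrXl.
Qed.

Variables (n : 'I_d) (m : nat).
Variable p : 'I_(b ^ m) -> s.-tuple R.
Hypothesis p_inj : injective p.
Hypothesis p_net : is_net b m (range p).

Let bX : 0 < b%:R ^+ m :> R. Proof. exact: bX_gt0. Qed.
Let pin := net_itv p_net.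
Local Notation Y i t := (Ypt hb pi xi n t (tnth (p i) t) i).

Definition rv_block : set (rv_ix b s d) := [set q | match q with
  | PermIx n' m' _ _ => n' = n /\ m' = m
  | UnifIx n' m' _ _ => n' = n /\ m' = m end].

(** The scrambled net rule, applied to the tensor product of the [f t]. *)
Definition net_rule (f : 'I_s -> R -> R) (w : Omega) : R :=
  b%:R ^- m * \sum_i \prod_t f t (Y i t w).

Lemma rv_coord_dis (t t' : 'I_s) (q : rv_ix b s d) : rv_coord n m t q -> rv_coord n m t' q -> t = t'.
Proof. by case: q => [n1 m1 t1 pre|n1 m1 t1 i] [_ _ <-] [_ _ <-]. Qed.

Let smfY i t (f : R -> R) : measurable_fun setT f -> smfR (rv_coord n m t) (fun w => f (Y i t w)).
Proof. by move=> mf; exact: (measurableT_comp mf (@smf_Ypt _ _ _ _ _ _ hb pi xi n m t _ i)). Qed.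

Section OneFunction.
Variable f : 'I_s -> R -> R.
Hypothesis hf : forall t, uL2 (f t).

Let L2Y i t : L2 P (fun w => f t (Y i t w)).
Proof. by apply: (L2_Ypt hb hrand) => //; exact: pin. Qed.

Lemma smf_net_rule : smfR rv_block (net_rule f).
Proof.
apply: measurable_funM => //; apply: measurable_sum => i; apply: measurable_prod => t _.
apply: smf_sub (smfY i (hf t).1.1).
by case=> [n1 m1 t1 pre|n1 m1 t1 i1] [].
Qed.

Lemma net_point_L2 i : L2 P (fun w => \prod_t f t (Y i t w)).
Proof. by apply: (rv_prod_L2 rv_coord_dis) => t //; exact: smfY (hf t).1.1. Qed.

Lemma L2_net_rule : L2 P (net_rule f).
Proof. by apply: L2Z; apply: L2_sum => i _; exact: net_point_L2. Qed.

Lemma Ex_net_rule : Ex P (net_rule f) = \prod_t Ex U (f t).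
Proof.
rewrite /net_rule ExZ; last by apply: L1_sum => i _; exact: L2_L1 (net_point_L2 i).
rewrite Ex_sum; last by move=> i _; exact: L2_L1 (net_point_L2 i).
transitivity (b%:R ^- m * \sum_(i < b ^ m) \prod_t Ex U (f t) : R).
  congr (_ * _); apply: eq_bigr => i _.
  have sm t : smfR (rv_coord n m t) (fun w => f t (Y i t w)) by exact: smfY (hf t).1.1.
  have [_ ->] := rv_prod_L1 rv_coord_dis sm (fun t => L2_L1 (L2Y i t)).
  by apply: eq_bigr => t _; rewrite (Ex_Ypt hb hrand) ?pin//; exact: L2_L1 (hf t).1.
by rewrite sumr_const card_ord -[X in _ * X]mulr_natl natrX mulrA mulVf ?mul1r// gt_eqF.
Qed.

End OneFunction.

Section TwoFunctions.
Variables f g : 'I_s -> R -> R.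
Hypothesis hf : forall t, uL2 (f t).
Hypothesis hg : forall t, uL2 (g t).

(** For two distinct points this is [pair_moment], without the finest level.
    For [i = i'] it is the expectation of [f g], in which every level has
    coefficient 1. *)
Lemma coord_moment i i' t : Ex P (fun w => f t (Y i t w) * g t (Y i' t w)) =
  \sum_(j < m.+2) net_gam p j i i' t * lev b m j (f t) (g t).
Proof.
have [<-|ne] := eqVneq i i'; last first.
  rewrite (pair_moment hb hrand) ?pin// [RHS]big_ord_recr /= /net_gam ltnn (negPf ne) mul0r addr0.
  by apply: eq_bigr => j _; rewrite -ltnS ltn_ord.
have lfg : L1 U (fun x => f t x * g t x) by exact: L2_mul (hf t).1 (hg t).1.
have e := @Ex_Ypt _ _ _ P b s d hb pi xi hrand n m t (tnth (p i) t) i (fun x => f t x * g t x) (pin i t) lfg.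
rewrite [LHS]e.
have -> : Ex U (fun x => f t x * g t x) = upto b m m.+1 (f t) (g t) by rewrite /upto ltnn.
rewrite upto_sum; apply: eq_bigr => j _; rewrite /net_gam eqxx.
by case: ifP => _; rewrite ?gam1 ?mul1r ?pin// /same_lvl eqxx.
Qed.

(** The coordinates of a pair of points are independent of each other, so the
    expectation is a product over the coordinates of sums over the levels. *)
Lemma net_moment : Ex P (fun w => net_rule f w * net_rule g w) =
  \sum_(J : {ffun 'I_s -> 'I_m.+2}) (b%:R ^+ m) ^- 2 * (\sum_i net_gain p (fun t => nat_of_ord (J t)) i) *
     \prod_t lev b m (J t) (f t) (g t).
Proof.
have l2 i i' t : L1 P (fun w => f t (Y i t w) * g t (Y i' t w)).
  by apply: L2_mul; apply: (L2_Ypt hb hrand) => //; exact: pin.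
have sm i i' t : smfR (rv_coord n m t) (fun w => f t (Y i t w) * g t (Y i' t w)).
  by apply: measurable_funM; exact: smfY (hf t).1.1 || exact: smfY (hg t).1.1.
have lp i i' := rv_prod_L1 rv_coord_dis (sm i i') (l2 i i').
rewrite (_ : (fun w => _) = fun w => (b%:R ^+ m) ^- 2 * \sum_i \sum_i' \prod_t
    (f t (Y i t w) * g t (Y i' t w))); last first.
  apply/funext => w; rewrite /net_rule mulrACA -invfM -expr2; congr (_ * _).
  rewrite mulr_suml; apply: eq_bigr => i _; rewrite mulr_sumr; apply: eq_bigr => i' _.
  by rewrite big_split.
rewrite ExZ; last by apply: L1_sum => i _; apply: L1_sum => i' _; exact: (lp i i').1.
rewrite Ex_sum; last by move=> i _; apply: L1_sum => i' _; exact: (lp i i').1.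
under [RHS]eq_bigr do rewrite -mulrA mulr_suml.
rewrite -mulr_sumr exchange_big/=; congr (_ * _); apply: eq_bigr => i _.
rewrite Ex_sum; last by move=> i' _; exact: (lp i i').1.
rewrite (eq_bigr (fun i' => \sum_(J : {ffun 'I_s -> 'I_m.+2}) \prod_t
    (net_gam p (J t) i i' t * lev b m (J t) (f t) (g t)))); last first.
  move=> i' _; rewrite (lp i i').2; under eq_bigr do rewrite coord_moment.
  by rewrite (bigA_distr_bigA (fun t (j : 'I_m.+2) => net_gam p j i i' t * lev b m j (f t) (g t))).
rewrite exchange_big/=; apply: eq_bigr => J _.
by rewrite /net_gain mulr_suml; apply: eq_bigr => i' _; rewrite big_split.
Qed.

Definition net_weight (J : {ffun 'I_s -> 'I_m.+2}) : R := (b%:R ^+ m) ^- 2 * \sum_i net_gain p (fun t => nat_of_ord (J t)) i.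

Lemma net_cov : Ex P (fun w => (net_rule f w - \prod_t Ex U (f t)) * (net_rule g w - \prod_t Ex U (g t))) =
  \sum_(J : {ffun 'I_s -> 'I_m.+2} | (0 < \sum_t J t)%N) net_weight J * \prod_t lev b m (J t) (f t) (g t).
Proof.
set A := \prod_t Ex U (f t); set B := \prod_t Ex U (g t).
have Lf := L2_net_rule hf; have Lg := L2_net_rule hg.
have L1f := L2_L1 Lf; have L1g := L2_L1 Lg.
rewrite (_ : (fun w => _) = fun w => net_rule f w * net_rule g w +
    (- B * net_rule f w + (- A * net_rule g w + A * B))); last by apply/funext => w; ring.
have lc : L1 P (fun=> A * B) by exact: L1_cst.
have l1 : L1 P (fun w => - A * net_rule g w + A * B) by apply: L1D => //; exact: L1Z.
have l2 : L1 P (fun w => - B * net_rule f w + (- A * net_rule g w + A * B)).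
  by apply: L1D => //; exact: L1Z.
rewrite ExD//; last exact: L2_mul.
rewrite ExD//; last exact: L1Z.
rewrite ExD//; last exact: L1Z.
rewrite (ExZ _ L1f) (ExZ _ L1g) Ex_cst (Ex_net_rule hf) (Ex_net_rule hg) -/A -/B.
(* the term with J = 0 is the product of the means *)
rewrite net_moment (bigID (fun J : {ffun 'I_s -> 'I_m.+2} => (0 < \sum_t J t)%N))/= -[RHS]addr0 -addrA.
congr (_ + _); rewrite (big_pred1 [ffun=> ord0]); last first.
  move=> J; rewrite -leqNgt leqn0 sum_nat_eq0.
  apply/forallP/eqP => [h|-> t]; last by rewrite ffunE.
  by apply/ffunP => t; apply/val_inj; rewrite ffunE /=; apply/eqP; exact: h.
have s0 : (\sum_t ([ffun=> ord0] : {ffun 'I_s -> 'I_m.+2}) t = 0)%N by rewrite big1// => t _; rewrite ffunE.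
rewrite (eq_bigr (fun=> b%:R ^+ m)); last by move=> i _; exact: net_gain0.
rewrite (eq_bigr (fun t => Ex U (f t) * Ex U (g t))); last first.
  by move=> t _; rewrite ffunE /= /upto /= av0.
rewrite big_split/= -/A -/B sumr_const card_ord -[X in _ * X * _]mulr_natl natrX.
by move: bX; set x := b%:R ^+ m => x0; field; rewrite gt_eqF.
Qed.

End TwoFunctions.

Variable alpha : R.
Hypothesis alpha0 : 0 < alpha.
Local Notation B := (b%:R `^ (2 * alpha)).

(** By [net_gain_low] only the multi-indices of size greater than [m] count,
    so that a factor [B ^ (|J| - (m + 1)) >= 1] can be inserted. *)
Lemma net_weight_le (J : {ffun 'I_s -> 'I_m.+2}) : (0 < \sum_t J t)%N ->
  net_weight J <= b%:R ^+ s / b%:R ^+ m * B ^- m.+1 * B ^+ \sum_t J t.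
Proof.
move=> J0; have B1 : 1 <= B := B_ge1 hb alpha0; have B0 : 0 < B := lt_le_trans ltr01 B1.
have [Jm|mJ] := leqP (\sum_t J t) m.
  rewrite /net_weight big1 ?mulr0; last by move=> i _; apply: (net_gain_low hb hs p_inj p_net); rewrite J0.
  by rewrite !mulr_ge0 ?invr_ge0 ?exprn_ge0 ?(ltW B0) ?(ltW bX) ?(ltW bR).
apply: (@le_trans _ _ (b%:R ^+ s / b%:R ^+ m)); last first.
  rewrite -mulrA ler_peMr ?divr_ge0 ?exprn_ge0 ?(ltW bR)//.
  by rewrite mulrC ler_pdivlMr ?exprn_gt0// mul1r ler_weXn2l.
rewrite /net_weight; apply: (@le_trans _ _ ((b%:R ^+ m) ^- 2 * \sum_(i < b ^ m) b%:R ^+ s)).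
  apply: ler_wpM2l; first by rewrite invr_ge0 exprn_ge0// ltW.
  apply: ler_sum => i _; apply: le_trans (ler_norm _) _.
  exact: (net_gain_high hb hs p_inj p_net).
rewrite sumr_const card_ord -[X in _ * X <= _]mulr_natl natrX le_eqVlt; apply/orP; left; apply/eqP.
by move: bX; set x := b%:R ^+ m => x0; field; rewrite gt_eqF.
Qed.

(** The quadratic form of a covariance matrix is the expectation of a
    square. *)
Lemma net_cov_psd N (f : 'I_N -> 'I_s -> R -> R) : (forall a t, uL2 (f a t)) ->
  psd (fun a a' => Ex P (fun w => (net_rule (f a) w - \prod_t Ex U (f a t)) *
                                  (net_rule (f a') w - \prod_t Ex U (f a' t)))).
Proof.
move=> hf; set Z := fun a w => net_rule (f a) w - \prod_t Ex U (f a t).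
have LZ a : L2 P (Z a) by apply: L2D; [exact: L2_net_rule|exact: L2_cst].
split=> [a a'|x]; first by congr (Ex P _); apply/funext => w; rewrite mulrC.
have -> : quad (fun a a' => Ex P (fun w => Z a w * Z a' w)) x = Ex P (fun w => (\sum_a x a * Z a w) ^+ 2).
  rewrite (_ : (fun w => _ ^+ 2) = fun w => \sum_a \sum_a' x a * x a' * (Z a w * Z a' w)); last first.
    apply/funext => w; rewrite expr2 mulr_suml; apply: eq_bigr => a _; rewrite mulr_sumr.
    by apply: eq_bigr => a' _; ring.
  have l a a' : L1 P (fun w => x a * x a' * (Z a w * Z a' w)) by apply: L1Z; exact: L2_mul.
  rewrite Ex_sum; last by move=> a _; apply: L1_sum => a' _; exact: l.
  apply: eq_bigr => a _; rewrite Ex_sum; last by move=> a' _; exact: l.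
  by apply: eq_bigr => a' _; rewrite ExZ//; exact: L2_mul.
by apply: Ex_ge0 => w; exact: sqr_ge0.
Qed.

(** The products of the levels are positive semidefinite, so enlarging their
    coefficients enlarges the matrix; with the coefficients of [net_weight_le]
    the sum over all multi-indices factorizes. *)
Lemma net_cov_le N (f : 'I_N -> 'I_s -> R -> R) : (forall a t, uL2 (f a t)) ->
  psd_le (fun a a' => Ex P (fun w => (net_rule (f a) w - \prod_t Ex U (f a t)) *
                                  (net_rule (f a') w - \prod_t Ex U (f a' t))))
    (fun a a' => b%:R ^+ s / b%:R ^+ m * B ^- m.+1 * \prod_t henergy b alpha m (f a t) (f a' t)).
Proof.
move=> hf; have B0 : 0 < B := lt_le_trans ltr01 (B_ge1 hb alpha0).
pose c := b%:R ^+ s / b%:R ^+ m * B ^- m.+1.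
have c0 : 0 <= c by rewrite /c !mulr_ge0 ?invr_ge0 ?exprn_ge0 ?(ltW B0) ?(ltW bX) ?(ltW bR).
pose M (J : {ffun 'I_s -> 'I_m.+2}) (a a' : 'I_N) := \prod_t lev b m (J t) (f a t) (f a' t).
have pM J : psd (M J) by apply: psd_prod => t _; exact: lev_psd.
rewrite (_ : (fun a a' => Ex _ _) = fun a a' => \sum_(J : {ffun 'I_s -> 'I_m.+2} | (0 < \sum_t J t)%N) net_weight J * M J a a'); last first.
  by apply/funext => a; apply/funext => a'; rewrite net_cov.
rewrite (_ : (fun a a' => c * _) = fun a a' => \sum_(J : {ffun 'I_s -> 'I_m.+2}) c * B ^+ (\sum_t J t) * M J a a'); last first.
  apply/funext => a; apply/funext => a'; rewrite /henergy.
  rewrite (bigA_distr_bigA (fun t (j : 'I_m.+2) => B ^+ j * lev b m j (f a t) (f a' t))) mulr_sumr.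
  by apply: eq_bigr => J _; rewrite big_split/= prodrXr mulrA.
under [X in psd_le X]eq_fun do under eq_fun do rewrite big_mkcond.
apply: psd_le_sum => J _; case: (ltnP 0 (\sum_t J t)) => J0.
  by apply: psd_le_coef => //; exact: net_weight_le.
rewrite /psd_le; under eq_fun do under eq_fun do rewrite subr0.
by apply: psdZ => //; rewrite mulr_ge0// exprn_ge0// ltW.
Qed.

End Block.

(** * Product quadrature rules and the algebra of the Smolyak sum *)

Section ProductRules.
Context {R : realType}.

Lemma bigA_distr_dffun (I : finType) (T : I -> finType) (F : forall i, T i -> R) :
  \sum_(c : {dffun forall i, T i}) \prod_i F i (c i) = \prod_i \sum_(j : T i) F i j.
Proof.
rewrite (reindex (@dffun_of_fprod I T)) /=; last exact/onW_bij/dffun_of_fprod_bij.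
rewrite (eq_bigr (fun t : fprod T => \prod_(i in I) ([ffun j => F i j] : {ffun T i -> R}) (t i))); last first.
  by move=> t _; apply: eq_bigr => i _; rewrite !ffunE.
rewrite big_fprod /=.
rewrite [RHS](eq_bigr (fun i => \sum_(j in tagged_with T i) untag 0 ([ffun j => F i j] : {ffun T i -> R}) j)); last first.
  move=> i _; transitivity (\sum_(j : T i) ([ffun j => F i j] : {ffun T i -> R}) j).
    by apply: eq_bigr => j _; rewrite ffunE.
  exact: (@big_tag _ _ _ I T (fun i => ([ffun j => F i j] : {ffun T i -> R})) i).
by rewrite bigA_distr_big_dep; apply: eq_bigl => f; rewrite !inE.
Qed.

Section Blocks.
Variables s d : nat.

Lemma join_proof (n : 'I_d) (t : 'I_s) : (n * s + t < s * d)%N.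
Proof. by have := ltn_ord n; have := ltn_ord t; nia. Qed.

Definition join_ix (n : 'I_d) (t : 'I_s) : 'I_(s * d) := Ordinal (join_proof n t).

Definition block_ix (t : 'I_(s * d)) : 'I_d := Ordinal (block_proof t).
Definition coord_ix (t : 'I_(s * d)) : 'I_s := Ordinal (coord_proof t).

Lemma join_ixK t : join_ix (block_ix t) (coord_ix t) = t.
Proof. by apply/val_inj; rewrite /= -divn_eq. Qed.

Lemma block_join n t : block_ix (join_ix n t) = n.
Proof.
apply/val_inj => /=; have s0 : (0 < s)%N by case: (posnP s) t => [->|//] [].
by rewrite divnMDl// divn_small ?addn0.
Qed.

Lemma coord_join n t : coord_ix (join_ix n t) = t.
Proof. by apply/val_inj => /=; rewrite modnMDl modn_small. Qed.

Lemma prod_blocks (F : 'I_(s * d) -> R) : \prod_t F t = \prod_n \prod_t F (join_ix n t).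
Proof.
rewrite pair_bigA /= (reindex (fun u : 'I_d * 'I_s => join_ix u.1 u.2))//=.
exists (fun t => (block_ix t, coord_ix t)) => [[n t] _|t _] /=; last exact: join_ixK.
by rewrite block_join coord_join.
Qed.

Lemma tnth_join (y : 'I_d -> s.-tuple R) n t : tnth (join_blocks y) (join_ix n t) = tnth (y n) t.
Proof.
rewrite tnth_mktuple -[Ordinal (block_proof _)]/(block_ix _) -[Ordinal (coord_proof _)]/(coord_ix _).
by rewrite block_join coord_join.
Qed.

Lemma q_eval_tensor (q : 'I_d -> qrule (R := R) (s.-tuple R)) (h : 'I_(s * d) -> R -> R) :
  q_eval (q_tensor q) (fun x => \prod_t h t (tnth x t)) =
  \prod_n q_eval (q n) (fun y => \prod_t h (join_ix n t) (tnth y t)).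
Proof.
rewrite /q_eval /= -(bigA_distr_dffun (fun n (i : q_ix (q n)) =>
  q_weight i * \prod_t h (join_ix n t) (tnth (q_node i) t))).
apply: eq_bigr => c _; rewrite big_split/=; congr (_ * _).
by rewrite prod_blocks; apply: eq_bigr => n _; apply: eq_bigr => t _; rewrite tnth_join.
Qed.

End Blocks.

Lemma q_eval_sub T (q r : qrule (R := R) T) (f : T -> R) : q_eval (q_sub q r) f = q_eval q f - q_eval r f.
Proof.
rewrite /q_eval /= big_sumType /=; congr (_ + _); rewrite -sumrN.
by apply: eq_bigr => i _; rewrite mulNr.
Qed.

Lemma q_eval_sum T (q : qrule (R := R) T) N (f : 'I_N -> T -> R) :
  q_eval q (fun x => \sum_a f a x) = \sum_a q_eval q (f a).
Proof. by rewrite exchange_big/=; apply: eq_bigr => c _; rewrite mulr_sumr. Qed.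

Lemma smolyak_sum s d (U : 'I_d -> nat -> qrule (R := R) (s.-tuple R)) L N (f : 'I_N -> (s * d).-tuple R -> R) :
  smolyak U L (fun x => \sum_a f a x) = \sum_a smolyak U L (f a).
Proof. by rewrite exchange_big/=; apply: eq_bigr => l _; rewrite q_eval_sum. Qed.

Lemma smolyakB s d (U : 'I_d -> nat -> qrule (R := R) (s.-tuple R)) L (f g : (s * d).-tuple R -> R) :
  smolyak U L (fun x => f x - g x) = smolyak U L f - smolyak U L g.
Proof.
rewrite /smolyak -sumrB; apply: eq_bigr => l _; rewrite /q_eval -sumrB.
by apply: eq_bigr => c _; rewrite mulrBr.
Qed.

(** The Smolyak sum in terms of the errors [V n k - c n] of the building
    blocks; the exact values [c n] play the role of level 0. *)
Lemma smolyak_expand d L (V : 'I_d -> nat -> R) (c : 'I_d -> R) : (forall n, V n 0%N = 0) ->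
  \sum_(l : {ffun 'I_d -> 'I_L.+1} | smolyak_ix l) \prod_n (V n (l n) - V n (l n).-1) =
  \sum_(K : {ffun 'I_d -> 'I_L.+1}) smolyak_coef L (fun n => K n : nat) *
    \prod_n (if K n == 0%N :> nat then c n else V n (K n) - c n).
Proof.
move=> V0; pose X n k := if k == 0%N then c n else V n k - c n.
transitivity (\sum_(l : {ffun 'I_d -> 'I_L.+1} | smolyak_ix l) \sum_(K : {ffun 'I_d -> 'I_L.+1})
    \prod_n (delta_coef (l n) (K n) * X n (K n))).
  apply: eq_bigr => l /andP[/forallP l0 _].
  rewrite -(bigA_distr_bigA (fun n (k : 'I_L.+1) => delta_coef (l n) k * X n k)).
  apply: eq_bigr => n _; have := l0 n; have lL := ltn_ord (l n).
  move: (nat_of_ord (l n)) lL => [//|v] lL _ /=.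
  transitivity (\sum_(0 <= k < L.+1) delta_coef v.+1 k * X n k : R); last by rewrite big_mkord.
  rewrite (big_cat_nat (n := v.+2))//= [X in _ = _ + X]big1_seq ?addr0; last first.
    move=> k; rewrite mem_index_iota => /andP[_ /andP[kv _]].
    case: k kv => [//|k] kv; rewrite /delta_coef.
    rewrite (_ : (v.+1 == k.+1)%N = false); last by apply/negbTE; lia.
    by rewrite (_ : (v.+1 == k.+2)%N = false) ?subrr ?mul0r//; apply/negbTE; lia.
  rewrite big_nat_recr//= big_nat_recr//= big1_seq ?add0r; last first.
    move=> k; rewrite mem_index_iota => /andP[_ /andP[_ kv]].
    case: k kv => [|k] kv; rewrite /delta_coef.
      by rewrite (_ : (v.+1 == 1)%N = false) ?mul0r//; apply/negbTE; lia.
    rewrite (_ : (v.+1 == k.+1)%N = false); last by apply/negbTE; lia.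
    by rewrite (_ : (v.+1 == k.+2)%N = false) ?subrr ?mul0r//; apply/negbTE; lia.
  rewrite eqxx (_ : (v.+1 == v.+2)%N = false) ?subr0 ?mul1r; last by apply/negbTE; lia.
  case: v lL => [|v] lL /=; first by rewrite V0 /X /=; ring.
  rewrite eqxx (_ : (v.+2 == v.+1)%N = false); last by apply/negbTE; lia.
  by rewrite /X /=; ring.
rewrite exchange_big/=; apply: eq_bigr => K _.
by rewrite /smolyak_coef mulr_suml; apply: eq_bigr => l _; rewrite big_split.
Qed.

End ProductRules.

(** * The mean square error on finite tensors *)

Section SmolyakTensor.
Context {R : realType} {d0 : measure_display} {Omega : measurableType d0}.
Variable P : probability Omega R.
Variables b s d : nat.
Hypothesis hb : (1 < b)%N.
Hypothesis hs : (0 < s)%N.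
Variable p : forall (n : 'I_d) (m : nat), 'I_(b ^ m) -> s.-tuple R.
Hypothesis hp_inj : forall n m, injective (p n (m:=m)).
Hypothesis hp_net : forall n m, is_net b m (range (p n (m:=m))).
Variable pi : 'I_d -> nat -> 'I_s -> seq 'I_b -> Omega -> {perm 'I_b}.
Variable xi : 'I_d -> forall m : nat, 'I_s -> 'I_(b ^ m) -> Omega -> R.
Hypothesis hrand : independently_randomized P pi xi.
Variables (alpha : R) (ip : (R -> R) -> (R -> R) -> R).
Hypothesis alpha0 : 0 < alpha.
Hypothesis hip : sobolev_inner_product alpha ip.
Local Notation Un := (@unif R).
Local Notation smfR := (smf (@rv_used b s d) (rv_events pi xi)).
Local Notation q := (b%:R `^ (- (2 * alpha + 1)) : R).

Let bR : 0 < b%:R :> R. Proof. by rewrite ltr0n ltnW. Qed.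

Definition block_rules (w : Omega) (n : 'I_d) : nat -> qrule (R := R) (s.-tuple R) :=
  scrambled_rule hb (@p n) (fun m t prefix => pi n m t prefix w) (fun m t i => xi n t i w).

Definition block_value (f : 'I_s -> R -> R) n l w : R :=
  q_eval (block_rules w n l) (fun y => \prod_t f t (tnth y t)).

Lemma block_value0 f n w : block_value f n 0 w = 0.
Proof. by rewrite /block_value /q_eval big1//; case. Qed.

Lemma block_valueS f n m : block_value f n m.+1 = net_rule hb pi xi n (@p n m) f.
Proof.
apply/funext => w; rewrite /block_value /q_eval /= /net_rule mulr_sumr; apply: eq_bigr => i _.
by congr (_ * _); apply: eq_bigr => t _; rewrite tnth_mktuple.
Qed.

Definition block_mean (f : 'I_s -> R -> R) : R := \prod_t Ex Un (f t).

(** The error of the rule of level [k] for [k > 0]; level 0 stands for the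
    exact integral, so that these terms add up to the rules. *)
Definition block_err (f : 'I_s -> R -> R) n k w : R :=
  if k == 0%N then block_mean f else block_value f n k w - block_mean f.

Definition rv_group (n : 'I_d) : set (rv_ix b s d) := [set e | exists m, rv_block n m e].

Section OneFunction.
Variable f : 'I_s -> R -> R.
Hypothesis hf : forall t, uL2 (f t).

Lemma block_errS n m : block_err f n m.+1 = fun w => net_rule hb pi xi n (@p n m) f w - block_mean f.
Proof. by apply/funext => w; rewrite /block_err /= block_valueS. Qed.

Lemma smf_block_errS n m : smfR (rv_block n m) (block_err f n m.+1).
Proof.
rewrite block_errS; apply: measurable_funB => //.
exact: (@smf_net_rule _ _ _ _ _ _ hb pi xi n m (@p n m) f hf).
Qed.

Lemma smf_block_err n k : smfR (rv_group n) (block_err f n k).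
Proof.
case: k => [|m]; first exact: measurable_cst.
by apply: smf_sub (@smf_block_errS n m) => e h; exists m.
Qed.

Lemma L2_block_err n k : L2 P (block_err f n k).
Proof.
case: k => [|m]; first exact: L2_cst.
rewrite block_errS; apply: L2D; last exact: L2_cst.
exact: (L2_net_rule hb hrand n (@hp_net n m) hf).
Qed.

Lemma Ex_block_errS n m : Ex P (block_err f n m.+1) = 0.
Proof.
have l := L2_net_rule hb hrand n (@hp_net n m) hf.
rewrite block_errS ExD; [|exact: L2_L1|exact: L1_cst].
by rewrite Ex_cst (Ex_net_rule hb hrand n (@hp_net n m) hf) subrr.
Qed.

End OneFunction.

(** Distinct levels of a block use independent randomness, and the rules are
    unbiased. *)
Lemma block_err_orth f g n k k' : (forall t, uL2 (f t)) -> (forall t, uL2 (g t)) -> k != k' ->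
  Ex P (fun w => block_err f n k w * block_err g n k' w) = 0.
Proof.
move=> hf hg; case: k k' => [|m] [|m'] kk //.
- rewrite [X in Ex _ X](_ : _ = fun w => block_mean f * block_err g n m'.+1 w)//.
  by rewrite ExZ ?Ex_block_errS ?mulr0//; exact: L2_L1 (L2_block_err hg n _).
- rewrite [X in Ex _ X](_ : _ = fun w => block_mean g * block_err f n m.+1 w); last first.
    by apply/funext => w; rewrite mulrC.
  by rewrite ExZ ?Ex_block_errS ?mulr0//; exact: L2_L1 (L2_block_err hf n _).
have dis (e : rv_ix b s d) : rv_block n m e -> rv_block n m' e -> False.
  by case: e => [n1 m1 t pre|n1 m1 t i] [_ e1] [_ e2]; case/eqP: kk; rewrite -e1 -e2.
have [_ ->] := rv_indep_Ex hrand dis (smf_block_errS hf (n := n) (m := m)) (smf_block_errS hg (n := n) (m := m'))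
  (L2_L1 (L2_block_err hf n _)) (L2_L1 (L2_block_err hg n _)).
by rewrite Ex_block_errS// mul0r.
Qed.

Definition block_cov (f g : 'I_s -> R -> R) n k : R :=
  Ex P (fun w => block_err f n k w * block_err g n k w).

Lemma block_cov0 f g n : block_cov f g n 0 = block_mean f * block_mean g.
Proof. by rewrite /block_cov /block_err /= Ex_cst. Qed.

(** For [k = m + 1] this is [net_cov_le] followed by the Sobolev bound
    [henergy_gram]; for [k = 0] the product of the means is the product of the
    levels 0. *)
Lemma block_cov_le : exists2 c : R, 0 < c & forall N (f : 'I_N -> 'I_s -> R -> R),
  (forall a t, sobolev alpha (f a t)) -> forall n k,
  psd (fun a a' => block_cov (fun t => zext (f a t)) (fun t => zext (f a' t)) n k) /\
  psd_le (fun a a' => block_cov (fun t => zext (f a t)) (fun t => zext (f a' t)) n k)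
         (fun a a' => c * q ^+ k * \prod_t ip (f a t) (f a' t)).
Proof.
have [C C0 hC] := henergy_gram hb alpha0 hip.
have B0 : 0 < b%:R `^ (2 * alpha) :> R by rewrite powR_gt0.
have bs : 1 <= b%:R ^+ s.+1 :> R by rewrite exprn_ege1// ler1n ltnW.
(* b ^ s comes from the net, and one more factor b turns b ^ -m into b ^ -(m + 1) *)
exists (b%:R ^+ s.+1 * C ^+ s); first by rewrite mulr_gt0// exprn_gt0.
move=> N f hf n k.
have hz a t : uL2 (zext (f a t)) by exact: uL2_sobolev (hf a t).
have pip : psd (fun a a' => \prod_t ip (f a t) (f a' t)).
  by apply: psd_prod => t _; apply: (ip_psd hip) => a; exact: hf.
have hprod m : psd_le (fun a a' => \prod_t henergy b alpha m (zext (f a t)) (zext (f a' t)))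
    (fun a a' => C ^+ s * \prod_t ip (f a t) (f a' t)).
  have h := @psd_le_prod R N _ (index_enum 'I_s) xpredT
    (fun t a a' => henergy b alpha m (zext (f a t)) (zext (f a' t)))
    (fun t a a' => C * ip (f a t) (f a' t)).
  under [X in psd_le _ X]eq_fun do under eq_fun do rewrite -[X in C ^+ X]card_ord -prodr_const -big_split.
  apply: h => t _; last by apply: hC => a; exact: hf.
  by apply: psd_sum => j _; apply: psdZ; [rewrite exprn_ge0// ltW|exact: lev_psd].
case: k => [|m]; last first.
  have e a a' : block_cov (fun t => zext (f a t)) (fun t => zext (f a' t)) n m.+1 =
     Ex P (fun w => (net_rule hb pi xi n (@p n m) (fun t => zext (f a t)) w - \prod_t Ex Un (zext (f a t))) *
          (net_rule hb pi xi n (@p n m) (fun t => zext (f a' t)) w - \prod_t Ex Un (zext (f a' t)))).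
    by rewrite /block_cov !block_errS.
  under eq_fun do under eq_fun do rewrite e.
  split; first exact: (net_cov_psd hb hrand n (@hp_net n m) hz).
  apply: psd_le_trans (net_cov_le hb hs hrand n (@hp_inj n m) (@hp_net n m) alpha0 hz) _.
  set c := (_ * _ * _ : R).
  have ce : c = b%:R ^+ s.+1 * q ^+ m.+1.
    rewrite /c powRN powRD ?(gt_eqF bR) ?implybT// powRr1 ?(ltW bR)// invfM exprMn [b%:R ^+ s.+1]exprS.
    rewrite -!exprVn [b%:R^-1 ^+ m.+1]exprS; move: (b%:R ^+ s) (_ ^+ m.+1) (b%:R^-1 ^+ m) => x y z.
    by field; rewrite gt_eqF.
  have c0 : 0 <= c by rewrite ce mulr_ge0 ?exprn_ge0 ?powR_ge0// ltW.
  rewrite (_ : (fun a a' => _ * q ^+ m.+1 * _) = fun a a' => c * (C ^+ s * \prod_t ip (f a t) (f a' t))).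
    by apply: psd_leZ => //; exact: hprod.
  by apply/funext => a; apply/funext => a'; rewrite ce; ring.
under eq_fun do under eq_fun do rewrite block_cov0.
split; first exact: psd_rank1.
apply: psd_le_trans (_ : psd_le (fun a a' => C ^+ s * \prod_t ip (f a t) (f a' t)) _).
  apply: psd_le_trans (hprod 0%N).
  rewrite (_ : (fun a a' => _ * _) = fun a a' => \prod_t lev b 0 0 (zext (f a t)) (zext (f a' t))).
    apply: psd_le_prod => t _; first exact: lev_psd.
    rewrite /psd_le /henergy; under eq_fun do under eq_fun do
      rewrite big_ord_recr big_ord1 /= expr0 mul1r [X in X - _]addrC addrK.
    apply: psdZ; first by rewrite exprn_ge0// ltW.
    exact: (@lev_psd R b hb 0 1 N (fun a => zext (f a t)) (fun a => hz a t)).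
  apply/funext => a; apply/funext => a'; rewrite /block_mean -big_split/=; apply: eq_bigr => t _.
  by rewrite /lev /upto /= av0.
rewrite expr0 mulr1; apply: psd_le_coef => //.
by rewrite ler_peMl// exprn_ge0// ltW.
Qed.

(** Coefficients of [A(L,d) - I] in the products of block errors. *)
Definition err_coef L (K : {ffun 'I_d -> 'I_L.+1}) : R :=
  smolyak_coef L (fun n => K n : nat) - [forall n, K n == 0%N :> nat]%:R.

Definition block_fac (u : ftensor (R := R) (s * d)) a n t := ft_fac (f := u) a (join_ix n t).

Definition zblock u a n t : R -> R := zext (@block_fac u a n t).

Lemma smolyak_tensor_err L u w : ft_sobolev alpha u ->
  smolyak (block_rules w) L (zcube (ft_eval u)) - cube_integral (ft_eval u) =
  \sum_a \sum_(K : {ffun 'I_d -> 'I_L.+1}) err_coef K * \prod_n block_err (@zblock u a n) n (K n) w.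
Proof.
move=> hu; rewrite cube_integralE !zcube_ft smolyak_sum.
have L1t a : L1 (cube_measure (s * d)) (fun x => \prod_t zext (ft_fac (f := u) a t) (tnth x t)).
  by apply: L2_L1; apply: (L2_cube_prod (f := fun t => zext (ft_fac a t))) => t; exact: uL2_sobolev (hu a t).
rewrite Ex_sum// -sumrB; apply: eq_bigr => a _.
rewrite (Ex_cube_prod (f := fun t => zext (ft_fac a t))); last by move=> t; exact: uL2_sobolev (hu a t).
rewrite prod_blocks /smolyak.
have e1 (l : {ffun 'I_d -> 'I_L.+1}) : q_eval (q_tensor (fun n => q_sub (block_rules w n (l n)) (block_rules w n (l n).-1)))
    (fun x => \prod_t zext (ft_fac (f := u) a t) (tnth x t)) =
    \prod_n (block_value (@zblock u a n) n (l n) w - block_value (@zblock u a n) n (l n).-1 w).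
  rewrite [LHS](q_eval_tensor _ (fun t => zext (ft_fac (f := u) a t))).
  by apply: eq_bigr => n _; rewrite q_eval_sub.
rewrite (eq_bigr _ (fun l _ => e1 l)).
have V0 n : block_value (@zblock u a n) n 0 w = 0 by exact: block_value0.
rewrite (smolyak_expand L (V := fun n l => block_value (@zblock u a n) n l w)
  (fun n => block_mean (@zblock u a n)) V0).
under [RHS]eq_bigr do rewrite mulrBl; rewrite sumrB; congr (_ - _).
have z0 : [forall n, ([ffun=> ord0] : {ffun 'I_d -> 'I_L.+1}) n == 0%N :> nat].
  by apply/forallP => n; rewrite ffunE.
rewrite (bigD1 [ffun=> ord0])//= z0.
rewrite mul1r [X in _ = _ + X]big1 ?addr0; last first.
  move=> K nK; case: forallP => [h|_]; last by rewrite mul0r.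
  by case/eqP: nK; apply/ffunP => n; apply/val_inj; rewrite ffunE /=; exact: (eqP (h n)).
by apply: eq_bigr => n _; rewrite ffunE.
Qed.

Lemma err_coef_small L (K : {ffun 'I_d -> 'I_L.+1}) : (\sum_n K n + d <= L)%N -> err_coef K = 0.
Proof. by move=> h; rewrite /err_coef smolyak_coef_small// subrr. Qed.

Lemma err_coef_le L (K : {ffun 'I_d -> 'I_L.+1}) : (d <= L)%N -> err_coef K ^+ 2 <= 4 ^+ d.
Proof.
move=> dL; have [h|h] := leqP (\sum_n K n + d) L; first by rewrite err_coef_small// expr0n exprn_ge0.
rewrite /err_coef; case: forallP => [h0|_].
  by move: h; rewrite big1 ?ltnNge ?dL// => n _; exact/eqP.
rewrite subr0 -real_normK ?num_real//.
apply: (@le_trans _ _ ((2 ^+ d) ^+ 2)); last by rewrite -exprM mulnC exprM -natrX.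
by rewrite ler_pXn2r ?nnegrE ?exprn_ge0//; exact: smolyak_coef_bound.
Qed.

(** The blocks are independent, and in each block errors of distinct levels
    are orthogonal, so only the squares remain when the error is squared. *)
Lemma smolyak_second_moment L u : ft_sobolev alpha u ->
  L2 P (fun w => smolyak (block_rules w) L (zcube (ft_eval u)) - cube_integral (ft_eval u)) /\
  Ex P (fun w => (smolyak (block_rules w) L (zcube (ft_eval u)) - cube_integral (ft_eval u)) ^+ 2) =
  \sum_(K : {ffun 'I_d -> 'I_L.+1}) err_coef K ^+ 2 *
    \sum_a \sum_a' \prod_n block_cov (@zblock u a n) (@zblock u a' n) n (K n).
Proof.
move=> hu.
have hz a n t : uL2 (@zblock u a n t) by exact: uL2_sobolev (hu a _).
have dis (n n' : 'I_d) e : rv_group n e -> rv_group n' e -> n = n'.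
  by case: e => [n1 m1 t pre|n1 m1 t i] [m [<- _]] [m' [<- _]].
rewrite (_ : (fun w => _ - _) = fun w => \sum_a \sum_(K : {ffun 'I_d -> 'I_L.+1})
    err_coef K * \prod_n block_err (@zblock u a n) n (K n) w); last first.
  by apply/funext => w; exact: smolyak_tensor_err.
rewrite (_ : (fun w => _ ^+ 2) = fun w => (\sum_a \sum_(K : {ffun 'I_d -> 'I_L.+1})
    err_coef K * \prod_n block_err (@zblock u a n) n (K n) w) ^+ 2); last first.
  by apply/funext => w; rewrite smolyak_tensor_err.
split.
  apply: L2_sum => a _; apply: L2_sum => K _; apply: L2Z.
  apply: (rv_prod_L2 hrand dis) => n; [exact: smf_block_err (hz a n) n _|exact: L2_block_err (hz a n) n _].
pose T a a' (K K' : {ffun 'I_d -> 'I_L.+1}) w := \prod_n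
  (block_err (@zblock u a n) n (K n) w * block_err (@zblock u a' n) n (K' n) w).
have hT a a' (K K' : {ffun 'I_d -> 'I_L.+1}) : L1 P (T a a' K K') /\
    Ex P (T a a' K K') = (K == K')%:R * \prod_n block_cov (@zblock u a n) (@zblock u a' n) n (K n).
  have sm n : smfR (rv_group n) (fun w => block_err (@zblock u a n) n (K n) w * block_err (@zblock u a' n) n (K' n) w).
    by apply: measurable_funM; [exact: smf_block_err (hz a n) n _|exact: smf_block_err (hz a' n) n _].
  have l1 n : L1 P (fun w => block_err (@zblock u a n) n (K n) w * block_err (@zblock u a' n) n (K' n) w).
    by apply: L2_mul; [exact: L2_block_err (hz a n) n _|exact: L2_block_err (hz a' n) n _].
  have [l ->] := rv_prod_L1 hrand dis sm l1; split => //.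
  case: eqP => [<-|ne]; first by rewrite mul1r.
  have /existsP[n nn] : [exists n, K n != K' n].
    by apply: contra_notT ne => /existsPn h; apply/ffunP => n; have := h n; rewrite negbK => /eqP.
  by rewrite mul0r (bigD1 n)//= block_err_orth// mul0r.
rewrite (_ : (fun w => _ ^+ 2) = fun w => \sum_a \sum_a' \sum_(K : {ffun 'I_d -> 'I_L.+1})
    \sum_(K' : {ffun 'I_d -> 'I_L.+1}) err_coef K * err_coef K' * T a a' K K' w); last first.
  apply/funext => w; rewrite expr2 mulr_suml; apply: eq_bigr => a _.
  rewrite mulr_sumr; apply: eq_bigr => a' _; rewrite mulr_suml; apply: eq_bigr => K _.
  rewrite mulr_sumr; apply: eq_bigr => K' _; rewrite /T big_split/=; ring.
have l0 a a' (K K' : {ffun 'I_d -> 'I_L.+1}) : L1 P (fun w => err_coef K * err_coef K' * T a a' K K' w).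
  by apply: L1Z; exact: (hT a a' K K').1.
rewrite Ex_sum; last by move=> a _; do 3 (apply: L1_sum => ? _); exact: l0.
transitivity (\sum_a \sum_a' \sum_(K : {ffun 'I_d -> 'I_L.+1}) err_coef K ^+ 2 *
    \prod_n block_cov (@zblock u a n) (@zblock u a' n) n (K n)).
  apply: eq_bigr => a _; rewrite Ex_sum; last by move=> ? _; do 2 (apply: L1_sum => ? _); exact: l0.
  apply: eq_bigr => a' _; rewrite Ex_sum; last by move=> ? _; (apply: L1_sum => ? _); exact: l0.
  apply: eq_bigr => K _; rewrite Ex_sum; last by move=> ? _; exact: l0.
  rewrite (bigD1 K)//= big1 ?addr0; last first.
    by move=> K' /negPf ne; rewrite ExZ ?(hT a a' K K').2 ?(hT a a' K K').1 1?eq_sym ?ne ?mul0r ?mulr0//; exact: (hT a a' K K').1.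
  rewrite ExZ; last exact: (hT a a' K K).1.
  by rewrite (hT a a' K K).2 eqxx mul1r expr2.
under eq_bigr do rewrite exchange_big/=.
rewrite exchange_big/=; apply: eq_bigr => K _.
by rewrite mulr_sumr; apply: eq_bigr => a _; rewrite mulr_sumr.
Qed.

End SmolyakTensor.

(** * Continuity of the method in the mean square *)

Section SumL2.
Context {d0 : measure_display} {Omega : measurableType d0} {R : realType}.
Variable P : probability Omega R.

(** For each outcome, the square of a sum of [n] terms is at most [n] times
    the sum of their squares. *)
Lemma Ex_sqr_sum_le (I : finType) (A : pred I) (X : I -> Omega -> R) (c : I -> R) (v : R) :
  (forall i, L2 P (X i)) -> (forall i, Ex P (fun w => X i w ^+ 2) <= c i * v) ->
  Ex P (fun w => (\sum_(i | A i) X i w) ^+ 2) <= (#|A|%:R * \sum_(i | A i) c i) * v.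
Proof.
move=> hX hv.
have l : L1 P (fun w => \sum_(i | A i) X i w ^+ 2) by apply: L1_sum => i _; exact: (hX i).2.
apply: (@le_trans _ _ (Ex P (fun w => #|A|%:R * \sum_(i | A i) X i w ^+ 2))).
  apply: Ex_le => [||w]; last exact: sqr_sum_le.
    exact: (L2_sum (index_enum I) (p := A) (fun i _ => hX i)).2.
  exact: L1Z.
rewrite ExZ// -mulrA ler_wpM2l// Ex_sum => [|i _]; last exact: (hX i).2.
by rewrite mulr_suml; apply: ler_sum => i _.
Qed.

End SumL2.

Section Smolyak.
Context {R : realType} {d0 : measure_display} {Omega : measurableType d0}.
Variable P : probability Omega R.
Variables b s d : nat.
Hypothesis hb : (1 < b)%N.
Hypothesis hs : (0 < s)%N.
Variable p : forall (n : 'I_d) (m : nat), 'I_(b ^ m) -> s.-tuple R.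
Hypothesis hp_inj : forall n m, injective (p n (m:=m)).
Hypothesis hp_net : forall n m, is_net b m (range (p n (m:=m))).
Variable pi : 'I_d -> nat -> 'I_s -> seq 'I_b -> Omega -> {perm 'I_b}.
Variable xi : 'I_d -> forall m : nat, 'I_s -> 'I_(b ^ m) -> Omega -> R.
Hypothesis hrand : independently_randomized P pi xi.
Variables (alpha : R) (ip : (R -> R) -> (R -> R) -> R).
Hypothesis alpha0 : 0 < alpha.
Hypothesis hip : sobolev_inner_product alpha ip.
Local Notation D := (s * d)%N.
Local Notation Q := (@cube_measure R D).
Local Notation q := (b%:R `^ (- (2 * alpha + 1)) : R).
Local Notation rules := (block_rules hb p pi xi).

(** The index type of a rule is the same for all outcomes; with this
    description a sum over the nodes is a finite sum of random variables. *)
Definition level_ix (l : nat) : finType := if l is m.+1 then 'I_(b ^ m) : finType else void : finType.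

Definition level_weight (l : nat) : level_ix l -> R :=
  if l is m.+1 return level_ix l -> R then fun=> b%:R ^- m else fun=> 0.

Definition level_node (n : 'I_d) (l : nat) (w : Omega) : level_ix l -> s.-tuple R :=
  if l is m.+1 return level_ix l -> s.-tuple R then
    fun i => scrambled_point hb m (fun t prefix => pi n m t prefix w) (fun t => xi n t i w) (p n i)
  else fun c => match c with end.

Lemma block_rulesE w n l : rules w n l = QRule (@level_weight l) (@level_node n l w).
Proof. by case: l. Qed.

Definition diff_ix (l : nat) : finType := (level_ix l + level_ix l.-1)%type.

Definition diff_weight l (c : diff_ix l) : R :=
  match c with inl i => level_weight i | inr i => - level_weight i end.

Definition diff_node n l w (c : diff_ix l) : s.-tuple R :=
  match c with inl i => level_node n w i | inr i => level_node n w i end.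

Definition smolyak_node L (l : {ffun 'I_d -> 'I_L.+1}) (c : {dffun forall n, diff_ix (l n)}) (w : Omega) :
    D.-tuple R := join_blocks (fun n => diff_node n w (c n)).

Lemma smolyakE L w (g : D.-tuple R -> R) : smolyak (rules w) L g =
  \sum_(l : {ffun 'I_d -> 'I_L.+1} | smolyak_ix l) \sum_(c : {dffun forall n, diff_ix (l n)})
    (\prod_n diff_weight (c n)) * g (smolyak_node c w).
Proof.
apply: eq_bigr => l _.
have -> : (fun n => q_sub (rules w n (l n)) (rules w n (l n).-1)) =
    (fun n => q_sub (QRule (@level_weight (l n)) (@level_node n (l n) w))
                    (QRule (@level_weight (l n).-1) (@level_node n (l n).-1 w))).
  by apply/funext => n; rewrite !block_rulesE.
by [].
Qed.

Lemma diff_node_coord n l (c : diff_ix l) :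
  {m : nat & {i : 'I_(b ^ m) | forall w t, tnth (diff_node n w c) t =
    Ypt hb pi xi n t (tnth (p n i) t) i w}}.
Proof.
have h l' (i : level_ix l') : {m : nat & {i' : 'I_(b ^ m) | forall w t, tnth (level_node n w i) t =
    Ypt hb pi xi n t (tnth (p n i') t) i' w}}.
  case: l' i => [[]|m i]; exists m, i => w t; exact: tnth_mktuple.
by case: c => i; exact: h.
Qed.

Section Node.
Variables (L : nat) (l : {ffun 'I_d -> 'I_L.+1}) (c : {dffun forall n, diff_ix (l n)}).

Let depth n := projT1 (@diff_node_coord n _ (c n)).
Let point n : 'I_(b ^ depth n) := sval (projT2 (@diff_node_coord n _ (c n))).
Let Y (t : 'I_D) := Ypt hb pi xi (block_ix t) (coord_ix t)
  (tnth (p (block_ix t) (point (block_ix t))) (coord_ix t)) (point (block_ix t)).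

Lemma smolyak_nodeE : smolyak_node c = fun w => [tuple Y t w | t < D].
Proof.
apply/funext => w; apply: eq_from_tnth => t; rewrite !tnth_mktuple.
exact: (svalP (projT2 (@diff_node_coord (block_ix t) _ (c (block_ix t)))) w (coord_ix t)).
Qed.

Lemma smolyak_node_cube w : unit_cube (smolyak_node c w).
Proof. by move=> t; rewrite smolyak_nodeE tnth_mktuple; exact: (Ypt_itv hb hrand). Qed.

(** The coordinates of a node use disjoint groups of random variables,
    whichever levels the node combines. *)
Lemma smolyak_node_law : measurable_fun setT (smolyak_node c) /\
  forall A, measurable A -> P (smolyak_node c @^-1` A) = Q A.
Proof.
rewrite smolyak_nodeE.
have [] := tuple_law (rv_Em hrand) (@rv_EI _ _ _ _ _ _ pi xi) (@rv_ET _ _ _ _ _ _ pi xi) (rv_Eind hrand)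
  (S := fun t : 'I_D => rv_coord (block_ix t) (depth (block_ix t)) (coord_ix t)) (Y := Y).
- move=> t t' e h h'; rewrite -(join_ixK t) -(join_ixK t').
  by case: e h h' => [n1 m1 t1 pre|n1 m1 t1 i] [e1 _ e2] [e1' _ e2']; congr join_ix; congruence.
- by move=> t; exact: smf_Ypt.
- move=> t A mA; apply: (Ypt_law hb hrand) => //.
  exact: (net_itv (@hp_net _ _)).
by move=> m h; split => //; exact: (smf_measurable (rv_Em hrand) m).
Qed.

Lemma L2_node (g : D.-tuple R -> R) : L2 Q g -> L2 P (fun w => g (smolyak_node c w)).
Proof. by have [m law] := smolyak_node_law => hg; exact: (L2_law m law hg). Qed.

Lemma Ex_node (g : D.-tuple R -> R) : L1 Q g -> Ex P (fun w => g (smolyak_node c w)) = Ex Q g.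
Proof. by have [m law] := smolyak_node_law => hg; exact/esym/(Ex_law m law hg). Qed.

End Node.

(** All nodes lie in the half-open cube. *)
Lemma smolyak_zcube L w (g : D.-tuple R -> R) : smolyak (rules w) L g = smolyak (rules w) L (zcube g).
Proof.
rewrite !smolyakE; apply: eq_bigr => l _; apply: eq_bigr => c _.
by rewrite zcube_in//; exact: smolyak_node_cube.
Qed.

(** Every node is uniform in the cube, so each of the finitely many summands
    is bounded in the mean square by the norm of [g]. The constant grows with
    [L], but it only serves to pass to the limit for fixed [L]. *)
Lemma smolyak_L2 L : exists2 C : R, 0 <= C & forall g : D.-tuple R -> R, L2 Q g ->
  L2 P (fun w => smolyak (rules w) L g) /\
  Ex P (fun w => smolyak (rules w) L g ^+ 2) <= C * Ex Q (fun x => g x ^+ 2).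
Proof.
pose W (l : {ffun 'I_d -> 'I_L.+1}) (c : {dffun forall n, diff_ix (l n)}) : R := \prod_n diff_weight (c n).
pose C1 (l : {ffun 'I_d -> 'I_L.+1}) : R := #|{: {dffun forall n, diff_ix (l n)}}|%:R * \sum_c W l c ^+ 2.
have C10 l : 0 <= C1 l by rewrite mulr_ge0// sumr_ge0// => c _; exact: sqr_ge0.
exists (#|[pred l : {ffun 'I_d -> 'I_L.+1} | smolyak_ix l]|%:R * \sum_(l | smolyak_ix l) C1 l).
  by rewrite mulr_ge0// sumr_ge0.
move=> g hg.
have h2 (l : {ffun 'I_d -> 'I_L.+1}) (c : {dffun forall n, diff_ix (l n)}) :
  L2 P (fun w => W l c * g (smolyak_node c w)) by apply: L2Z; exact: L2_node.
have h1 (l : {ffun 'I_d -> 'I_L.+1}) : L2 P (fun w => \sum_c W l c * g (smolyak_node c w)) by exact: L2_sum.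
rewrite (_ : (fun w => smolyak _ _ _) = fun w => \sum_(l | smolyak_ix l) \sum_c W l c * g (smolyak_node c w)); last first.
  by apply/funext => w; exact: smolyakE.
rewrite (_ : (fun w => smolyak _ _ _ ^+ 2) = fun w => (\sum_(l | smolyak_ix l) \sum_c W l c * g (smolyak_node c w)) ^+ 2); last first.
  by apply/funext => w; rewrite smolyakE.
split; first exact: L2_sum.
apply: Ex_sqr_sum_le => // l; apply: Ex_sqr_sum_le => // c.
rewrite (_ : (fun w => _ ^+ 2) = fun w => W l c ^+ 2 * (g (smolyak_node c w) ^+ 2)); last first.
  by apply/funext => w; rewrite exprMn.
rewrite ExZ; last exact: (L2_node c hg).2.
by rewrite (Ex_node c (g := fun x => g x ^+ 2) hg.2).
Qed.

End Smolyak.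

(** * The error bound on the unit ball *)

Section SmolyakError.
Context {R : realType} {d0 : measure_display} {Omega : measurableType d0}.
Variable P : probability Omega R.
Variables b s d : nat.
Hypothesis hb : (1 < b)%N.
Hypothesis hs : (0 < s)%N.
Variable p : forall (n : 'I_d.+1) (m : nat), 'I_(b ^ m) -> s.-tuple R.
Hypothesis hp_inj : forall n m, injective (p n (m:=m)).
Hypothesis hp_net : forall n m, is_net b m (range (p n (m:=m))).
Variable pi : 'I_d.+1 -> nat -> 'I_s -> seq 'I_b -> Omega -> {perm 'I_b}.
Variable xi : 'I_d.+1 -> forall m : nat, 'I_s -> 'I_(b ^ m) -> Omega -> R.
Hypothesis hrand : independently_randomized P pi xi.
Variables (alpha : R) (ip : (R -> R) -> (R -> R) -> R).
Hypothesis alpha0 : 0 < alpha.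
Hypothesis hip : sobolev_inner_product alpha ip.
Local Notation D := (s * d.+1)%N.
Local Notation Q := (@cube_measure R D).
Local Notation q := (b%:R `^ (- (2 * alpha + 1)) : R).
Local Notation rules := (block_rules hb p pi xi).

Let q_ge0 : 0 <= q. Proof. exact: powR_ge0. Qed.

Let q_half : q <= 2^-1.
Proof.
rewrite powRN lef_pV2 ?posrE ?powR_gt0 ?ltr0n ?(ltnW hb)//.
apply: (@le_trans _ _ b%:R); first by rewrite ler_nat.
by rewrite -[leLHS]powRr1// ler_powR// ?ler1n ?(ltnW hb)// lerDr mulr_ge0// ltW.
Qed.

(** By [err_coef_small] only multi-indices of size greater than [L - (d + 1)]
    contribute. For each of them the block covariances are bounded by products
    of the inner products, which add up to the tensor norm of [u], and the sum
    of the remaining powers of [q] is a geometric tail. *)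
Lemma smolyak_tensor_le : exists2 c : R, 0 <= c & forall L u, (d.+1 <= L)%N -> ft_sobolev alpha u ->
  Ex P (fun w => (smolyak (rules w) L (zcube (ft_eval u)) - cube_integral (ft_eval u)) ^+ 2) <=
  c * (L.+1%:R ^+ d * q ^+ (L - d.+1)) * ft_ip ip u u.
Proof.
have [c0 c00 hc] := block_cov_le hb hs hp_inj hp_net hrand alpha0 hip.
exists (4 ^+ d.+1 * c0 ^+ d.+1); first by rewrite mulr_ge0 ?exprn_ge0 ?(ltW c00).
move=> L u dL hu.
have [_ ->] := smolyak_second_moment hb hp_net hrand L hu.
have ipu := ft_ip_ge0 hip hu.
apply: (@le_trans _ _ (\sum_(K : {ffun 'I_d.+1 -> 'I_L.+1}) err_coef (R := R) K ^+ 2 *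
    (c0 ^+ d.+1 * q ^+ (\sum_n K n) * ft_ip ip u u))).
  apply: ler_sum => K _; apply: ler_wpM2l; first exact: sqr_ge0.
  have hK n := hc _ (fun a => @block_fac R s d.+1 u a n) (fun a t => hu a _) n (K n).
  have := psd_le_total (psd_le_prod (index_enum 'I_d.+1) (p := xpredT) (fun n _ => (hK n).1) (fun n _ => (hK n).2)).
  move=> h; apply: le_trans h _; rewrite /ft_ip mulr_sumr le_eqVlt; apply/orP; left; apply/eqP.
  apply: eq_bigr => a _; rewrite mulr_sumr; apply: eq_bigr => a' _.
  by rewrite big_split/= prod_blocks big_split/= prodr_const card_ord prodrXr.
rewrite (bigID (fun K : {ffun 'I_d.+1 -> 'I_L.+1} => (L - d.+1 < \sum_n K n)%N))/=.
rewrite [X in _ + X]big1 ?addr0; last first.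
  move=> K; rewrite -leqNgt => hK; rewrite err_coef_small ?expr0n ?mul0r//.
  by move: hK; rewrite -(leq_add2r d.+1) subnK.
apply: (@le_trans _ _ (4 ^+ d.+1 * c0 ^+ d.+1 * ft_ip ip u u *
  \sum_(K : {ffun 'I_d.+1 -> 'I_L.+1} | (L - d.+1 < \sum_n K n)%N) q ^+ (\sum_n K n))).
  rewrite mulr_sumr; apply: ler_sum => K _.
  rewrite [leRHS](_ : _ = 4 ^+ d.+1 * (c0 ^+ d.+1 * q ^+ (\sum_n K n) * ft_ip ip u u)); last by ring.
  apply: ler_wpM2r; last exact: err_coef_le.
  by rewrite !mulr_ge0 ?exprn_ge0 ?(ltW c00).
rewrite [leRHS](_ : _ = 4 ^+ d.+1 * c0 ^+ d.+1 * ft_ip ip u u * (L.+1%:R ^+ d * q ^+ (L - d.+1))); last by ring.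
apply: ler_wpM2l; first by rewrite !mulr_ge0 ?exprn_ge0 ?(ltW c00).
exact: multi_tail.
Qed.

(** [F] is an [L^2] limit of finite tensors with converging norms, and both
    the method and the integral are continuous on [L^2], so the bound for
    tensors passes to the limit. *)
Lemma smolyak_error_le : exists2 c : R, 0 <= c & forall L F, (d.+1 <= L)%N ->
  sobolev_mix alpha ip F -> sobolev_mix_norm alpha ip F <= 1 ->
  L2 P (fun w => smolyak (rules w) L F - cube_integral F) /\
  Ex P (fun w => (smolyak (rules w) L F - cube_integral F) ^+ 2) <=
  c * (L.+1%:R ^+ d * q ^+ (L - d.+1)).
Proof.
have [c c0 hc] := smolyak_tensor_le; exists (2 * c); first by rewrite mulr_ge0.
move=> L F dL [mF [u hu]].
have [v0 hv0] := mix_norm_cvg hip hu.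
rewrite /sobolev_mix_norm; set S := [set v : R | _].
have : S (xget 0 S) by apply: xgetPex; exists v0, u; split; [exact: hu|exact: hv0].
set v := xget 0 S => -[u' [hu' hv]] v1.
have [CA CA0 hA] := smolyak_L2 hb hp_net hrand L.
have L2F : L2 Q (zcube F) by apply/L2_zcube; exact: mix_L2 mF hu'.
have eF w : smolyak (rules w) L F = smolyak (rules w) L (zcube F) by exact: smolyak_zcube hrand _ _ _.
have L2e : L2 P (fun w => smolyak (rules w) L F - cube_integral F).
  rewrite (_ : (fun w => _) = fun w => smolyak (rules w) L (zcube F) + - cube_integral F).
    by apply: L2D; [exact: (hA _ L2F).1|exact: L2_cst].
  by apply/funext => w; rewrite eF.
split=> //.
set r := L.+1%:R ^+ d * q ^+ (L - d.+1).
have r0 : 0 <= r by rewrite mulr_ge0 ?exprn_ge0.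
suff h : Ex P (fun w => (smolyak (rules w) L F - cube_integral F) ^+ 2) <= 2 * c * r * v.
  apply: le_trans h _; rewrite ler_piMr ?mulr_ge0//.
  (* Num.sqrt is 0 on negative arguments, so v <= 0 has to be treated apart *)
  have [v0'|v0'] := leP v 0; first exact: le_trans v0' ler01.
  by rewrite -ler_sqrt ?ltr01// sqrtr1.
have C'0 : 0 <= 4 * CA + 4 by rewrite addr_ge0 ?mulr_ge0.
apply: (mix_limit mF hu' C'0 hv) => k /L2_zcube hk.
have hu'k : ft_sobolev alpha (u' k) by case: hu' => h _ _ i t; exact: h.
set G := fun x => F x - ft_eval (u' k) x; rewrite -/G in hk.
have L2u := L2_ft hu'k.
pose e1 w := smolyak (rules w) L (zcube (ft_eval (u' k))) - cube_integral (ft_eval (u' k)).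
pose a w := smolyak (rules w) L (zcube G).
have Gk : zcube G = fun x => zcube F x - zcube (ft_eval (u' k)) x by rewrite zcubeB.
have eI : cube_integral F = cube_integral (ft_eval (u' k)) + Ex Q (zcube G).
  rewrite !cube_integralE -ExD; [|exact: L2_L1|exact: L2_L1].
  by congr (Ex Q _); rewrite Gk; apply/funext => x; rewrite addrC subrK.
have ee w : smolyak (rules w) L F - cube_integral F = e1 w + (a w - Ex Q (zcube G)).
  rewrite eF eI /e1 /a Gk smolyakB; ring.
have L2e1 : L2 P e1 by exact: (smolyak_second_moment hb hp_net hrand L hu'k).1.
have [L2a ha] := hA _ hk.
set y := Ex Q (fun x => zcube G x ^+ 2) in ha *.
have y0 : 0 <= y by apply: Ex_ge0 => x; exact: sqr_ge0.
apply: (@le_trans _ _ (Ex P (fun w => 2 * e1 w ^+ 2 + (4 * a w ^+ 2 + 4 * Ex Q (zcube G) ^+ 2)))).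
  apply: Ex_le => [||w].
  - exact: L2e.2.
  - apply: L1D; first by apply: L1Z; exact: L2e1.2.
    by apply: L1D; [apply: L1Z; exact: L2a.2|exact: L1_cst].
  - rewrite ee; set x := e1 w; set z := a w; set g := Ex Q _.
    by have := sqr_ge0 (x - (z - g)); have := sqr_ge0 (z + g); nra.
rewrite ExD; last 2 first.
- by apply: L1Z; exact: L2e1.2.
- by apply: L1D; [apply: L1Z; exact: L2a.2|exact: L1_cst].
rewrite ExD; [|by apply: L1Z; exact: L2a.2|exact: L1_cst].
rewrite (ExZ _ L2e1.2) (ExZ _ L2a.2) Ex_cst.
have h1 := hc L _ dL hu'k; rewrite -/r -/(e1 _) in h1.
have h2 := jensen_sq hk; rewrite -/y in h2.
set z := ft_ip _ _ _ in h1 *.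
rewrite [leRHS](_ : _ = 2 * (c * r * z) + (4 * (CA * y) + 4 * y)); last by ring.
apply: lerD; first by rewrite ler_pM2l.
by apply: lerD; rewrite ler_pM2l.
Qed.

Lemma smolyak_sup_le : exists C : R, forall L, (d.+1 <= L)%N ->
  (d.+1 == 1%N) || (1 < smolyak_cost b d.+1 L)%N ->
  (ereal_sup [set rmse P (fun w => smolyak (rules w) L) f | f in
     [set f : D.-tuple R -> R | sobolev_mix alpha ip f /\ (sobolev_mix_norm alpha ip f <= 1)%R]]
   <= (C * (ln (smolyak_cost b d.+1 L)%:R `^ (d%:R * (1 + alpha))
         / (smolyak_cost b d.+1 L)%:R `^ (alpha + 2^-1)))%:E)%E.
Proof.
have [c c0 hc] := smolyak_error_le.
have [C hC] := smolyak_rate d hb alpha0 c0.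
exists C => L dL cL; apply: ge_ereal_sup => _ [F [hF F1] <-].
have [[mX lX] hX] := hc L F dL hF F1.
rewrite /rmse expectation.unlock -(Ex_EFin lX) poweR_EFin lee_fin.
apply: le_trans (hC L dL cL); apply: ge0_ler_powR => //; rewrite ?nnegrE ?invr_ge0//.
- by apply: Ex_ge0 => w; exact: sqr_ge0.
- by rewrite !mulr_ge0 ?exprn_ge0.
Qed.

End SmolyakError.

Theorem corollary14 (R : realType)
    (b : nat) (hb : (1 < b)%N)
    (alpha : R) (halpha : 2^-1 < alpha < 1)
    (s d : nat) (hs : (0 < s)%N) (hd : (0 < d)%N)
    (ip : (R -> R) -> (R -> R) -> R) (hip : sobolev_inner_product alpha ip)
    (p : forall (n : 'I_d) (m : nat), 'I_(b ^ m) -> s.-tuple R)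
    (hp_inj : forall n m, injective (p n m))
    (hp_net : forall n m, is_net b m (range (p n m)))
    (d0 : measure_display) (Omega : measurableType d0) (P : probability Omega R)
    (pi : 'I_d -> nat -> 'I_s -> seq 'I_b -> Omega -> {perm 'I_b})
    (xi : 'I_d -> forall m : nat, 'I_s -> 'I_(b ^ m) -> Omega -> R)
    (hrand : independently_randomized P pi xi) :
  let D := (s * d)%N in
  let U (w : Omega) (n : 'I_d) :=
    scrambled_rule hb (p n) (fun m t prefix => pi n m t prefix w)
      (fun m t i => xi n m t i w) in
  let A (L : nat) (w : Omega) := smolyak (U w) L in
  let N (L : nat) := smolyak_cost b d L in
  (exists K : R, forall f : D.-tuple R -> R, sobolev_mix alpha ip f ->
     haar_space b alpha f /\
     haar_norm b alpha f <= K * sobolev_mix_norm alpha ip f) /\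
  (exists C : R, forall L : nat, (d <= L)%N -> (d == 1%N) || (1 < N L)%N ->
     (ereal_sup [set rmse P (A L) f | f in
        [set f : D.-tuple R -> R | sobolev_mix alpha ip f /\
                                   (sobolev_mix_norm alpha ip f <= 1)%R]]
      <= (C * (ln (N L)%:R `^ ((d.-1)%:R * (1 + alpha))
             / (N L)%:R `^ (alpha + 2^-1)))%:E)%E).
Proof.
move=> D U A N.
have alpha0 : 0 < alpha by case/andP: halpha => + _; apply: lt_trans; rewrite invr_gt0.
split; first exact: haar_embedding.
case: d hd p hp_inj hp_net pi xi hrand @D @U @A @N => [//|d'] _ p hp_inj hp_net pi xi hrand D U A N.
exact: (smolyak_sup_le hb hs hp_inj hp_net hrand alpha0 hip).
Qed.
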